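(* Let $R$ be a commutative ring with $1$, $q\in R$ invertible and $\mathcal{H}=\mathcal{H}_{R,q}(\mathfrak{S}_n)$. Suppose $\lambda=(\lambda_1,\ldots,\lambda_a)$ is a partition of $n$ and $\nu=(\nu_1,\ldots,\nu_b)$ is a composition of $n$. Let $\mathsf{S}\in\mathcal{T}_{\mathrm r}(\lambda,\nu)$. (1) Suppose $1\le r\le a-1$ and $1\le d\le b$. Let $\mathcal{G}$ be the set of sequences $g=(g_1,\ldots,g_b)$ of non-negative integers with $g_d=0$, $\bar g=\mathsf{S}^d_{r+1}$ and $g_i\le \mathsf{S}^i_r$ for $1\le i\le b$. For $g\in\mathcal{G}$, let $\mathsf{U}_g$ be the row-standard tableau formed from $\mathsf{S}$ by moving all entries equal to $d$ from row $r+1$ to row $r$ and, for $i\ne d$, moving $g_i$ entries equal to $i$ from row $r$ to row $r+1$. Then $$\Theta_{\mathsf{S}}=(-1)^{\mathsf{S}^d_{r+1}}q^{-\binom{\mathsf{S}^d_{r+1}+1}{2}}q^{-\mathsf{S}^d_{r+1}\mathsf{S}^{<d}_{r+1}}\sum_{g\in\mathcal{G}}q^{\bar g_{d-1}}\prod_{i=1}^b q^{g_i\mathsf{S}^{<i}_{r+1}}{\mathsf{S}^i_{r+1}+g_i\brack g_i}\Theta_{\mathsf{U}_g}.$$ (2) Suppose $1\le r\le a-1$, $\lambda_r=\lambda_{r+1}$ and $1\le d\le b$. Let $\mathcal{G}$ be the set of sequences $g=(g_1,\ldots,g_b)$ of non-negative integers with $g_d=0$, $\bar g=\mathsf{S}^d_r$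 and $g_i\le\mathsf{S}^i_{r+1}$ for $1\le i\le b$. For $g\in\mathcal{G}$, let $\mathsf{U}_g$ be the row-standard tableau formed from $\mathsf{S}$ by moving all entries equal to $d$ from row $r$ to row $r+1$ and, for $i\ne d$, moving $g_i$ entries equal to $i$ from row $r+1$ to row $r$. Then $$\Theta_{\mathsf{S}}=(-1)^{\mathsf{S}^d_r}q^{-\binom{\mathsf{S}^d_r}{2}}q^{-\mathsf{S}^d_r\mathsf{S}^{>d}_r}\sum_{g\in\mathcal{G}}q^{-\bar g_{d-1}}\prod_{i=1}^b q^{g_i\mathsf{S}^{>i}_r}{\mathsf{S}^i_r+g_i\brack g_i}\Theta_{\mathsf{U}_g}.$$
   Context: Hecke algebra: $\mathcal{H}=\mathcal{H}_{R,q}(\mathfrak{S}_n)$ is the unital associative $R$-algebra with generators $T_1,\ldots,T_{n-1}$ and relations $T_iT_j=T_jT_i$ ($1\le i<j-1\le n-2$), $T_iT_{i+1}T_i=T_{i+1}T_iT_{i+1}$ ($1\le i\le n-2$), $(T_i+1)(T_i-q)=0$ ($1\le i\le n-1$). Permutations act on the right (products are read left to right). If $w=(i_1,i_1+1)\cdots(i_k,i_k+1)$ with $k$ minimal, then $T_w=T_{i_1}\cdots T_{i_k}$; $\{T_w\}$ is an $R$-basis of $\mathcal{H}$. Compositions and tableaux: a composition of $n$ is a finite sequence of non-negative integers with sum $n$; a partition is a weakly decreasing composition. $\lambda\unrhd\mu$ means $\sum_{i\le j}\lambda_i\ge\sum_{i\le j}\mu_i$ for all $j$; $\lambda\rhd\mu$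 means in addition $\lambda\ne\mu$. $[\mu]=\{(r,c)\mid 1\le c\le\mu_r\}$. $\mathcal{T}(\mu)$ is the set of fillings of $[\mu]$ containing each of $1,\ldots,n$ exactly once; $\mathfrak{t}^\mu\in\mathcal{T}(\mu)$ has $1,\ldots,n$ entered in order along the rows, from top to bottom. $\mathfrak{S}_n$ acts on the right on $\mathcal{T}(\mu)$ by permuting entries; $d(\mathfrak{t})$ is defined by $\mathfrak{t}=\mathfrak{t}^\mu d(\mathfrak{t})$. $\mathfrak{S}_\mu$ is the row stabilizer of $\mathfrak{t}^\mu$. $\mathrm{RStd}(\mu)\subseteq\mathcal{T}(\mu)$ is the set of tableaux with entries increasing along rows; for a partition $\mu$, $\mathrm{Std}(\mu)$ is the subset of those with entries also increasing down columns. Modules: $m_\mu=\sum_{w\in\mathfrak{S}_\mu}T_w$, $M^\mu=m_\mu\mathcal{H}$ (right module). Let $*$ be the anti-automorphism with $T_i^*=T_i$; for $\mathfrak{s},\mathfrak{t}\in\mathrm{RStd}(\nu)$ put $m_{\mathfrak{s}\mathfrak{t}}=T_{d(\mathfrak{s})}^*m_\nu T_{d(\mathfrak{t})}$. For a partition $\lambda$ of $n$, $\mathcal{H}^{\rhd\lambda}$ is the two-sided ideal with $R$-basis all $m_{\mathfrak{s}\mathfrak{t}}$, $\mathfrak{s},\mathfrak{t}\in\mathrm{Std}(\nu)$, $\nu$ a partition of $n$ with $\nu\rhd\lambda$. The Specht module $S^\lambda$ is the right submodule of $\mathcal{H}/\mathcal{H}^{\rhd\lambda}$ generated by $\mathcal{H}^{\rhd\lambda}+m_\lambda$.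 Homomorphisms: a $\lambda$-tableau (filling of $[\lambda]$ by positive integers) has type $\nu$ if each $i$ appears $\nu_i$ times. $\mathcal{T}_{\mathrm r}(\lambda,\nu)$ is the set of row-standard (non-decreasing along rows) $\lambda$-tableaux of type $\nu$. For $\mathfrak{s}\in\mathcal{T}(\lambda)$, $\nu(\mathfrak{s})$ is obtained by replacing each entry by its row index in $\mathfrak{t}^\nu$. For $\mathsf{S}\in\mathcal{T}_{\mathrm r}(\lambda,\nu)$, $\Theta_{\mathsf{S}}:M^\nu\to S^\lambda$ is the $\mathcal{H}$-homomorphism with $\Theta_{\mathsf{S}}(m_\nu)=\mathcal{H}^{\rhd\lambda}+\sum_{\mathfrak{s}\in\mathrm{RStd}(\lambda),\,\nu(\mathfrak{s})=\mathsf{S}}m_\lambda T_{d(\mathfrak{s})}$. Notation: $\mathsf{S}^i_j$ is the number of entries equal to $i$ in row $j$ of $\mathsf{S}$; $\mathsf{S}^{<i}_j$, $\mathsf{S}^{>i}_j$ are the numbers of entries in row $j$ less than, greater than $i$. For a sequence $g$, $\bar g_k=\sum_{i=1}^kg_i$ and $\bar g=\sum_i g_i$. $[m]=1+q+\cdots+q^{m-1}$, $[0]!=1$, $[m]!=[m][m-1]!$, and for $m\ge k\ge0$, ${m\brack k}=\frac{[m]!}{[k]![m-k]!}$ is the Gaussian binomial (a polynomial in $q$, evaluated in $R$); ${m\brack k}=0$ if $m\ge k\ge 0$ fails. An empty sum is $0$. Rows of a tableau may be reordered to make it row-standard. *)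

(* Defs.v *)
From HB Require Import structures.
From mathcomp Require Import all_boot all_order all_fingroup all_algebra.
From mathcomp Require Import boolp ring.

Set Implicit Arguments.
Unset Strict Implicit.
Unset Printing Implicit Defensive.

Import GRing.Theory.

Local Open Scope ring_scope.
Local Open Scope quotient_scope.

(* Right modules over a ring A are left modules over the converse ring A^c:
   the action v . h is written (h : A^c) *: v.  The right regular module of A
   is (A^c)^o. *)

Section CyclicSubmodule.
Variables (B : pzRingType) (V : lmodType B) (v : V).

Definition in_cyclic : {pred V} := [pred x | `[< exists h, x = h *: v >]].

Fact in_cyclic_submod : submod_closed in_cyclic.
Proof.
split=> [|a x y]; first by apply/asboolP; exists 0; rewrite scale0r.
move=> /asboolP[h ->] /asboolP[k ->]; apply/asboolP.
by exists (a * h + k); rewrite scalerDl scalerA.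
Qed.

HB.instance Definition _ := GRing.isSubmodClosed.Build B V in_cyclic
  in_cyclic_submod.

Record cyclic : predArgType :=
  Cyclic { cyclic_val :> V; _ : cyclic_val \in in_cyclic }.

HB.instance Definition _ := [isSub for cyclic_val].
HB.instance Definition _ := [Choice of cyclic by <:].
HB.instance Definition _ := [SubChoice_isSubLmodule of cyclic by <:].

Fact cyclic_gen_subproof : v \in in_cyclic.
Proof. by apply/asboolP; exists 1; rewrite scale1r. Qed.

Definition cyclic_gen : cyclic := Cyclic cyclic_gen_subproof.

End CyclicSubmodule.

Section IdealQuotient.
Variables (A : pzRingType) (G : A -> Prop).

Inductive tsideal : A -> Prop :=
  | tsideal_gen x : G x -> tsideal x
  | tsideal0 : tsideal 0
  | tsidealD x y : tsideal x -> tsideal y -> tsideal (x + y)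
  | tsidealMl a x : tsideal x -> tsideal (a * x)
  | tsidealMr a x : tsideal x -> tsideal (x * a).

Lemma tsideal_min (J : A -> Prop) : (forall x, G x -> J x) -> J 0 ->
    (forall x y, J x -> J y -> J (x + y)) ->
    (forall a x, J x -> J (a * x)) -> (forall a x, J x -> J (x * a)) ->
  forall x, tsideal x -> J x.
Proof. by move=> JG J0 JD Jl Jr x; elim=> *; auto. Qed.

Definition in_tsideal : {pred A} := [pred x | `[< tsideal x >]].

Fact in_tsideal_zmod : zmod_closed in_tsideal.
Proof.
split=> [|x y /asboolP hx /asboolP hy]; apply/asboolP; first exact: tsideal0.
by apply: tsidealD => //; rewrite -mulN1r; apply: tsidealMl.
Qed.

HB.instance Definition _ := GRing.isZmodClosed.Build A in_tsideal
  in_tsideal_zmod.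

Definition ideal_quot : Type := Quotient.quot in_tsideal.

HB.instance Definition _ := GRing.Zmodule.on ideal_quot.

Definition ideal_pi (x : A) : ideal_quot := \pi_(Quotient.quot in_tsideal) x.

Definition ideal_quot_act (h : A^c) (x : ideal_quot) : ideal_quot :=
  ideal_pi ((generic_quotient.repr (x : Quotient.quot in_tsideal) : A) * (h : A)).

Lemma ideal_piP x y : reflect (ideal_pi x = ideal_pi y) (x - y \in in_tsideal).
Proof. by rewrite Quotient.idealrBE; apply: eqP. Qed.

Lemma ideal_piD x y : ideal_pi (x + y) = ideal_pi x + ideal_pi y.
Proof. exact: (raddfD \pi_(Quotient.quot in_tsideal)). Qed.

Lemma ideal_pi_surj (x : ideal_quot) : exists y, x = ideal_pi y.
Proof. by exists (generic_quotient.repr (x : Quotient.quot in_tsideal)); rewrite /ideal_pi reprK. Qed.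

Lemma ideal_quot_actE (h : A^c) x :
  ideal_quot_act h (ideal_pi x) = ideal_pi ((x : A) * (h : A)).
Proof.
apply/ideal_piP; rewrite -mulrBl; apply/asboolP/tsidealMr/asboolP.
by apply/ideal_piP; rewrite {1}/ideal_pi reprK.
Qed.

Fact ideal_quot_actA (h k : A^c) x :
  ideal_quot_act h (ideal_quot_act k x) = ideal_quot_act (h * k) x.
Proof.
by have [y ->] := ideal_pi_surj x; rewrite !ideal_quot_actE mulrA.
Qed.

Fact ideal_quot_act1 : left_id 1 ideal_quot_act.
Proof.
by move=> x; have [y ->] := ideal_pi_surj x; rewrite ideal_quot_actE mulr1.
Qed.

Fact ideal_quot_actDr : right_distributive ideal_quot_act +%R.
Proof.
move=> h x y; have [x' ->] := ideal_pi_surj x; have [y' ->] := ideal_pi_surj y.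
by rewrite -ideal_piD !ideal_quot_actE mulrDl ideal_piD.
Qed.

Fact ideal_quot_actDl x : {morph ideal_quot_act^~ x : h k / h + k}.
Proof.
move=> h k; have [y ->] := ideal_pi_surj x.
by rewrite !ideal_quot_actE mulrDr ideal_piD.
Qed.

HB.instance Definition _ := GRing.Zmodule_isLmodule.Build A^c ideal_quot
  ideal_quot_actA ideal_quot_act1 ideal_quot_actDr ideal_quot_actDl.

End IdealQuotient.

(* The Hecke algebra is the algebra given by generators and relations:
   terms in the generators T_i modulo the least congruence containing the
   axioms of associative unital R-algebras and the defining relations.  The
   index i : 'I_n.-1 stands for T_(i+1). *)

Section HeckeTerms.
Variables (R : comPzRingType) (q : R) (n : nat).

Inductive hterm : Type :=
  | HScal of R
  | HGen of 'I_n.-1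
  | HAdd of hterm & hterm
  | HMul of hterm & hterm.

Inductive hrel : hterm -> hterm -> Prop :=
  | hrel_refl x : hrel x x
  | hrel_sym x y : hrel x y -> hrel y x
  | hrel_trans x y z : hrel x y -> hrel y z -> hrel x z
  | hrel_add x x' y y' : hrel x x' -> hrel y y' -> hrel (HAdd x y) (HAdd x' y')
  | hrel_mul x x' y y' : hrel x x' -> hrel y y' -> hrel (HMul x y) (HMul x' y')
  | hrel_addA x y z : hrel (HAdd x (HAdd y z)) (HAdd (HAdd x y) z)
  | hrel_addC x y : hrel (HAdd x y) (HAdd y x)
  | hrel_add0 x : hrel (HAdd (HScal 0) x) x
  | hrel_addN x : hrel (HAdd (HMul (HScal (-1)) x) x) (HScal 0)
  | hrel_mulA x y z : hrel (HMul x (HMul y z)) (HMul (HMul x y) z)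
  | hrel_mul1l x : hrel (HMul (HScal 1) x) x
  | hrel_mul1r x : hrel (HMul x (HScal 1)) x
  | hrel_mulDl x y z : hrel (HMul (HAdd x y) z) (HAdd (HMul x z) (HMul y z))
  | hrel_mulDr x y z : hrel (HMul x (HAdd y z)) (HAdd (HMul x y) (HMul x z))
  | hrel_scalD a b : hrel (HScal (a + b)) (HAdd (HScal a) (HScal b))
  | hrel_scalM a b : hrel (HScal (a * b)) (HMul (HScal a) (HScal b))
  | hrel_scalC a x : hrel (HMul (HScal a) x) (HMul x (HScal a))
  | hrel_comm (i j : 'I_n.-1) : (i.+1 < j)%N ->
      hrel (HMul (HGen i) (HGen j)) (HMul (HGen j) (HGen i))
  | hrel_braid (i j : 'I_n.-1) : j = i.+1 :> nat ->
      hrel (HMul (HMul (HGen i) (HGen j)) (HGen i))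
           (HMul (HMul (HGen j) (HGen i)) (HGen j))
  | hrel_quad (i : 'I_n.-1) :
      hrel (HMul (HAdd (HGen i) (HScal 1)) (HAdd (HGen i) (HScal (- q))))
           (HScal 0).

HB.instance Definition _ := gen_eqMixin hterm.
HB.instance Definition _ := gen_choiceMixin hterm.

Definition hrelb : rel hterm := fun x y => `[< hrel x y >].

Fact hrelb_equiv : equiv_class_of hrelb.
Proof.
split=> [x|x y|y x z]; first exact/asboolP/hrel_refl.
  by apply/asboolP/asboolP; apply: hrel_sym.
by move=> /asboolP xy /asboolP yz; apply/asboolP; apply: hrel_trans yz.
Qed.

Canonical hrelb_equiv_rel := EquivRelPack hrelb_equiv.
Canonical hrelb_encModRel := defaultEncModRel hrelb.

End HeckeTerms.

Section HeckeAlgebra.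
Variables (R : comPzRingType) (q : R) (n : nat).

Definition hecke : Type := {eq_quot (hrelb q (n := n))}.

HB.instance Definition _ := Choice.on hecke.

Definition hpi (t : hterm R n) : hecke := \pi_({eq_quot (hrelb q (n := n))}) t.
Definition hrepr (x : hecke) : hterm R n :=
  generic_quotient.repr (x : {eq_quot (hrelb q (n := n))}).

Lemma hreprK x : hpi (hrepr x) = x.
Proof. by rewrite /hpi /hrepr reprK. Qed.

Lemma hpiP s t : hpi s = hpi t <-> hrel q s t.
Proof.
split; first by move=> /eqquotP/asboolP.
by move=> h; apply/eqquotP/asboolP.
Qed.

Lemma hpi_surj x : exists t, x = hpi t.
Proof. by exists (hrepr x); rewrite hreprK. Qed.

Definition hscal (c : R) : hecke := hpi (HScal n c).
Definition hgen (i : 'I_n.-1) : hecke := hpi (HGen R i).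
Definition hadd (x y : hecke) : hecke := hpi (HAdd (hrepr x) (hrepr y)).
Definition hmul (x y : hecke) : hecke := hpi (HMul (hrepr x) (hrepr y)).
Definition hopp (x : hecke) : hecke := hmul (hscal (-1)) x.

Lemma haddE s t : hadd (hpi s) (hpi t) = hpi (HAdd s t).
Proof. by apply/hpiP/hrel_add; apply/hpiP; rewrite hreprK. Qed.

Lemma hmulE s t : hmul (hpi s) (hpi t) = hpi (HMul s t).
Proof. by apply/hpiP/hrel_mul; apply/hpiP; rewrite hreprK. Qed.

Let hE := (haddE, hmulE).

Local Ltac hlift := do ?move=> ?; repeat match goal with
  | x : hecke |- _ => let t := fresh in have [t ->] := hpi_surj x; clear x
  end; rewrite ?/hopp ?/hscal ?hE; apply/hpiP.

Fact haddA : associative hadd.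
Proof. by hlift; apply: hrel_addA. Qed.

Fact haddC : commutative hadd.
Proof. by hlift; apply: hrel_addC. Qed.

Fact hadd0 : left_id (hscal 0) hadd.
Proof. by hlift; apply: hrel_add0. Qed.

Fact haddN : left_inverse (hscal 0) hopp hadd.
Proof. by hlift; apply: hrel_addN. Qed.

HB.instance Definition _ :=
  GRing.isZmodule.Build hecke haddA haddC hadd0 haddN.

Fact hmulA : associative hmul.
Proof. by hlift; apply: hrel_mulA. Qed.

Fact hmul1l : left_id (hscal 1) hmul.
Proof. by hlift; apply: hrel_mul1l. Qed.

Fact hmul1r : right_id (hscal 1) hmul.
Proof. by hlift; apply: hrel_mul1r. Qed.

Fact hmulDl : left_distributive hmul hadd.
Proof. by hlift; apply: hrel_mulDl. Qed.

Fact hmulDr : right_distributive hmul hadd.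
Proof. by hlift; apply: hrel_mulDr. Qed.

HB.instance Definition _ := GRing.Zmodule_isPzRing.Build hecke
  hmulA hmul1l hmul1r hmulDl hmulDr.

Fact hscalD : {morph hscal : a b / a + b}.
Proof. by move=> a b; rewrite /GRing.add /= /hscal haddE; apply/hpiP/hrel_scalD. Qed.

Fact hscalM : {morph hscal : a b / a * b}.
Proof. by move=> a b; rewrite /GRing.mul /= /hscal hmulE; apply/hpiP/hrel_scalM. Qed.

Fact hscalC a x : hscal a * x = x * hscal a.
Proof.
by have [t ->] := hpi_surj x; rewrite /GRing.mul /= !hmulE; apply/hpiP/hrel_scalC.
Qed.

Fact hscale_subA (a b : R) (x : hecke) :
  hscal a * (hscal b * x) = hscal (a * b) * x.
Proof. by rewrite mulrA hscalM. Qed.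

Fact hscale_sub1 (x : hecke) : hscal 1 * x = x.
Proof. exact: mul1r. Qed.

Fact hscale_subDr (a : R) : {morph (fun x : hecke => hscal a * x) : x y / x + y}.
Proof. by move=> x y; rewrite mulrDr. Qed.

Fact hscale_subDl (x : hecke) : {morph (fun a => hscal a * x) : a b / a + b}.
Proof. by move=> a b; rewrite hscalD mulrDl. Qed.

HB.instance Definition _ := GRing.Zmodule_isLmodule.Build R hecke
  hscale_subA hscale_sub1 hscale_subDr hscale_subDl.

(* The library structure algType R requires 1 != 0, which fails when R is the
   zero ring; the next two lemmas are its compatibility axioms. *)
Lemma hscaleAl (a : R) (x y : hecke) : a *: (x * y) = (a *: x) * y.
Proof. exact: mulrA. Qed.

Lemma hscaleAr (a : R) (x y : hecke) : a *: (x * y) = x * (a *: y).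
Proof. by rewrite /GRing.scale /= mulrA hscalC -mulrA. Qed.

Lemma hscalE (a : R) : a *: (1 : hecke) = hscal a.
Proof. exact: mulr1. Qed.

Lemma hgen_comm (i j : 'I_n.-1) : (i.+1 < j)%N ->
  hgen i * hgen j = hgen j * hgen i.
Proof.
by move=> ij; rewrite /GRing.mul /= /hgen !hmulE; apply/hpiP/hrel_comm.
Qed.

Lemma hgen_braid (i j : 'I_n.-1) : j = i.+1 :> nat ->
  hgen i * hgen j * hgen i = hgen j * hgen i * hgen j.
Proof.
by move=> ij; rewrite /GRing.mul /= /hgen !hmulE; apply/hpiP/hrel_braid.
Qed.

Lemma hgen_quad (i : 'I_n.-1) : (hgen i + 1) * (hgen i - q *: (1 : hecke)) = 0.
Proof.
have -> : - (q *: (1 : hecke)) = hscal (- q).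
  by rewrite -scaleNr hscalE.
rewrite /GRing.mul /GRing.add /= /hgen /hscal !haddE hmulE.
exact/hpiP/hrel_quad.
Qed.

Section Lift.
Variables (A : pzRingType) (phi : R -> A) (t : 'I_n.-1 -> A).

Fixpoint hterm_eval (s : hterm R n) : A :=
  match s with
  | HScal c => phi c
  | HGen i => t i
  | HAdd x y => hterm_eval x + hterm_eval y
  | HMul x y => hterm_eval x * hterm_eval y
  end.

Definition hecke_lift (x : hecke) : A := hterm_eval (hrepr x).

Hypotheses (phi1 : phi 1 = 1) (phiD : {morph phi : a b / a + b}).
Hypotheses (phiM : {morph phi : a b / a * b}).
Hypothesis phiC : forall a x, phi a * x = x * phi a.
Hypothesis t_comm : forall i j : 'I_n.-1, (i.+1 < j)%N -> t i * t j = t j * t i.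
Hypothesis t_braid : forall i j : 'I_n.-1, j = i.+1 :> nat ->
  t i * t j * t i = t j * t i * t j.
Hypothesis t_quad : forall i, (t i + 1) * (t i - phi q) = 0.

Lemma hterm_eval_rel s s' : hrel q s s' -> hterm_eval s = hterm_eval s'.
Proof.
have phi0 : phi 0 = 0 by apply: (addrI (phi 0)); rewrite -phiD !addr0.
have phiN a : phi (- a) = - phi a.
  by apply: (addrI (phi a)); rewrite -phiD !subrr.
elim=> //=; intros.
- by rewrite H0.
- by rewrite H0 H2.
- by rewrite H0 H2.
- exact: addrA.
- exact: addrC.
- by rewrite phi0 add0r.
- by rewrite phiN phi1 mulN1r addNr.
- exact: mulrA.
- by rewrite phi1 mul1r.
- by rewrite phi1 mulr1.
- exact: mulrDl.
- exact: mulrDr.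
- by rewrite phi1 phiN t_quad phi0.
Qed.

Lemma hecke_lift_pi s : hecke_lift (hpi s) = hterm_eval s.
Proof. by apply: hterm_eval_rel; apply/hpiP; rewrite hreprK. Qed.

Lemma hecke_lift_scal c : hecke_lift (c *: (1 : hecke)) = phi c.
Proof. by rewrite hscalE hecke_lift_pi. Qed.

Lemma hecke_lift_gen i : hecke_lift (hgen i) = t i.
Proof. exact: hecke_lift_pi. Qed.

Lemma hecke_liftD : {morph hecke_lift : x y / x + y}.
Proof.
move=> x y; have [s ->] := hpi_surj x; have [u ->] := hpi_surj y.
by rewrite /(_ + _) /= haddE !hecke_lift_pi.
Qed.

Lemma hecke_liftM : {morph hecke_lift : x y / x * y}.
Proof.
move=> x y; have [s ->] := hpi_surj x; have [u ->] := hpi_surj y.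
by rewrite /(_ * _) /= hmulE !hecke_lift_pi.
Qed.

Lemma hecke_lift_uniq (f : hecke -> A) :
    (forall c, f (c *: (1 : hecke)) = phi c) -> (forall i, f (hgen i) = t i) ->
    {morph f : x y / x + y} -> {morph f : x y / x * y} ->
  f =1 hecke_lift.
Proof.
move=> fs fg fD fM x; have [s ->] := hpi_surj x; rewrite hecke_lift_pi.
elim: s => [c|i|s IHs u IHu|s IHs u IHu] /=.
- by rewrite -fs hscalE.
- by rewrite -fg.
- by rewrite -haddE -IHs -IHu -fD.
- by rewrite -hmulE -IHs -IHu -fM.
Qed.

End Lift.

(* The anti-automorphism *, as an algebra morphism to the converse ring. *)
Definition hstar (x : hecke) : hecke :=
  hecke_lift (A := hecke^c) hscal hgen x.

Fact hscalMc : {morph (hscal : R -> hecke^c) : a b / a * b}.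
Proof. by move=> a b; rewrite mulrC; apply: hscalM. Qed.

Fact hstar_rels (g := hgen : 'I_n.-1 -> hecke^c) (sc := hscal : R -> hecke^c) :
  [/\ forall a x, sc a * x = x * sc a,
      forall i j : 'I_n.-1, (i.+1 < j)%N -> g i * g j = g j * g i,
      forall i j : 'I_n.-1, j = i.+1 :> nat ->
        g i * g j * g i = g j * g i * g j &
      forall i, (g i + 1) * (g i - sc q) = 0].
Proof.
split.
- by move=> a x; exact: (esym (hscalC a x)).
- by move=> i j ij; exact: (esym (hgen_comm ij)).
- by move=> i j ij; have := hgen_braid ij; rewrite -[RHS]mulrA -mulrA.
move=> i; have := hgen_quad i; rewrite hscalE => h.
suff H : (hgen i - hscal q) * (hgen i + 1) = 0 :> hecke by exact: H.
rewrite -[RHS]h !mulrDl !mulrDr !mulr1 !mul1r mulNr hscalC mulrN.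
by rewrite addrACA.
Qed.

Lemma hstarD : {morph hstar : x y / x + y}.
Proof.
case: hstar_rels => h1 h2 h3 h4.
exact: (hecke_liftD (A := hecke^c) (erefl 1) hscalD hscalMc h1 h2 h3 h4).
Qed.

Lemma hstarM x y : hstar (x * y) = hstar y * hstar x.
Proof.
case: hstar_rels => h1 h2 h3 h4.
exact: (hecke_liftM (A := hecke^c) (erefl 1) hscalD hscalMc h1 h2 h3 h4).
Qed.

Lemma hstar_scal c : hstar (c *: (1 : hecke)) = c *: (1 : hecke).
Proof.
case: hstar_rels => h1 h2 h3 h4; rewrite [RHS]hscalE.
exact: (hecke_lift_scal (A := hecke^c) (erefl 1) hscalD hscalMc h1 h2 h3 h4).
Qed.

Lemma hstar_gen i : hstar (hgen i) = hgen i.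
Proof.
case: hstar_rels => h1 h2 h3 h4.
exact: (hecke_lift_gen (A := hecke^c) (erefl 1) hscalD hscalMc h1 h2 h3 h4).
Qed.

End HeckeAlgebra.

Section ReducedWords.
Variable n : nat.

Fact adj_lo_subproof (i : 'I_n.-1) : (i < n)%N.
Proof. by apply: leq_trans (ltn_ord i) (leq_pred n). Qed.

Fact adj_hi_subproof (i : 'I_n.-1) : (i.+1 < n)%N.
Proof. by case: i => i /=; case: n. Qed.

Definition adj_tperm (i : 'I_n.-1) : 'S_n :=
  tperm (Ordinal (adj_lo_subproof i)) (Ordinal (adj_hi_subproof i)).

(* In 'S_n the product s * t is "first s, then t", as for a right action. *)
Definition word_perm (s : seq 'I_n.-1) : 'S_n :=
  (\prod_(i <- s) adj_tperm i)%g.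

Lemma word_perm_ex w : exists s, word_perm s = w.
Proof.
have mulP u v : (exists s, word_perm s = u) -> (exists s, word_perm s = v) ->
    exists s, word_perm s = (u * v)%g.
  by move=> [s <-] [t <-]; exists (s ++ t); rewrite /word_perm big_cat.
have oneP : exists s, word_perm s = 1%g by exists [::]; rewrite /word_perm big_nil.
have adjP (x y : 'I_n) : y = x.+1 :> nat -> exists s, word_perm s = tperm x y.
  move=> yx; have xn : (x < n.-1)%N.
    by rewrite -ltnS -yx prednK ?(leq_ltn_trans _ (ltn_ord y)) // yx.
  exists [:: Ordinal xn]; rewrite /word_perm big_seq1 /adj_tperm.
  by congr tperm; apply: val_inj.
have ltP (x : 'I_n) k (y : 'I_n) : y = (x + k.+1)%N :> nat ->
    exists s, word_perm s = tperm x y.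
  elim: k y => [|k IHk] y yE; first by apply: adjP; rewrite yE addn1.
  have zn : (x + k.+1 < n)%N by rewrite (leq_trans _ (ltn_ord y)) // yE ltnS leq_add2l.
  pose z := Ordinal zn.
  have yz : y = z.+1 :> nat by rewrite yE addnS.
  have -> : tperm x y = (tperm z y * (tperm x z * tperm z y))%g.
    rewrite mulgA -[X in (X * _ * _)%g]tpermV -mulgA -[RHS]/(tperm x z ^ tperm z y)%g.
    have xz : (x == z) = false by rewrite -val_eqE /= ltn_eqF // addnS ltnS leq_addr.
    have xy : (x == y) = false by rewrite -val_eqE /= yE ltn_eqF // addnS ltnS leq_addr.
    by rewrite tpermJ tpermL tpermD // eq_sym ?xz ?xy.
  by apply: (mulP _ _ (adjP _ _ yz)); apply: mulP (IHk z _) (adjP _ _ yz).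
have tpermP (x y : 'I_n) : exists s, word_perm s = tperm x y.
  case: (ltngtP x y) => [xy|yx|/val_inj ->]; last by rewrite tperm1.
    by apply: (ltP x (y - x).-1); rewrite prednK ?subn_gt0 // subnKC // ltnW.
  rewrite tpermC.
  by apply: (ltP y (x - y).-1); rewrite prednK ?subn_gt0 // subnKC // ltnW.
have [ts -> _] := prod_tpermP w.
by elim: ts => [|t ts IH]; rewrite ?big_nil // big_cons; apply: mulP (tpermP _ _) IH.
Qed.

Definition has_word (w : 'S_n) (k : nat) : bool :=
  [exists s : k.-tuple 'I_n.-1, word_perm s == w].

Fact has_word_ex w : exists k, has_word w k.
Proof.
have [s <-] := word_perm_ex w.
by exists (size s); apply/existsP; exists (in_tuple s).
Qed.

Definition perm_len (w : 'S_n) : nat := ex_minn (has_word_ex w).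

Fact perm_lenP w : has_word w (perm_len w).
Proof. by rewrite /perm_len; case: ex_minnP. Qed.

Definition reduced_word (w : 'S_n) : seq 'I_n.-1 :=
  xchoose (existsP (perm_lenP w)).

Lemma reduced_wordK w : word_perm (reduced_word w) = w.
Proof. exact/eqP/(xchooseP (existsP (perm_lenP w))). Qed.

Lemma size_reduced_word w : size (reduced_word w) = perm_len w.
Proof. exact: size_tuple. Qed.

Lemma perm_len_min s : (perm_len (word_perm s) <= size s)%N.
Proof.
rewrite /perm_len; case: ex_minnP => k _; apply.
by apply/existsP; exists (in_tuple s).
Qed.

End ReducedWords.

(* T_w does not depend on the choice of the reduced word, by Matsumoto's
   theorem. *)
Definition Tperm (R : comPzRingType) (q : R) (n : nat) (w : 'S_n) : hecke q n :=
  \prod_(i <- reduced_word w) hgen q i.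

Section Compositions.
Variable n : nat.

Record composition := Composition {
  cparts :> seq nat;
  cparts_sum : sumn cparts = n
}.

Definition is_partition (mu : composition) : bool := sorted geq mu.

Definition dominates (la mu : composition) : Prop :=
  forall j, (sumn (take j mu) <= sumn (take j la))%N.

(* Compositions differing only by trailing zeros are regarded as equal. *)
Definition sdominates (la mu : composition) : Prop :=
  dominates la mu /\ exists i, nth 0%N la i <> nth 0%N mu i.

Definition node (mu : seq nat) := {r : 'I_(size mu) & 'I_(nth 0%N mu r)}.

Definition noderow (mu : seq nat) (x : node mu) : nat := tag x.
Definition nodecol (mu : seq nat) (x : node mu) : nat := tagged x.

Lemma node_inj (mu : seq nat) (x y : node mu) :
  noderow x = noderow y -> nodecol x = nodecol y -> x = y.
Proof.
case: x y => [r c] [r' c'] /val_inj/= rr'; subst r'.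
by move=> /val_inj/= ->.
Qed.

(* Rows, columns and entries are numbered from 0: the entries of a tableau in
   T(mu) are the elements of 'I_n.  Since [mu] has n nodes, an injective
   filling contains each entry exactly once. *)
Record tableau (mu : composition) := Tableau {
  tab_fun :> {ffun node mu -> 'I_n};
  tab_inj : injectiveb tab_fun
}.

HB.instance Definition _ mu := [isSub for @tab_fun mu].
HB.instance Definition _ mu := [Finite of tableau mu by <:].

Section InitialTableau.
Variable mu : composition.

Fact tinit_subproof (x : node mu) :
  (flatten_index mu (noderow x) (nodecol x) < n)%N.
Proof.
rewrite -[X in (_ < X)%N](cparts_sum mu); exact: flatten_indexP (ltn_ord _).
Qed.

Definition tinit_fun : {ffun node mu -> 'I_n} :=
  [ffun x => Ordinal (tinit_subproof x)].

Fact node_row_subproof (k : 'I_n) : (reshape_index mu k < size mu)%N.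
Proof. by rewrite reshape_indexP // cparts_sum. Qed.

Fact node_col_subproof (k : 'I_n) :
  (reshape_offset mu k < nth 0%N mu (Ordinal (node_row_subproof k)))%N.
Proof. by rewrite reshape_offsetP // cparts_sum. Qed.

Definition node_of (k : 'I_n) : node mu :=
  Tagged (fun r : 'I_(size mu) => 'I_(nth 0%N mu r))
    (Ordinal (node_col_subproof k)).

Lemma node_ofK : cancel node_of tinit_fun.
Proof. by move=> k; apply: val_inj; rewrite ffunE /= reshape_indexK. Qed.

Lemma tinit_funK : cancel tinit_fun node_of.
Proof.
move=> x; have cP : (nodecol x < nth 0 mu (noderow x))%N := ltn_ord (tagged x).
apply: node_inj; rewrite /noderow /nodecol /= ffunE /=.
  by rewrite flatten_indexKl.
by rewrite flatten_indexKr.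
Qed.

Fact tinit_inj : injectiveb tinit_fun.
Proof. exact/injectiveP/(can_inj tinit_funK). Qed.

Definition tinit : tableau mu := Tableau tinit_inj.

Fact tact_inj (t : tableau mu) (w : 'S_n) : injectiveb [ffun x => w (t x)].
Proof.
apply/injectiveP=> x y; rewrite !ffunE => /perm_inj.
exact: (injectiveP _ (tab_inj t)).
Qed.

Definition tact (t : tableau mu) (w : 'S_n) : tableau mu := Tableau (tact_inj t w).

Fact tperm_of_inj (t : tableau mu) : injective (fun k => t (node_of k)).
Proof.
by move=> k l /(injectiveP _ (tab_inj t))/(can_inj node_ofK).
Qed.

Definition tabd (t : tableau mu) : 'S_n := perm (@tperm_of_inj t).

Lemma tabdE t : t = tact tinit (tabd t).
Proof.
by apply/val_inj/ffunP=> x; rewrite [RHS]ffunE permE [node_of _]tinit_funK.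
Qed.

Lemma tabd_uniq t w : t = tact tinit w -> w = tabd t.
Proof.
move=> ->; apply/permP=> k; rewrite permE /= ffunE.
by rewrite [tinit_fun _]node_ofK.
Qed.

Definition RStd : {set tableau mu} :=
  [set t : tableau mu | [forall x, forall y,
     (noderow x == noderow y) && (nodecol x < nodecol y)%N ==> (t x < t y)%N]].

Definition Std : {set tableau mu} :=
  [set t : tableau mu in RStd | [forall x, forall y,
     (nodecol x == nodecol y) && (noderow x < noderow y)%N ==> (t x < t y)%N]].

Definition row_of (k : 'I_n) : 'I_(size mu) := tag (node_of k).

Definition row_stab : {set 'S_n} :=
  [set w : 'S_n | [forall k, row_of (w k) == row_of k]].

End InitialTableau.
End Compositions.

(* A la-tableau of type nu has its entries in 'I_(size nu), the entry i
   standing for i + 1. *)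
Section TypedTableaux.
Variables (n : nat) (la nu : composition n).

Definition typed_tableau := {ffun node la -> 'I_(size nu)}.

Implicit Types (S : typed_tableau) (g : {ffun 'I_(size nu) -> 'I_n.+1}).

Definition rowstd_tableaux : {set typed_tableau} :=
  [set S : typed_tableau |
     [forall i : 'I_(size nu), #|[set x | S x == i]| == nth 0%N nu i] &&
     [forall x, forall y, (noderow x == noderow y) && (nodecol x < nodecol y)%N
        ==> (S x <= S y)%N]].

Definition tab_type (s : tableau la) : typed_tableau :=
  [ffun x => row_of nu (s x)].

Definition cnt S (i j : nat) : nat :=
  #|[set x | (noderow x == j) && (S x == i :> nat)]|.
Definition cnt_lt S (i j : nat) : nat :=
  #|[set x | (noderow x == j) && (S x < i)%N]|.
Definition cnt_gt S (i j : nat) : nat :=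
  #|[set x | (noderow x == j) && (S x > i)%N]|.

(* The sequences g with g_d = 0, sum equal to the number of entries d in row
   src, and g_i at most the number of entries i in row dst; the latter is at
   most n, so bounding g_i by n loses nothing. *)
Definition exch_seqs S (d : 'I_(size nu)) (src dst : nat) :
    {set {ffun 'I_(size nu) -> 'I_n.+1}} :=
  [set g : {ffun 'I_(size nu) -> 'I_n.+1} |
    [&& g d == 0 :> nat, \sum_i g i == cnt S d src
      & [forall i : 'I_(size nu), g i <= cnt S i dst]]]%N.

(* Multiplicities after moving all entries d from row src to row dst and, for
   i != d, moving g_i entries i from row dst to row src. *)
Definition exch_cnt S (d : 'I_(size nu)) (src dst : nat) g
    (i : 'I_(size nu)) (j : nat) : nat :=
  (if j == dst then
     if i == d then cnt S d dst + cnt S d src else cnt S i dst - g i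
   else if j == src then
     if i == d then 0 else cnt S i src + g i
   else cnt S i j)%N.

Definition row_word (c : 'I_(size nu) -> nat) : seq 'I_(size nu) :=
  flatten [seq nseq (c i) i | i <- enum 'I_(size nu)].

Definition exch S (d : 'I_(size nu)) (src dst : nat) g : typed_tableau :=
  [ffun x => nth d (row_word (exch_cnt S d src dst g ^~ (noderow x)))
               (nodecol x)].

Lemma count_row_word c i : count_mem i (row_word c) = c i.
Proof.
rewrite /row_word count_flatten -map_comp sumnE big_map big_enum /=.
rewrite (bigD1 i) //= count_nseq /= eqxx mul1n big1 ?addn0 // => j ji.
by rewrite count_nseq /= (negPf ji).
Qed.

Lemma size_row_word c : size (row_word c) = (\sum_i c i)%N.
Proof.
rewrite /row_word size_flatten /shape -map_comp sumnE big_map big_enum /=.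
by apply: eq_bigr => i _; rewrite size_nseq.
Qed.

Lemma row_word_sorted c : sorted leq (map val (row_word c)).
Proof.
rewrite (sorted_pairwise leq_trans) /row_word.
have: pairwise ltn (map val (enum 'I_(size nu))).
  by rewrite val_enum_ord -(sorted_pairwise ltn_trans) iota_ltn_sorted.
elim: (enum _) => //= i s IHs /andP[/allP is_lt /IHs ps].
rewrite map_cat pairwise_cat ps andbT; apply/andP; split; last first.
  by rewrite map_nseq; elim: (c i) => //= k ->; rewrite all_nseq leqnn orbT.
apply/allrelP=> x y /mapP[z /nseqP[-> _] ->].
move=> /mapP[u /flattenP[t /mapP[j js ->] /nseqP[-> _]] ->].
by apply/ltnW/is_lt/map_f.
Qed.

Lemma card_row j (P : pred nat) :
  #|[set x : node la | (noderow x == j) && P (nodecol x)]|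
  = count P (iota 0 (nth 0%N la j)).
Proof.
rewrite cardsE -sum1_card.
transitivity (\sum_(r < size la | r == j :> nat)
    \sum_(c < nth 0%N la r | P c) 1)%N.
  by rewrite sig_big_dep; apply: eq_bigl => -[r c].
have [jla|laj] := ltnP j (size la); last first.
  rewrite nth_default // big1 // => r /eqP rj.
  by have := ltn_ord r; rewrite rj ltnNge laj.
rewrite (big_pred1 (Ordinal jla)) => [|r] //.
rewrite -(big_mkord P (fun=> 1%N)) /= sum1_count.
by rewrite /index_iota subn0.
Qed.

Lemma sum_cnt S j : (\sum_(i < size nu) cnt S i j)%N = nth 0%N la j.
Proof.
have := card_row j xpredT; rewrite count_predT size_iota => <-.
rewrite -[RHS]sum1_card (partition_big S xpredT) //=; apply: eq_bigr => i _.
by rewrite sum1dep_card; apply: eq_card => x; rewrite !inE andbT.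
Qed.

Lemma sum_exch_cnt S d src dst g j : src != dst -> g \in exch_seqs S d src dst ->
  (\sum_i exch_cnt S d src dst g i j)%N = nth 0%N la j.
Proof.
rewrite inE => sd /and3P[/eqP gd0 /eqP gsum /forallP gle].
have gsum' : (\sum_(i | i != d) g i = cnt S d src)%N.
  by rewrite -gsum [in RHS](bigD1 d) //= gd0.
rewrite /exch_cnt -(sum_cnt S); have [->|jdst] := eqVneq j dst.
  rewrite [in LHS](bigD1 d) //= [in RHS](bigD1 d) //= eqxx -addnA; congr (_ + _)%N.
  rewrite -gsum' -big_split /=; apply: eq_bigr => i /negPf ->.
  by rewrite subnKC.
have [->|//] := eqVneq j src.
rewrite [in LHS](bigD1 d) //= [in RHS](bigD1 d) //= eqxx add0n -gsum' -big_split /=.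
by apply: eq_bigr => i /negPf ->; rewrite addnC.
Qed.

Lemma cnt_exch S d src dst g (i : 'I_(size nu)) j :
    src != dst -> g \in exch_seqs S d src dst ->
  cnt (exch S d src dst g) i j = exch_cnt S d src dst g i j.
Proof.
move=> sd gP; set w := row_word (exch_cnt S d src dst g ^~ j).
have sw : size w = nth 0%N la j by rewrite size_row_word sum_exch_cnt.
rewrite -[RHS](count_row_word (exch_cnt S d src dst g ^~ j)) -/w.
rewrite -[w in RHS](mkseq_nth d) count_map sw -card_row /cnt.
apply: eq_card => x; rewrite !inE ffunE.
by case: eqP => //= ->; rewrite -val_eqE.
Qed.

Lemma exch_rowstd S d (src dst : 'I_(size la)) g :
  src != dst -> g \in exch_seqs S d src dst ->
  S \in rowstd_tableaux -> exch S d src dst g \in rowstd_tableaux.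
Proof.
move=> sd gP; rewrite !inE => /andP[/forallP type_S _]; apply/andP; split.
  apply/forallP=> i; rewrite -(eqP (type_S i)); apply/eqP.
  have card_rows (U : typed_tableau) : #|[set x | U x == i]| = (\sum_(j < size la) cnt U i j)%N.
    rewrite -sum1_card (partition_big (fun x : node la => tag x) xpredT) //=.
    apply: eq_bigr => j _; rewrite sum1dep_card; apply: eq_card => x.
    by rewrite !inE andbC.
  rewrite !card_rows; under eq_bigr => j _ do rewrite cnt_exch //.
  rewrite (bigD1 dst) // [in RHS](bigD1 dst) //=.
  rewrite (bigD1 src) // [in RHS](bigD1 src) //= !addnA; congr (_ + _)%N.
    move: gP; rewrite inE => /and3P[_ _ /forallP/(_ i) gle].
    have sd' : (src == dst :> nat) = false := negPf sd.
    rewrite /exch_cnt !eqxx sd'; case: eqP => [->|_]; first by rewrite addn0.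
    by rewrite addnCA addnC subnK.
  apply: eq_bigr => j /andP[jd js].
  by rewrite /exch_cnt -![_ == _ :> nat]/(_ == _ :> 'I_(size la)) (negPf jd) (negPf js).
apply/forallP=> x; apply/forallP=> y; apply/implyP=> /andP[/eqP xy lt_xy].
rewrite !ffunE -xy; set w := row_word _.
have sw : size w = nth 0%N la (noderow y) by rewrite -xy size_row_word sum_exch_cnt.
have ys : (nodecol y < size w)%N by rewrite sw; apply: ltn_ord (tagged y).
have xs := ltn_trans lt_xy ys.
rewrite -!(nth_map d 0%N val) //.
apply: (sorted_leq_nth leq_trans leqnn) (ltnW lt_xy); last 2 first.
- by rewrite inE size_map.
- by rewrite inE size_map.
exact: row_word_sorted.
Qed.

End TypedTableaux.

Section GaussianBinomials.

Definition qint (m : nat) : {poly int} := \sum_(i < m) 'X^i.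
Definition qfact (m : nat) : {poly int} := \prod_(i < m) qint i.+1.

Definition qbinom_poly (m k : nat) : {poly int} :=
  if (k <= m)%N then qfact m %/ (qfact k * qfact (m - k)) else 0.

(* Evaluation at q of a polynomial with integer coefficients; R may be the
   zero ring, over which {poly R} is not available. *)
Definition int_eval (R : comPzRingType) (q : R) (p : {poly int}) : R :=
  \sum_(i < size p) (p`_i)%:~R * q ^+ i.

Definition qbinom (R : comPzRingType) (q : R) (m k : nat) : R :=
  int_eval q (qbinom_poly m k).

Lemma qint_monic m : qint m.+1 \is monic.
Proof.
have -> : qint m.+1 = \poly_(i < m.+1) 1.
  by rewrite poly_def; apply: eq_bigr => i _; rewrite scale1r.
by rewrite monicE lead_coef_poly ?oner_eq0.
Qed.

Lemma qfact_monic m : qfact m \is monic.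
Proof. by apply: monic_prod => i _; apply: qint_monic. Qed.

Lemma qfactS m : qfact m.+1 = qint m.+1 * qfact m.
Proof. by rewrite /qfact big_ord_recr mulrC. Qed.

Lemma qintD m k : qint (m + k) = qint m + 'X^m * qint k.
Proof.
rewrite /qint big_split_ord; congr (_ + _).
by rewrite mulr_sumr; apply: eq_bigr => i _; rewrite -exprD.
Qed.

Lemma qbinom_polyP m k : (k <= m)%N ->
  qbinom_poly m k * (qfact k * qfact (m - k)) = qfact m.
Proof.
have H l m' k' : (m' + k' < l)%N -> exists p : {poly int},
    p * (qfact k' * qfact m') = qfact (m' + k').
  elim: l m' k' => // l IH [|m'] [|k'] lt.
  - by exists 1; rewrite /qfact !big_ord0 !mulr1.
  - by exists 1; rewrite add0n {2}/qfact big_ord0 mulr1 mul1r.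
  - by exists 1; rewrite addn0 {1}/qfact big_ord0 !mul1r.
  have [|p pE] := IH m' k'.+1; first by rewrite -ltnS -addSn.
  have [|p' p'E] := IH m'.+1 k'; first by rewrite -ltnS -addnS.
  exists (p' + 'X^(k'.+1) * p).
  have -> : (m'.+1 + k'.+1)%N = (m' + k'.+1).+1 by rewrite addSn.
  have E : (k'.+1 + m'.+1 = (m' + k'.+1).+1)%N by rewrite addnC addSn.
  rewrite [in RHS]qfactS -E qintD [in RHS]mulrDl -[in X in _ = _ + X]pE.
  rewrite -addSnnS -p'E !qfactS; ring.
move=> km; have [|p pE] := H (m.+1) (m - k)%N k; first by rewrite subnK.
rewrite subnK // in pE; rewrite /qbinom_poly km -pE.
by rewrite Pdiv.IdomainMonic.mulpK // monicMl // ?qfact_monic.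
Qed.

End GaussianBinomials.

Section SpechtModules.
Variables (R : comPzRingType) (q : R) (n : nat).

Local Notation H := (hecke q n).

Definition m_elt (mu : composition n) : H :=
  \sum_(w in row_stab mu) Tperm q w.

Definition murphy (mu : composition n) (s t : tableau mu) : H :=
  hstar (Tperm q (tabd s)) * m_elt mu * Tperm q (tabd t).

Definition murphy_gt (la : composition n) (x : H) : Prop :=
  exists (nu : composition n) (s t : tableau nu),
    [/\ is_partition nu, sdominates nu la, s \in Std nu, t \in Std nu
      & x = murphy s t].

(* H^{> la} is the two-sided ideal generated by the m_st of strictly more
   dominant shape.  Any two-sided ideal which is the R-span of these m_st, in
   particular one having them as an R-basis, is equal to it: hecke_gt_span. *)
Definition hecke_gt (la : composition n) : H -> Prop := tsideal (murphy_gt la).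

Lemma hecke_gt_span (la : composition n) (J : H -> Prop) :
    (forall a x, J x -> J (a * x)) -> (forall a x, J x -> J (x * a)) ->
    (forall x, J x <-> exists s : seq (R * H),
       (forall p, p \in s -> murphy_gt la p.2) /\
       x = \sum_(p <- s) p.1 *: p.2) ->
  forall x, J x <-> hecke_gt la x.
Proof.
move=> Jl Jr JE x; split.
  move=> /JE[s [sP ->]] {x}; elim: s sP => [|p s IHs] sP.
    by rewrite big_nil; apply: tsideal0.
  rewrite big_cons; apply: tsidealD; last first.
    by apply: IHs => p' p's; apply: sP; rewrite inE p's orbT.
  rewrite -[p.2]mul1r hscaleAl; apply/tsidealMl/tsideal_gen/sP.
  by rewrite inE eqxx.
apply: (tsideal_min (J := J)) => // [y yP||y z /JE[s [sP ->]] /JE[t [tP ->]]].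
- apply/JE; exists [:: (1, y)]; split; last by rewrite big_seq1 scale1r.
  by move=> p; rewrite inE => /eqP ->.
- by apply/JE; exists [::]; split; last by rewrite big_nil.
apply/JE; exists (s ++ t); split; last by rewrite big_cat.
by move=> p; rewrite mem_cat => /orP[/sP|/tP].
Qed.

Definition hecke_quot (la : composition n) := ideal_quot (murphy_gt la).

Definition perm_module (mu : composition n) := cyclic (m_elt mu : (H^c)^o).

Definition specht (la : composition n) :=
  cyclic (ideal_pi (murphy_gt la) (m_elt la)).

(* Scalars act on right H-modules through R -> H, c |-> c 1. *)
Definition specht_scale (la : composition n) (c : R) (x : specht la) :
  specht la := ((c *: (1 : H)) : H^c) *: x.

Section Theta.
Variables (la nu : composition n) (S : typed_tableau la nu).

Definition theta_spec (f : {linear perm_module nu -> specht la}) : Prop :=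
  cyclic_val (f (cyclic_gen (m_elt nu : (H^c)^o))) =
  ideal_pi (murphy_gt la)
    (\sum_(s in RStd la | tab_type nu s == S) m_elt la * Tperm q (tabd s)).

Lemma theta_spec_uniq f g : theta_spec f -> theta_spec g -> f =1 g.
Proof.
move=> fP gP x; have [h xE] : exists h : H^c, x = h *: cyclic_gen _.
  have /asboolP[h xE] := valP x; exists h; exact: val_inj.
by rewrite xE !linearZ /=; congr (_ *: _); apply: val_inj; rewrite /= fP gP.
Qed.

(* Theta_S is the unique homomorphism described by theta_spec; the zero map is
   a default value. *)
Definition Theta : {linear perm_module nu -> specht la} :=
  match pselect (exists f, theta_spec f) with
  | left fP => projT1 (cid fP)
  | right _ => [the {linear perm_module nu -> specht la} of \0]
  end.

Lemma ThetaP : (exists f, theta_spec f) -> theta_spec Theta.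
Proof. by rewrite /Theta; case: pselect => // fP _; case: cid. Qed.

End Theta.
End SpechtModules.

(* Main.v *)
(* Theta_S(m_nu) is the class of the sum X_S of the T_w with w of type S: w sends
   cnt S i j elements of row j of la to row i of nu.  Relabelling
   k elements of row t of la as elements of the adjacent row s turns la into a
   composition mu whose sorting strictly dominates la, so m_mu lies in H^{> la}.
   Multiplying sums of T_w over left S_mu-stable sets on the left by the element C
   with m_la = C m_(la /\ mu) gives the multiplication rule of the q-Schur algebra for
   the divided power F^(k) that moves k entries between the two rows, hence for each
   k > 0 a relation between the X_U modulo H^{> la}.  Write F = F_< + F_d + F_>
   according to the entries moved, with D entries d; since the three parts q-commute,
   F_d^(D) is a combination of the F^(D-a-c) F_>^(c) F_<^(a).  Modulo H^{> la} only the
   terms with a + c = D survive: this is the theorem.  At the level of coefficients,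
   the inversion is a product of instances of the q-binomial theorem.  The second part
   is the mirror image of the first, all orders being reversed. *)

Require Import Defs.
From mathcomp Require Import all_boot all_order all_fingroup all_algebra.
From HB Require Import structures.
From mathcomp Require Import boolp zify ring.

Set Implicit Arguments.
Unset Strict Implicit.
Unset Printing Implicit Defensive.

Import GRing.Theory.

Local Open Scope ring_scope.

(** * Inversions and reduced words *)

(** The operators act on the type obtained from S by putting the D entries d of row t into row s; N
    counts what row t keeps. There F_d^(D) gives back S with a factor q^E, where E is D times the
    number of entries of row t before d. This factor is a unit, and dividing by it produces part of
    the negative powers of q. A function h records how many entries of each kind i other than d are
    brought into row t by F_> and F_<; F^(D-|h|) brings the rest. For each possible content M of row
    t the sum over all h is evaluated at once: the exponents are quadratic in h, but the products
    h_i h_j with i <> j cancel, so the sum becomes a product of one q-binomial sum per kind of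
    entry. For every M other than the content of row t in S, one of these sums has a factor 1 - 1.

    H^{> la} is given through partitions, whereas a row move yields an unsorted composition.
    Conjugation by some T_u, invertible because q is, passes from one to the other. *)

Section Inversions.
Variable n : nat.
Implicit Types (w : 'S_n) (i j : 'I_n.-1).

Definition adj_lo i : 'I_n := Ordinal (adj_lo_subproof i).
Definition adj_hi i : 'I_n := Ordinal (adj_hi_subproof i).

Definition ninv w : nat :=
  #|[set p : 'I_n * 'I_n | (p.1 < p.2)%N && (w p.2 < w p.1)%N]|.

Lemma adj_lo_hi i : (adj_lo i == adj_hi i) = false.
Proof. by rewrite -val_eqE /= ltn_eqF. Qed.

Lemma adj_tpermE i : adj_tperm i = tperm (adj_lo i) (adj_hi i).
Proof. by []. Qed.

Lemma adj_tpermL i : adj_tperm i (adj_lo i) = adj_hi i.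
Proof. exact: tpermL. Qed.

Lemma adj_tpermR i : adj_tperm i (adj_hi i) = adj_lo i.
Proof. exact: tpermR. Qed.

Lemma adj_tpermK i w : (adj_tperm i * (adj_tperm i * w))%g = w.
Proof. by rewrite mulgA tperm2 mul1g. Qed.

Lemma adj_perm_lo i w : (adj_tperm i * w)%g (adj_lo i) = w (adj_hi i).
Proof. by rewrite permM tpermL. Qed.

Lemma adj_perm_hi i w : (adj_tperm i * w)%g (adj_hi i) = w (adj_lo i).
Proof. by rewrite permM tpermR. Qed.

Lemma adj_perm_ltn i w : (w (adj_hi i) < w (adj_lo i))%N ->
  ((adj_tperm i * w)%g (adj_lo i) < (adj_tperm i * w)%g (adj_hi i))%N.
Proof. by rewrite adj_perm_lo adj_perm_hi. Qed.

Lemma adj_perm_neq i w : w (adj_lo i) != w (adj_hi i) :> nat.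
Proof. by rewrite val_eqE (inj_eq perm_inj) adj_lo_hi. Qed.

Lemma adj_tperm_ltn i (k l : 'I_n) :
    (k, l) != (adj_lo i, adj_hi i) -> (k, l) != (adj_hi i, adj_lo i) ->
  (adj_tperm i k < adj_tperm i l)%N = (k < l)%N.
Proof.
rewrite !xpair_eqE adj_tpermE !permE /= -!val_eqE /= !(fun_if (@nat_of_ord n)) /=.
move: (nat_of_ord k) (nat_of_ord l) (nat_of_ord i) => a b c.
by case: (eqVneq a c); case: (eqVneq b c); case: (eqVneq a c.+1);
  case: (eqVneq b c.+1); lia.
Qed.

(** Applying [adj_tperm i] to both members of a pair matches the inversions of the two permutations;
    only the pair ([adj_lo i], [adj_hi i]) changes order, and it is the new inversion. *)
Lemma ninv_adjl i w : (w (adj_lo i) < w (adj_hi i))%N ->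
  ninv (adj_tperm i * w)%g = (ninv w).+1.
Proof.
move=> lt_w; pose f (p : 'I_n * 'I_n) := (adj_tperm i p.1, adj_tperm i p.2).
have fK : involutive f by case=> k l; rewrite /f /= !tpermK.
rewrite /ninv -(card_imset _ (inv_inj fK)).
have -> : f @: [set p : 'I_n * 'I_n |
      (p.1 < p.2)%N && ((adj_tperm i * w)%g p.2 < (adj_tperm i * w)%g p.1)%N]
    = (adj_hi i, adj_lo i) |: [set p : 'I_n * 'I_n | (p.1 < p.2)%N && (w p.2 < w p.1)%N].
  apply/setP=> p; rewrite -[p in LHS]fK (mem_imset _ _ (inv_inj fK)) !inE /= !permM !tpermK.
  case: eqVneq => [->|ne1] /=.
    by rewrite adj_tpermR adj_tpermL /= ltnSn lt_w.
  case: (eqVneq p (adj_lo i, adj_hi i)) => [->|ne2] /=.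
    by rewrite adj_tpermR adj_tpermL /=; lia.
  by case: p ne1 ne2 => k l ne1 ne2; rewrite adj_tperm_ltn.
by rewrite cardsU1 inE /= ltnNge leqnSn.
Qed.

Lemma ninvV w : ninv w^-1 = ninv w.
Proof.
pose f (p : 'I_n * 'I_n) := (w^-1 p.2, w^-1 p.1)%g.
have f_inj : injective f by case=> a b [c d] [/perm_inj -> /perm_inj ->].
rewrite /ninv -(card_imset _ f_inj); apply: eq_card => p; rewrite !inE.
have -> : p = f (w p.2, w p.1) by case: p => a b; rewrite /f /= !permK.
by rewrite (mem_imset _ _ f_inj) !inE /= !permK andbC.
Qed.

Lemma ninv_descent i w : (w (adj_hi i) < w (adj_lo i))%N ->
  ninv w = (ninv (adj_tperm i * w)%g).+1.
Proof. by move=> /adj_perm_ltn/ninv_adjl; rewrite adj_tpermK. Qed.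

Lemma ninv_adjl_leq i w : (ninv (adj_tperm i * w)%g <= (ninv w).+1)%N.
Proof.
have [/ninv_adjl -> //|/ninv_descent ->|/eqP] :=
  ltngtP (w (adj_lo i)) (w (adj_hi i)); first by do 2 apply: leqW.
by rewrite (negPf (adj_perm_neq i w)).
Qed.

Lemma word_perm_cons i s : word_perm (i :: s) = (adj_tperm i * word_perm s)%g.
Proof. by rewrite /word_perm big_cons. Qed.

Lemma ninv1 : ninv 1%g = 0%N.
Proof.
apply/eqP; rewrite cards_eq0; apply/eqP/setP=> p; rewrite !inE !perm1.
by case: ltngtP.
Qed.

Lemma ninv_word s : (ninv (word_perm s) <= size s)%N.
Proof.
elim: s => [|i s IHs]; first by rewrite /word_perm big_nil ninv1.
by rewrite word_perm_cons (leq_trans (ninv_adjl_leq _ _)).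
Qed.

(** An increasing permutation satisfies k <= w k, and so does its inverse, which gives the opposite
    inequality. *)
Lemma incr_perm1 w : (forall k l : 'I_n, (k < l)%N -> (w k < w l)%N) -> w = 1%g.
Proof.
have ge_id (u : 'S_n) : (forall k l : 'I_n, (k < l)%N -> (u k < u l)%N) ->
    forall k : 'I_n, (k <= u k)%N.
  move=> u_incr [k]; elim: k => // k IHk lt_kn.
  have lt_kn' : (k < n)%N by apply: ltnW.
  by rewrite (leq_ltn_trans (IHk lt_kn')) // u_incr.
move=> w_incr; apply/permP=> k; rewrite perm1; apply/val_inj/eqP.
rewrite eqn_leq ge_id // andbT -{2}[k](permK w) ge_id // => a b lt_ab.
rewrite ltnNge leq_eqVlt negb_or val_eqE (inj_eq perm_inj).
apply/andP; split; first by rewrite -val_eqE gtn_eqF.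
by apply/negP=> /w_incr; rewrite !permKV ltnNge ltnW.
Qed.

Lemma no_descent1 w : (forall i, (w (adj_lo i) < w (adj_hi i))%N) -> w = 1%g.
Proof.
move=> w_asc; apply: incr_perm1 => k l; have [m] := ubnP (l - k).
elim: m k l => // m IHm k l le_m lt_kl.
have lt_k : (k < n.-1)%N by have := ltn_ord l; lia.
have lo_k : adj_lo (Ordinal lt_k) = k by apply: val_inj.
have := w_asc (Ordinal lt_k); rewrite lo_k; set k' := adj_hi _ => ltk.
have [/val_inj <- //|ne] := eqVneq (val k') (val l).
have : (k' < l)%N by rewrite ltn_neqAle ne.
by move=> /(IHm k')/(_)/(ltn_trans ltk); apply; rewrite /= in ne *; lia.
Qed.

Lemma descent_ex w : w != 1%g -> exists i, (w (adj_hi i) < w (adj_lo i))%N.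
Proof.
move=> w1; apply/existsP; rewrite -[X in is_true X]negbK negb_exists.
apply: contra w1 => /forallP asc; apply/eqP/no_descent1 => i.
by rewrite ltn_neqAle adj_perm_neq leqNgt asc.
Qed.

(** Induction along a reduced word, read from the right: every step is taken at an ascent, so the
    length grows by exactly one and [Tperm_adjl] applies. *)
Lemma ninv_ind (P : 'S_n -> Prop) : P 1%g ->
  (forall i w, (w (adj_lo i) < w (adj_hi i))%N -> P w -> P (adj_tperm i * w)%g) ->
  forall w, P w.
Proof.
move=> P1 PS w; have [m] := ubnP (ninv w); elim: m w => // m IHm w.
have [-> //|/descent_ex[i wi]] := eqVneq w 1%g.
rewrite (ninv_descent wi) ltnS => /IHm Pw.
by rewrite -(adj_tpermK i w); apply: PS => //; apply: adj_perm_ltn.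
Qed.

Lemma reduced_ex w : exists2 s, word_perm s = w & size s = ninv w.
Proof.
elim/ninv_ind: w => [|i w wi [s sw szs]].
  by exists [::]; rewrite /word_perm ?big_nil ?ninv1.
by exists (i :: s); rewrite ?word_perm_cons ?sw //= szs ninv_adjl.
Qed.

Lemma perm_len_ninv w : perm_len w = ninv w.
Proof.
apply/eqP; rewrite eqn_leq; apply/andP; split.
  by have [s <- <-] := reduced_ex w; apply: perm_len_min.
by rewrite -size_reduced_word -{1}[w]reduced_wordK ninv_word.
Qed.

Lemma adj_tperm_braid i j : j = i.+1 :> nat ->
  (adj_tperm i * (adj_tperm j * adj_tperm i)
   = adj_tperm j * (adj_tperm i * adj_tperm j))%g.
Proof.
move=> ji; have hl : adj_hi i = adj_lo j by apply: val_inj; rewrite /= ji.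
have ne1 : (adj_lo i == adj_hi j) = false by rewrite -val_eqE /= ji; lia.
have conjE k l : (adj_tperm k * (adj_tperm l * adj_tperm k) = adj_tperm l ^ adj_tperm k)%g.
  by rewrite conjgE tpermV.
rewrite !conjE !adj_tpermE !tpermJ hl tpermR tpermL.
by rewrite !tpermD // -val_eqE /=; lia.
Qed.

Lemma adj_tperm_comm i j : (i.+1 < j)%N ->
  (adj_tperm i * adj_tperm j = adj_tperm j * adj_tperm i)%g.
Proof.
move=> ij; apply/commgP/conjg_fixP; rewrite !adj_tpermE tpermJ !tpermD //;
  rewrite -val_eqE /=; lia.
Qed.

End Inversions.

Section TpermRules.
Variables (R : comPzRingType) (q : R) (n : nat).
Implicit Types (w : 'S_n) (i j : 'I_n.-1).
Local Notation H := (hecke q n).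

Definition word_elt (s : seq 'I_n.-1) : H := \prod_(i <- s) hgen q i.

Lemma word_elt_cons i s : word_elt (i :: s) = hgen q i * word_elt s.
Proof. by rewrite /word_elt big_cons. Qed.

(* Matsumoto's theorem: two reduced words of w beginning with different letters
   are compared through a reduced word of w stripped of the longest element of
   the dihedral parabolic subgroup generated by these letters. *)
Lemma word_elt_reduced s s' : word_perm s = word_perm s' ->
  size s = ninv (word_perm s) -> size s' = ninv (word_perm s') ->
  word_elt s = word_elt s'.
Proof.
have [m] := ubnP (size s); elim: m s s' => // m IHm s s' lt_m ss' red red'.
case: s s' ss' red red' lt_m => [|i u] [|j v] //.
- by move=> <-; rewrite /word_perm big_nil ninv1.
- by move=> ->; rewrite /word_perm big_nil ninv1.
(* The first letter of a reduced word is a descent of its permutation, and the remaining word is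
   again reduced. *)
have tail (k : 'I_n.-1) (t : seq 'I_n.-1) : size (k :: t) = ninv (word_perm (k :: t)) ->
    let w := word_perm (k :: t) in
    [/\ (w (adj_hi k) < w (adj_lo k))%N, word_perm t = (adj_tperm k * w)%g
       & size t = ninv (word_perm t)].
  rewrite word_perm_cons /= => red; have le_t := ninv_word t.
  have [lt|gt|/eqP] := ltngtP ((adj_tperm k * word_perm t)%g (adj_lo k))
     ((adj_tperm k * word_perm t)%g (adj_hi k)); last by rewrite (negPf (adj_perm_neq _ _)).
    by have := ninv_adjl lt; rewrite adj_tpermK -red; lia.
  split=> //; first by rewrite adj_tpermK.
  by have := ninv_descent gt; rewrite adj_tpermK -red => -[].
move=> ww' red red' lt_m; set w := word_perm (i :: u) in ww' red.
have [di wu ru] := tail _ _ red; have [dj wv rv] := tail _ _ red'.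
rewrite -/w -ww' in di wu dj wv; rewrite !word_elt_cons.
have szuv : size u = size v.
  by have := congr1 (@ninv n) ww'; rewrite -red -red' => -[].
have {}lt_m : (size u < m)%N by [].
have near (a b : 'I_n.-1) ua va : size ua = size va -> (size ua < m)%N ->
    word_perm ua = (adj_tperm a * w)%g -> word_perm va = (adj_tperm b * w)%g ->
    size ua = ninv (word_perm ua) -> size va = ninv (word_perm va) ->
    (w (adj_hi a) < w (adj_lo a))%N -> (w (adj_hi b) < w (adj_lo b))%N ->
    (a < b)%N ->
    hgen q a * word_elt ua = hgen q b * word_elt va.
  move=> sz ltm wua wva rua rva da db ab.
  have [ab1|ab1] := eqVneq (b : nat) a.+1.
    have hl : adj_hi a = adj_lo b by apply: val_inj; rewrite /= ab1.
    have ne1 : adj_lo a != adj_lo b by rewrite -val_eqE /= ab1; lia.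
    have ne2 : adj_lo a != adj_hi b by rewrite -val_eqE /= ab1; lia.
    have ne3 : adj_hi a != adj_hi b by rewrite -val_eqE /= ab1; lia.
    (* The values of w decrease along three consecutive positions, so one can descend by a, b, a in
       turn. The reduced word [x] of what is left is prolonged to w by aba as well as by bab. *)
    pose w1 := (adj_tperm a * w)%g; pose w2 := (adj_tperm b * w1)%g.
    have d1 : (w1 (adj_hi b) < w1 (adj_lo b))%N.
      rewrite -hl /w1 adj_perm_hi permM tpermD //; first by rewrite (ltn_trans db) // -hl.
    have d2 : (w2 (adj_hi a) < w2 (adj_lo a))%N.
      have -> : w2 (adj_hi a) = w (adj_hi b).
        by rewrite hl /w2 adj_perm_lo /w1 permM tpermD.
      have -> : w2 (adj_lo a) = w (adj_hi a).
        by rewrite /w2 permM tpermD 1?eq_sym // /w1 adj_perm_lo.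
      by rewrite hl.
    have [x wx rx] := reduced_ex (adj_tperm a * w2)%g.
    have n1 := ninv_descent da; have n2 := ninv_descent d1; have n3 := ninv_descent d2.
    rewrite -/w1 -/w2 in n1 n2 n3.
    have -> : word_elt ua = word_elt (b :: a :: x).
      apply: IHm => //; rewrite !word_perm_cons wx adj_tpermK /w2 adj_tpermK //=.
      by rewrite rx -n3 -n2.
    have -> : word_elt va = word_elt (a :: b :: x).
      have wE : (adj_tperm b * w)%g = word_perm (a :: b :: x).
        have br y : (adj_tperm a * (adj_tperm b * (adj_tperm a * y))
            = adj_tperm b * (adj_tperm a * (adj_tperm b * y)))%g.
          by have /(congr1 (mulg^~ y)) := adj_tperm_braid ab1; rewrite -!mulgA.
        by rewrite !word_perm_cons wx /w2 /w1 br !adj_tpermK.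
      apply: IHm; [by rewrite -sz|by rewrite -wE|by []|rewrite -wE /= rx].
      by have := ninv_descent db; rewrite n1 n2 n3 => -[].
    by rewrite !word_elt_cons ![LHS]mulrA ![RHS]mulrA (hgen_braid q ab1).
  have far : (a.+1 < b)%N by rewrite ltn_neqAle eq_sym ab1.
  pose w1 := (adj_tperm a * w)%g.
  have d1 : (w1 (adj_hi b) < w1 (adj_lo b))%N.
    by rewrite /w1 !permM !tpermD // -val_eqE /=; lia.
  have [x wx rx] := reduced_ex (adj_tperm b * w1)%g.
  have n1 := ninv_descent da; have n2 := ninv_descent d1; rewrite -/w1 in n1 n2.
  have -> : word_elt ua = word_elt (b :: x).
    apply: IHm => //; rewrite !word_perm_cons wx adj_tpermK //=.
    by rewrite rx -n2.
  have -> : word_elt va = word_elt (a :: x).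
    have wE : (adj_tperm b * w)%g = word_perm (a :: x).
      rewrite word_perm_cons wx /w1 !mulgA (adj_tperm_comm far) -!mulgA.
      by rewrite (mulgA (adj_tperm a)) tperm2 mul1g.
    apply: IHm; [by rewrite -sz|by rewrite -wE|by []|rewrite -wE /= rx].
    by have := ninv_descent db; rewrite n1 n2 => -[].
  by rewrite !word_elt_cons ![LHS]mulrA ![RHS]mulrA (hgen_comm q far).
have [ij|ji|/val_inj ij] := ltngtP i j; first exact: near ij.
  by apply/esym/near => //; rewrite -?szuv.
by subst j; congr (_ * _); apply: IHm => //; rewrite wu wv.
Qed.

Lemma Tperm_word s : size s = ninv (word_perm s) -> Tperm q (word_perm s) = word_elt s.
Proof.
move=> red; apply: word_elt_reduced; rewrite ?reduced_wordK //.
by rewrite size_reduced_word perm_len_ninv.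
Qed.

Lemma Tperm1 : Tperm q (1%g : 'S_n) = 1.
Proof.
have := @Tperm_word [::]; rewrite /word_perm /word_elt !big_nil; apply.
by rewrite ninv1.
Qed.

Lemma Tperm_adjl i w : (w (adj_lo i) < w (adj_hi i))%N ->
  Tperm q (adj_tperm i * w)%g = hgen q i * Tperm q w.
Proof.
have [s <- red] := reduced_ex w => asc.
rewrite -word_perm_cons !Tperm_word ?word_elt_cons // word_perm_cons.
by rewrite ninv_adjl // -red.
Qed.

Lemma hstar_word s : hstar (word_elt s) = word_elt (rev s).
Proof.
elim: s => [|i s IHs]; rewrite /word_elt.
  rewrite !big_nil -[1 in LHS]scale1r hstar_scal; exact: scale1r.
rewrite big_cons hstarM hstar_gen -/(word_elt s) IHs /word_elt rev_cons.
by rewrite -cats1 big_cat big_seq1.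
Qed.

Lemma word_perm_rev (s : seq 'I_n.-1) : word_perm (rev s) = ((word_perm s)^-1)%g.
Proof.
elim: s => [|i s IHs]; first by rewrite /word_perm !big_nil invg1.
rewrite word_perm_cons invMg tpermV -IHs rev_cons -cats1.
by rewrite /word_perm big_cat big_seq1.
Qed.

Lemma hstar_Tperm w : hstar (Tperm q w) = Tperm q w^-1%g.
Proof.
have [s <- red] := reduced_ex w.
rewrite Tperm_word // hstar_word -word_perm_rev Tperm_word //.
by rewrite word_perm_rev ninvV size_rev.
Qed.

Lemma hstar_sum (I : Type) (r : seq I) (P : pred I) (F : I -> H) :
  hstar (\sum_(i <- r | P i) F i) = \sum_(i <- r | P i) hstar (F i).
Proof.
have s0 : hstar (0 : H) = 0.
  by rewrite -[0 in LHS](scale0r (1 : H)) hstar_scal scale0r.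
exact: (big_morph _ (@hstarD _ _ _) s0).
Qed.

End TpermRules.

(** * Young subgroups *)

Section YoungSubgroups.
Variables (n : nat) (c : 'I_n -> nat).
Hypothesis c_mono : {homo c : k l / (k <= l)%N}.
Implicit Types (w v u : 'S_n) (i : 'I_n.-1).

(** A level function takes the place of a composition; when it is monotone its fibres are intervals.
    Relabelled rows and intersections of Young subgroups then have the same form. *)
Definition young : {set 'S_n} := [set w : 'S_n | [forall k, c (w k) == c k]].

(** These are the minimal-length representatives of the cosets Y w of the Young subgroup Y. *)
Definition blockwise w : bool :=
  [forall k, forall l, (c k == c l) && (k < l)%N ==> (w k < w l)%N].

Lemma youngP w : reflect (forall k, c (w k) = c k) (w \in young).
Proof. by rewrite inE; apply: (iffP forallP) => wP k; apply/eqP. Qed.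

Lemma blockwiseP w :
  reflect (forall k l : 'I_n, c k = c l -> (k < l)%N -> (w k < w l)%N) (blockwise w).
Proof.
apply: (iffP idP) => [/forallP wP k l ckl kl|wP].
  by have /forallP/(_ l) := wP k; rewrite ckl eqxx kl.
by apply/forallP=> k; apply/forallP=> l; apply/implyP=> /andP[/eqP]; apply: wP.
Qed.

Lemma youngM v u : v \in young -> u \in young -> (v * u)%g \in young.
Proof. by move=> /youngP vP /youngP uP; apply/youngP=> k; rewrite permM uP. Qed.

Lemma youngV v : v \in young -> (v^-1)%g \in young.
Proof. by move=> /youngP vP; apply/youngP=> k; rewrite -vP permKV. Qed.

Lemma young1 : 1%g \in young.
Proof. by apply/youngP=> k; rewrite perm1. Qed.

Lemma youngVE v : ((v^-1)%g \in young) = (v \in young).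
Proof. by apply/idP/idP => /youngV; rewrite ?invgK. Qed.

Lemma youngMl v u : v \in young -> ((v * u)%g \in young) = (u \in young).
Proof.
move=> vY; apply/idP/idP => [/(youngM (youngV vY))|/(youngM vY)//].
by rewrite mulKg.
Qed.

Lemma adj_young i : c (adj_lo i) = c (adj_hi i) -> adj_tperm i \in young.
Proof. by move=> ci; apply/youngP=> k; rewrite adj_tpermE; case: tpermP => // ->. Qed.

(** A descent across two blocks would contradict the monotonicity of [c]. This is what keeps
    [ninv_ind], started at an element of the Young subgroup, inside that subgroup. *)
Lemma young_descent i v : v \in young -> (v (adj_hi i) < v (adj_lo i))%N ->
  c (adj_lo i) = c (adj_hi i).
Proof.
move=> /youngP vP /ltnW/c_mono; rewrite !vP => le; apply/eqP.
by rewrite eqn_leq le andbT; apply: c_mono => /=.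
Qed.

Lemma blockwise_adj w :
  (forall i, c (adj_lo i) = c (adj_hi i) -> (w (adj_lo i) < w (adj_hi i))%N) ->
  blockwise w.
Proof.
move=> w_asc; apply/blockwiseP => k l; have [m] := ubnP (l - k).
elim: m k l => // m IHm k l le_m ckl lt_kl.
have lt_k : (k < n.-1)%N by have := ltn_ord l; lia.
have lo_k : adj_lo (Ordinal lt_k) = k by apply: val_inj.
have := w_asc (Ordinal lt_k); rewrite lo_k; set k' := adj_hi _.
have le_k'l : (k' <= l)%N by [].
have ck' : c k = c k'.
  by apply/eqP; rewrite eqn_leq c_mono /= ?leqnSn // ckl c_mono.
move/(_ ck') => ltk; have [/val_inj <- //|ne] := eqVneq (val k') (val l).
have lt_k'l : (k' < l)%N by rewrite ltn_neqAle ne.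
by apply: ltn_trans ltk (IHm _ _ _ _ _); rewrite // -?ck' //=; lia.
Qed.

Lemma young_sort w : exists2 u, blockwise u & (w * u^-1)%g \in young.
Proof.
have [m] := ubnP (ninv w); elim: m w => // m IHm w lt_m.
have [bw|] := boolP (blockwise w); first by exists w; rewrite ?mulgV ?young1.
move=> nbw; have [i /andP[/eqP ci wi]] : exists i, (c (adj_lo i) == c (adj_hi i))
     && (w (adj_hi i) < w (adj_lo i))%N.
  apply/existsP; apply: contraNT nbw; rewrite negb_exists => /forallP asc.
  apply: blockwise_adj => i ci; have := asc i; rewrite ci eqxx /= -leqNgt => le.
  by rewrite ltn_neqAle adj_perm_neq.
have [|u bu uY] := IHm (adj_tperm i * w)%g; first by rewrite -ltnS -(ninv_descent wi).
exists u => //; rewrite -(adj_tpermK i w) -mulgA.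
by apply: youngM uY; apply: adj_young.
Qed.

(** A descent of v lies inside a block, and u keeps the order of the two images there; v u would
    then have a descent inside a block. *)
Lemma young_blockwise1 v u : v \in young -> blockwise u -> blockwise (v * u)%g -> v = 1%g.
Proof.
move=> vY /blockwiseP bu /blockwiseP bvu; apply: no_descent1 => i.
rewrite ltnNge leq_eqVlt eq_sym (negPf (adj_perm_neq i v)) /=; apply/negP => vi.
have ci := young_descent vY vi; have := bvu _ _ ci (ltnSn i).
rewrite !permM ltnNge ltnW // bu //; move/youngP: vY => vP; by rewrite !vP.
Qed.

Definition block_sort w : 'S_n :=
  odflt w [pick u | blockwise u && ((w * u^-1)%g \in young)].

Lemma block_sortP w : blockwise (block_sort w) /\ (w * (block_sort w)^-1)%g \in young.
Proof.
rewrite /block_sort; case: pickP => [u /andP[] //|no_u].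
by have [u bu uY] := young_sort w; have := no_u u; rewrite bu uY.
Qed.

Lemma block_sort_young v u : v \in young -> blockwise u -> block_sort (v * u)%g = u.
Proof.
move=> vY bu; have [bs sY] := block_sortP (v * u)%g; set s := block_sort _ in bs sY *.
have E : (v^-1 * (v * u * s^-1) * s = u)%g by rewrite !mulgA mulVg mul1g mulgKV.
have := young_blockwise1 (youngM (youngV vY) sY) bs; rewrite E => /(_ bu) eq1.
by rewrite -E eq1 mul1g.
Qed.

Definition young_closed (D : {set 'S_n}) : Prop :=
  forall v w, v \in young -> w \in D -> (v * w)%g \in D.

Lemma young_closedE (D : {set 'S_n}) v w : young_closed D -> v \in young ->
  ((v * w)%g \in D) = (w \in D).
Proof.
move=> cD vY; apply/idP/idP => [|/(cD _ _ vY)//].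
by move=> /(cD _ _ (youngV vY)); rewrite mulKg.
Qed.

Lemma sum_young_closed (A : nmodType) (D : {set 'S_n}) (F : 'S_n -> A) :
  young_closed D ->
  \sum_(w in D) F w = \sum_(u in D | blockwise u) \sum_(v in young) F (v * u)%g.
Proof.
move=> cD; rewrite (partition_big block_sort (fun u => (u \in D) && blockwise u)) /=.
  apply: eq_bigr => u /andP[uD bu].
  rewrite (reindex_inj (mulIg u)) /=; apply: eq_bigl => v.
  apply/andP/idP => [[vuD /eqP su]|vY].
    by have [_] := block_sortP (v * u)%g; rewrite su mulgK.
  by rewrite cD //= block_sort_young.
move=> w wD; have [-> sY] := block_sortP w; rewrite andbT.
by rewrite -(young_closedE _ cD sY) mulgKV.
Qed.

End YoungSubgroups.

Section YoungElements.
Variables (R : comPzRingType) (q : R) (n : nat).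
Implicit Types (c : 'I_n -> nat) (w v u : 'S_n) (i : 'I_n.-1).
Local Notation H := (hecke q n).

Definition young_elt c : H := \sum_(w in young c) Tperm q w.

(** Lengths add: an ascent of v inside a block remains an ascent of v u, since u is increasing on
    that block. *)
Lemma Tperm_young c v u : {homo c : k l / (k <= l)%N} ->
  v \in young c -> blockwise c u -> Tperm q (v * u)%g = Tperm q v * Tperm q u.
Proof.
move=> c_mono vY /blockwiseP bu; elim/ninv_ind: v vY => [|i v vi IHv] vY.
  by rewrite mul1g Tperm1 mul1r.
have ci : c (adj_lo i) = c (adj_hi i).
  by apply: (young_descent c_mono vY); rewrite adj_perm_lo adj_perm_hi.
have {}vY : v \in young c by rewrite -(youngMl _ (adj_young ci)).
rewrite -mulgA !Tperm_adjl ?IHv ?mulrA // !permM bu //.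
by move/youngP: vY => vP; rewrite !vP.
Qed.

Lemma hstar_young_elt c : hstar (young_elt c) = young_elt c.
Proof.
rewrite hstar_sum [RHS](reindex_inj invg_inj) /=.
by apply: eq_big => [v|v _]; rewrite ?youngVE ?hstar_Tperm.
Qed.

Lemma sum_young_left c (D : {set 'S_n}) : {homo c : k l / (k <= l)%N} -> young_closed c D ->
  \sum_(w in D) Tperm q w = young_elt c * \sum_(u in D | blockwise c u) Tperm q u.
Proof.
move=> c_mono cD; rewrite (sum_young_closed c_mono _ cD) mulr_sumr.
apply: eq_bigr => u /andP[_ bu]; rewrite mulr_suml.
by apply: eq_bigr => v vY; apply: Tperm_young c_mono _ _.
Qed.

(** The mirror image of [sum_young_left]: inversion exchanges the two sides, and [hstar] carries one
    factorisation to the other. *)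
Lemma sum_young_right c (D : {set 'S_n}) : {homo c : k l / (k <= l)%N} ->
    (forall v w, v \in young c -> w \in D -> (w * v)%g \in D) ->
  exists X, \sum_(w in D) Tperm q w = X * young_elt c.
Proof.
move=> c_mono cD; pose D' := [set w : 'S_n | (w^-1)%g \in D].
have cD' : young_closed c D'.
  by move=> v w vY; rewrite !inE invMg => wD; apply: cD => //; apply: youngV.
exists (hstar (\sum_(u in D' | blockwise c u) Tperm q u)).
rewrite -[young_elt c]hstar_young_elt -hstarM -sum_young_left // hstar_sum.
rewrite [LHS](reindex_inj invg_inj) /=.
by apply: eq_big => [w|w _]; rewrite ?inE ?hstar_Tperm.
Qed.

(** Pairing each u with its product by [adj_tperm i] writes the sum as (T_i + 1) X, and the
    quadratic relation gives T_i (T_i + 1) = q (T_i + 1). *)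
Lemma hgen_young_elt c i : {homo c : k l / (k <= l)%N} -> c (adj_lo i) = c (adj_hi i) ->
  hgen q i * young_elt c = q *: young_elt c.
Proof.
move=> c_mono ci; pose X := \sum_(u in young c | (u (adj_lo i) < u (adj_hi i))%N) Tperm q u.
have -> : young_elt c = (hgen q i + 1) * X.
  rewrite /young_elt (bigID (fun u : 'S_n => (u (adj_lo i) < u (adj_hi i))%N)) /=.
  rewrite mulrDl mul1r addrC; congr (_ + _).
  rewrite (reindex_inj (mulgI (adj_tperm i))) mulr_sumr /=.
  apply: eq_big => [u|u /andP[_ ui]].
    rewrite youngMl ?adj_young // adj_perm_lo adj_perm_hi -leqNgt leq_eqVlt.
    by rewrite (negPf (adj_perm_neq i u)).
  rewrite Tperm_adjl //; move: ui; rewrite adj_perm_lo adj_perm_hi -leqNgt leq_eqVlt.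
  by rewrite (negPf (adj_perm_neq i u)).
rewrite mulrA hscaleAl; congr (_ * _).
have := hgen_quad q i; rewrite mulrBr -hscaleAr mulr1 => /subr0_eq <-.
by rewrite mulrDl mulrDr mulr1 mul1r.
Qed.

Lemma young_elt_hgen c i : {homo c : k l / (k <= l)%N} -> c (adj_lo i) = c (adj_hi i) ->
  young_elt c * hgen q i = q *: young_elt c.
Proof.
move=> c_mono ci; have := congr1 (@hstar _ _ _) (hgen_young_elt c_mono ci).
rewrite hstarM hstar_young_elt hstar_gen => ->.
by rewrite -[young_elt c in LHS]mul1r hscaleAl hstarM hstar_scal hstar_young_elt -hscaleAr mulr1.
Qed.

Lemma young_elt_Tperm c v : {homo c : k l / (k <= l)%N} -> v \in young c ->
  young_elt c * Tperm q v = q ^+ ninv v *: young_elt c.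
Proof.
move=> c_mono; elim/ninv_ind: v => [|i v vi IHv] vY.
  by rewrite Tperm1 mulr1 ninv1 expr0 scale1r.
have ci : c (adj_lo i) = c (adj_hi i).
  by apply: (young_descent c_mono vY); rewrite adj_perm_lo adj_perm_hi.
have {}vY : v \in young c by rewrite -(youngMl _ (adj_young ci)).
rewrite Tperm_adjl // mulrA young_elt_hgen // -hscaleAl IHv //.
by rewrite scalerA ninv_adjl // exprS.
Qed.

Lemma young_homoD c c' v : {homo c : k l / (k <= l)%N} -> {homo c' : k l / (k <= l)%N} ->
  (v \in young (fun k => c k + c' k)%N) = (v \in young c) && (v \in young c').
Proof.
move=> c_mono c'_mono; apply/youngP/andP => [vP|[/youngP vP /youngP v'P] k].
  by split; apply/youngP=> k; have := vP k;
    have [/[dup]/c_mono + /c'_mono|/ltnW/[dup]/c_mono + /c'_mono] := leqP (v k) k; lia.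
by rewrite vP v'P.
Qed.

(* As c and c' are monotone, the level sets of c + c' are the intersections of those
   of c and c'.  The sum is X * \sum_(w in D) T_w with young_elt c = X * young_elt (c + c'). *)
Lemma young_elt_product c c' (D : {set 'S_n}) :
    {homo c : k l / (k <= l)%N} -> {homo c' : k l / (k <= l)%N} -> young_closed c' D ->
  exists X Y, \sum_(w in D | blockwise (fun k => c k + c' k)%N w) young_elt c * Tperm q w
     = X * young_elt c' * Y.
Proof.
move=> c_mono c'_mono cD; pose r (k : 'I_n) := (c k + c' k)%N; rewrite -/r.
have r_mono : {homo r : k l / (k <= l)%N}.
  by move=> k l kl; apply: leq_add; [apply: c_mono | apply: c'_mono].
have [|X XE] := @sum_young_right r (young c) r_mono.
  move=> v w; rewrite young_homoD // => /andP[vY _] wY; exact: youngM wY vY.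
exists X, (\sum_(u in D | blockwise c' u) Tperm q u).
rewrite -mulrA -sum_young_left // (@sum_young_left r) //.
  by rewrite mulrA -XE mulr_sumr.
by move=> v w; rewrite young_homoD // => /andP[_]; apply: cD.
Qed.

(** Both sides are the sum of the T_x over the coset Y_c w = w Y_c': w carries blocks onto blocks,
    and lengths add on either side. *)
Lemma young_elt_conj c c' w : {homo c : k l / (k <= l)%N} -> {homo c' : k l / (k <= l)%N} ->
    (forall k l, (c' (w k) == c' (w l)) = (c k == c l)) -> blockwise c w ->
  young_elt c * Tperm q w = Tperm q w * young_elt c'.
Proof.
move=> c_mono c'_mono cw bw.
have bw' : blockwise c' w^-1%g.
  apply/blockwiseP=> k l /eqP; rewrite -{1}(permKV w k) -{1}(permKV w l) cw => /eqP ckl lt_kl.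
  rewrite ltnNge leq_eqVlt negb_or val_eqE (inj_eq perm_inj).
  apply/andP; split; first by rewrite -val_eqE gtn_eqF.
  apply/negP => lt; have /blockwiseP/(_ _ _ (esym ckl) lt) := bw.
  by rewrite !permKV ltnNge ltnW.
transitivity (hstar (young_elt c' * Tperm q w^-1%g)); last first.
  by rewrite hstarM hstar_young_elt hstar_Tperm invgK.
have conjY v : (v^-1 ^ w \in young c')%g = (v \in young c).
  rewrite conjVg youngVE; apply/youngP/youngP => vP k.
    by have := vP (w k); rewrite conjgE !permM permK => /eqP; rewrite cw => /eqP.
  by apply/eqP; rewrite conjgE !permM -{2}(permKV w k) cw vP.
rewrite !mulr_suml hstar_sum [RHS](reindex_inj (conjg_inj w)) [RHS](reindex_inj invg_inj) /=.
apply: eq_big => [v|v vY]; first by rewrite conjY.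
rewrite -(Tperm_young c_mono) // -(Tperm_young c'_mono) ?conjY // hstar_Tperm.
by rewrite invMg invgK conjVg invgK conjgE !mulgA mulgV mul1g.
Qed.

(** The quadratic relation in the form T_i (T_i + 1 - q) = q inverts each generator. *)
Lemma Tperm_rinv (qV : R) w : q * qV = 1 -> exists Z, Tperm q w * Z = 1.
Proof.
move=> qK; elim/ninv_ind: w => [|i w wi [Z ZE]]; first by exists 1; rewrite Tperm1 mulr1.
exists (Z * (qV *: (hgen q i + (1 - q *: (1 : H))))).
rewrite Tperm_adjl // mulrA -[_ * _ * Z]mulrA ZE mulr1 -hscaleAr.
have := hgen_quad q i; rewrite mulrBr -hscaleAr mulr1 mulrDl mul1r => /subr0_eq quad.
rewrite mulrDr mulrBr mulr1 -hscaleAr mulr1 addrA quad.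
by rewrite -scalerBr [hgen q i + 1]addrC addrK scalerA mulrC qK scale1r.
Qed.

End YoungElements.

(** * Dominance and the ideal H^{> la} *)

Section RowFunctions.
Variable n : nat.
Implicit Types (mu : composition n) (k l : 'I_n).

Lemma perm_of_fibers (f g : 'I_n -> nat) :
  (forall a, #|[set k | f k == a]| = #|[set k | g k == a]|) ->
  exists v : 'S_n, forall k, f (v k) = g k.
Proof.
move=> fg; have card_count (h : 'I_n -> nat) a :
    count_mem a [tuple h i | i < n] = #|[set k | h k == a]|.
  by rewrite -sum1_count big_map val_ord_tuple big_enum_cond sum1dep_card.
have /tuple_permP[v vE] : perm_eq [tuple g i | i < n] [tuple f i | i < n].
  by apply/allP => a _; rewrite /= !card_count fg.
exists v => k; have := congr1 (nth 0%N ^~ k) vE.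
rewrite -(tnth_nth _ [tuple g i | i < n]) -(tnth_nth _ [tuple tnth _ _ | _ < _]).
by rewrite !tnth_mktuple.
Qed.

Lemma flatten_index_node mu k :
  flatten_index mu (row_of mu k) (nodecol (node_of mu k)) = k :> nat.
Proof. exact: reshape_indexK. Qed.

Lemma row_of_mono mu : {homo (fun k => nat_of_ord (row_of mu k)) : k l / (k <= l)%N}.
Proof.
move=> k l; rewrite (reshape_leq mu) => kl.
suff: (reshape_index mu k <= reshape_index mu l)%N by [].
by case/orP: kl => [/ltnW//|/andP[/eqP -> _]].
Qed.

Lemma row_of_tinit mu (x : node mu) : row_of mu (tinit_fun mu x) = tag x.
Proof. by rewrite /row_of tinit_funK. Qed.

Lemma card_row_of mu a : #|[set k | row_of mu k == a :> nat]| = nth 0%N mu a.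
Proof.
transitivity (count xpredT (iota 0 (nth 0%N mu a))); last by rewrite count_predT size_iota.
rewrite -card_row.
have tinj : injective (tinit_fun mu) := can_inj (@tinit_funK _ mu).
rewrite -(card_imset _ tinj); apply: eq_card => k.
by rewrite -[k](node_ofK mu) (mem_imset _ _ tinj) !inE /row_of tinit_funK andbT.
Qed.

Lemma row_stabE mu : row_stab mu = young (fun k => row_of mu k).
Proof.
by apply/setP=> w; rewrite !inE; apply: eq_forallb => k; rewrite -val_eqE.
Qed.

Lemma m_eltE (R : comPzRingType) (q : R) mu :
  m_elt q mu = young_elt q (fun k => row_of mu k).
Proof. by rewrite /m_elt row_stabE. Qed.

Lemma tinit_Std mu : tinit mu \in Std mu.
Proof.
rewrite !inE; apply/andP; split; apply/forallP=> x; apply/forallP=> y;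
  apply/implyP=> /andP[/eqP xy lt_xy]; rewrite /= !ffunE /= /flatten_index.
  by rewrite xy ltn_add2l.
rewrite xy ltn_add2r.
have lt_row : (0 < nth 0 mu (noderow x))%N := leq_ltn_trans (leq0n _) (ltn_ord (tagged x)).
have le_size : (noderow x < size mu)%N := ltn_ord (tag x).
apply: (@leq_trans (sumn (take (noderow x).+1 mu))).
  by rewrite (take_nth 0%N) // sumn_rcons -addn1 leq_add2l.
rewrite -(subnKC lt_xy) takeD sumn_cat; exact: leq_addr.
Qed.

Lemma tabd_tinit mu : tabd (tinit mu) = 1%g.
Proof. by apply/permP=> k; rewrite permE perm1 /= node_ofK. Qed.

End RowFunctions.

Section DominanceOfSorting.

Lemma sumn_take (s : seq nat) j : sumn (take j s) = (\sum_(i < j) nth 0 s i)%N.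
Proof.
rewrite sumnE (big_nth 0%N) big_mkord size_take_min.
rewrite (big_ord_widen_cond j xpredT (fun i => nth 0%N (take j s) i)) ?geq_minl //.
rewrite big_mkcond; apply: eq_bigr => i _ /=; rewrite nth_take //.
by rewrite leq_min ltn_ord /=; case: ltnP => // le; rewrite nth_default.
Qed.

(** Let x be the head of t, the largest entry. A prefix of s of length j + 1 exceeds the prefix of
    length j of s without x by at most x: either it contains x, or its last entry is at most x. *)
Lemma sumn_take_sort (s t : seq nat) j : perm_eq s t -> sorted geq t ->
  (sumn (take j s) <= sumn (take j t))%N.
Proof.
elim: t s j => [|x t IHt] s j st srt.
  by rewrite (perm_nilP st).
case: j => [|j]; first by rewrite take0.
have x_s : x \in s by rewrite (perm_mem st) mem_head.
have x_max y : y \in s -> (y <= x)%N.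
  rewrite (perm_mem st) inE => /predU1P[-> //|yt].
  by have /allP/(_ y yt) := order_path_min (rev_trans leq_trans) srt.
case/splitPr: x_s st x_max => s1 s2.
rewrite -[x :: s2]cat1s perm_catCA perm_cons => st x_max.
have {}IHt := IHt _ j st (path_sorted srt); rewrite /=.
apply: leq_trans (leq_add (leqnn x) IHt).
rewrite !take_cat; case: (ltnP j.+1 (size s1)) => [lt|ge].
  rewrite (ltn_trans _ lt) // (take_nth 0%N) ?(ltn_trans _ lt) // sumn_rcons addnC leq_add2r.
  by apply: x_max; rewrite mem_cat mem_nth ?(ltn_trans _ lt).
rewrite sumn_cat; case: (ltnP j (size s1)) => [lt|ge'].
  have -> : (j.+1 = size s1)%N by apply/eqP; rewrite eqn_leq lt.
  rewrite subnn take0 /= addn0.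
  have -> : sumn s1 = sumn (take j.+1 s1) by rewrite take_oversize.
  rewrite (take_nth 0%N) // sumn_rcons addnC leq_add2r.
  by apply: x_max; rewrite mem_cat mem_nth.
by rewrite subSn //= sumn_cat addnCA.
Qed.

End DominanceOfSorting.

Section DominantIdeal.
Variables (R : comPzRingType) (q qV : R) (n : nat).
Hypothesis qK : q * qV = 1.
Variable la : composition n.

Lemma hecke_gt_m_elt (nu : composition n) : is_partition nu -> sdominates nu la ->
  hecke_gt la (m_elt q nu).
Proof.
move=> pnu dom; apply: tsideal_gen; exists nu, (tinit nu), (tinit nu); split => //.
- exact: tinit_Std.
- exact: tinit_Std.
rewrite /murphy tabd_tinit Tperm1 mulr1.
by rewrite -[in hstar 1](Tperm1 q n) hstar_Tperm invg1 Tperm1 mul1r.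
Qed.

(** Sorting [mu] gives a partition [nu] that still dominates strictly. If u carries the levels of
    [c] onto the rows of [nu], then young_elt c * T_u = T_u * m_nu, and T_u has a right inverse. The
    renaming [sg] lets the sizes of the levels appear in [mu] in another order than in [c]. *)
Lemma hecke_gt_young_elt (c : 'I_n -> nat) (mu : seq nat) (sg : nat -> nat) :
    {homo c : k l / (k <= l)%N} -> injective sg ->
    (forall a, #|[set k | sg (c k) == a]| = nth 0%N mu a) -> sumn mu = n ->
    (forall j, (sumn (take j la) <= sumn (take j mu))%N) ->
    (exists j, (sumn (take j la) < sumn (take j mu))%N) ->
  hecke_gt la (young_elt q c).
Proof.
move=> c_mono sg_inj card_c sum_mu dom [j0 lt_j0].
have srt : sorted geq (sort geq mu).
  by apply: sort_sorted => x y; apply: leq_total.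
have prm : perm_eq mu (sort geq mu) by rewrite perm_sym perm_sort.
have sum_nu : sumn (sort geq mu) = n by rewrite -(perm_sumn prm).
pose nu := Composition sum_nu.
have gt_nu : hecke_gt la (m_elt q nu).
  apply: hecke_gt_m_elt => //; split.
    by move=> j; apply: leq_trans (dom j) (sumn_take_sort j prm srt).
  have lt : (sumn (take j0 la) < sumn (take j0 nu))%N.
    exact: leq_trans lt_j0 (sumn_take_sort j0 prm srt).
  have /existsP[i /eqP ne] : [exists i : 'I_j0, nth 0 la i != nth 0 nu i]%N.
    rewrite -[X in is_true X]negbK negb_exists; apply/negP => /forallP eq.
    move: lt; rewrite !sumn_take; under eq_bigr => i _ do
      rewrite (eqP (negbNE (eq i))).
    by rewrite ltnn.
  by exists i; apply: nesym.
have /(perm_iotaP 0%N)[Is prmI muE] := prm.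
have szI : size Is = size mu by rewrite (perm_size prmI) size_iota size_sort.
have uI : uniq Is by rewrite (perm_uniq prmI) iota_uniq.
have memI a : (a \in Is) = (a < size mu)%N.
  by rewrite (perm_mem prmI) mem_iota size_sort.
have lt_c k : (sg (c k) < size mu)%N.
  rewrite ltnNge; apply/negP => le; have := card_c (sg (c k)).
  by rewrite nth_default // => /eqP; rewrite cards_eq0 => /eqP/setP/(_ k); rewrite !inE eqxx.
(* [Is] satisfies mu_a = nu_(Is a), so [g] sends k to a row of [nu] that is as large as the level of
   k. *)
pose g k := nth (size mu) Is (sg (c k)).
have gE k l : (g k == g l) = (c k == c l).
  by rewrite /g nth_uniq ?szI // (inj_eq sg_inj).
have [|v vE] := @perm_of_fibers _ (fun k => row_of nu k) g.
  move=> a; rewrite card_row_of /=; have [lt|le] := ltnP a (size mu); last first.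
    rewrite nth_default ?size_sort //; apply/esym/eqP; rewrite cards_eq0; apply/eqP/setP=> k.
    by rewrite !inE; apply/negP => /eqP gk; have := memI a;
      rewrite -gk mem_nth ?szI // gk ltnNge le.
  have aI : a \in Is by rewrite memI.
  transitivity (nth 0%N mu (index a Is)).
    by rewrite {2}muE (nth_map (size mu)) ?index_mem // nth_index.
  rewrite -card_c; apply: eq_card => k; rewrite !inE /g.
  by rewrite -{2}(nth_index (size mu) aI) nth_uniq ?szI // -szI index_mem.
(* [young_elt_conj] asks for a blockwise permutation; the representative u of the coset of v carries
   levels to rows in the same way. *)
have [u bu uY] := young_sort c_mono v.
have uE k l : (row_of nu (u k) == row_of nu (u l) :> nat) = (c k == c l).
  have vu i : u i = v ((v * u^-1)^-1%g i) by rewrite -permM invMg invgK mulgKV.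
  rewrite !vu !vE gE; by move: (youngV uY) => /youngP vP; rewrite !vP.
have [Z ZE] := Tperm_rinv u qK.
rewrite -[young_elt q c]mulr1 -ZE mulrA.
rewrite (young_elt_conj q c_mono (@row_of_mono _ nu) uE bu).
by apply: tsidealMr; apply: tsidealMl; rewrite -m_eltE.
Qed.

End DominantIdeal.

(** * Gaussian binomials *)

Section GaussianBinomialRules.

Local Notation B := qbinom_poly.

Lemma qfact_neq0 m : qfact m != 0.
Proof. exact/monic_neq0/qfact_monic. Qed.

Lemma qbinom_poly_small m k : (m < k)%N -> B m k = 0.
Proof. by rewrite /B ltnNge => /negPf ->. Qed.

Lemma qfact0 : qfact 0 = 1.
Proof. by rewrite /qfact big_ord0. Qed.

Lemma qbinom_poly0 m : B m 0 = 1.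
Proof.
apply: (mulIf (qfact_neq0 m)); have := qbinom_polyP (leq0n m).
by rewrite subn0 qfact0 mul1r => /= ->.
Qed.

Lemma qbinom_polynn m : B m m = 1.
Proof.
apply: (mulIf (qfact_neq0 m)); have := qbinom_polyP (leqnn m).
by rewrite subnn qfact0 mulr1 => /= ->; rewrite mul1r.
Qed.

Lemma qbinom_polyS m k : B m.+1 k.+1 = B m k + 'X^(k.+1) * B m k.+1.
Proof.
have [lt|gt|<-] := ltngtP k m; last 2 first.
- by rewrite !qbinom_poly_small ?mulr0 ?addr0 // ltnW.
- by rewrite !qbinom_polynn qbinom_poly_small // mulr0 addr0.
apply: (mulIf (mulf_neq0 (qfact_neq0 k.+1) (qfact_neq0 (m - k)))).
have := @qbinom_polyP m.+1 k.+1 (ltnW lt).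
rewrite subSS => -> //; have P1 := @qbinom_polyP m k (ltnW lt).
have P2 := qbinom_polyP lt; have mkE : (m - k = (m - k.+1).+1)%N by lia.
have -> : qfact m.+1 = qint m.+1 * qfact m by rewrite qfactS.
have -> : qint m.+1 = qint k.+1 + 'X^(k.+1) * qint (m - k).
  by rewrite -qintD; congr qint; lia.
rewrite !mulrDl; congr (_ + _); first by rewrite -P1 qfactS; ring.
by rewrite -P2 mkE [in RHS](qfactS (m - k.+1)); ring.
Qed.

(** Both sides are the q-multinomial [a + f]! / ([a]! [h]! [f - h]!). *)
Lemma qbinom_poly_trinomial a f h :
  B (a + f) (a + h) * B (a + h) h = B (a + f) f * B f h.
Proof.
have [le|lt] := leqP h f; last first.
  by rewrite qbinom_poly_small ?ltn_add2l // (qbinom_poly_small lt) mul0r mulr0.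
apply: (mulIf (mulf_neq0 (mulf_neq0 (qfact_neq0 h) (qfact_neq0 a)) (qfact_neq0 (f - h)))).
have P1 := @qbinom_polyP (a + h) h (leq_addl _ _).
have P2 := @qbinom_polyP (a + f) (a + h); rewrite leq_add2l in P2.
have P3 := @qbinom_polyP (a + f) f (leq_addl _ _).
have P4 := qbinom_polyP le.
have {}P2 := P2 le; rewrite subnDl in P2; rewrite addnK in P1; rewrite addnK in P3.
transitivity (qfact (a + f)); first by rewrite -P2 -P1; ring.
by rewrite -P3 -P4; ring.
Qed.

Variables (R : comPzRingType) (q : R).
Implicit Types p r : {poly int}.

Lemma int_eval_widen N p : (size p <= N)%N ->
  int_eval q p = \sum_(i < N) (p`_i)%:~R * q ^+ i.
Proof.
move=> le; rewrite /int_eval (big_ord_widen _ (fun i => (p`_i)%:~R * q ^+ i) le).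
rewrite big_mkcond; apply: eq_bigr => i _ /=; case: ltnP => // le_i.
by rewrite nth_default // mul0r.
Qed.

Lemma int_evalD p r : int_eval q (p + r) = int_eval q p + int_eval q r.
Proof.
pose N := maxn (size p) (size r).
rewrite !(@int_eval_widen N) ?leq_maxl ?leq_maxr ?size_polyD // -big_split /=.
by apply: eq_bigr => i _; rewrite coefD rmorphD mulrDl.
Qed.

Lemma int_eval0 : int_eval q 0 = 0.
Proof. by rewrite /int_eval size_poly0 big_ord0. Qed.

Lemma int_evalMX p : int_eval q ('X * p) = q * int_eval q p.
Proof.
rewrite (@int_eval_widen (size p).+1) ?(leq_trans (size_polyMleq _ _)) ?size_polyX //.
rewrite big_ord_recl coefXM mul0r add0r mulr_sumr; apply: eq_bigr => i _.
by rewrite coefXM /= exprS; ring.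
Qed.

Lemma int_evalMXn k p : int_eval q ('X^k * p) = q ^+ k * int_eval q p.
Proof.
elim: k => [|k IHk]; first by rewrite !expr0 !mul1r.
by rewrite !exprS -!mulrA int_evalMX IHk.
Qed.

Lemma int_evalZ (c : int) p : int_eval q (c *: p) = c%:~R * int_eval q p.
Proof.
rewrite (@int_eval_widen (size p)) ?size_scale_leq // mulr_sumr.
by apply: eq_bigr => i _; rewrite coefZ rmorphM mulrA.
Qed.

Lemma int_evalM p r : int_eval q (p * r) = int_eval q p * int_eval q r.
Proof.
rewrite -{1}[p]coefK poly_def mulr_suml.
rewrite (big_morph _ int_evalD int_eval0) [in RHS]/int_eval mulr_suml.
by apply: eq_bigr => i _; rewrite -scalerAl int_evalZ int_evalMXn mulrA.
Qed.

Lemma int_eval1 : int_eval q 1 = 1.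
Proof. by rewrite /int_eval size_poly1 big_ord1 coef1 mul1r. Qed.

Local Notation qb := (qbinom q).

Lemma qbinom0 m : qb m 0 = 1.
Proof. by rewrite /qbinom qbinom_poly0 int_eval1. Qed.

Lemma qbinomnn m : qb m m = 1.
Proof. by rewrite /qbinom qbinom_polynn int_eval1. Qed.

Lemma qbinom_small m k : (m < k)%N -> qb m k = 0.
Proof. by rewrite /qbinom => /qbinom_poly_small ->; rewrite int_eval0. Qed.

Lemma qbinomS m k : qb m.+1 k.+1 = qb m k + q ^+ k.+1 * qb m k.+1.
Proof. by rewrite /qbinom qbinom_polyS int_evalD int_evalMXn. Qed.

Lemma qbinom_trinomial a f h : qb (a + f) (a + h) * qb (a + h) h = qb (a + f) f * qb f h.
Proof. by rewrite /qbinom -!int_evalM qbinom_poly_trinomial. Qed.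

(** Any bound N above f will do, as the further terms vanish; this lets all entries share one index
    range in [sum_exch_weight]. *)
Lemma qbinom_theorem N f x : (f < N)%N ->
  \sum_(h < N) (-1) ^+ h * q ^+ 'C(h, 2) * x ^+ h * qb f h
  = \prod_(t < f) (1 - q ^+ t * x).
Proof.
elim: f N x => [|f IHf] [|N] x // lt_fN.
  rewrite big_ord0 big_ord_recl /= qbinom0 bin0n !mulr1 big1 ?addr0 // => i _.
  by rewrite qbinom_small // mulr0.
(* The q-Pascal rule expresses the sum for f + 1 at x through the sum for f at q x, with the factor
   1 - x. *)
have step : \sum_(h < N.+1) (-1) ^+ h * q ^+ 'C(h, 2) * x ^+ h * qb f.+1 h
   = \sum_(h < N.+1) (-1) ^+ h * q ^+ 'C(h, 2) * (q * x) ^+ h * qb f h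
     - x * \sum_(h < N) (-1) ^+ h * q ^+ 'C(h, 2) * (q * x) ^+ h * qb f h.
  rewrite !big_ord_recl /= !qbinom0 -addrA; congr (_ + _).
  rewrite mulr_sumr -sumrB; apply: eq_bigr => i _.
  by rewrite /bump !add1n qbinomS binS bin1 !exprMn !exprS !exprD; ring.
rewrite step !IHf //; last exact: ltnW.
rewrite big_ord_recl expr0 mul1r mulrBl mul1r.
have -> : \prod_(t < f) (1 - q ^+ bump 0 t * x) = \prod_(t < f) (1 - q ^+ t * (q * x)).
  by apply: eq_bigr => t _; rewrite /bump add1n exprSr mulrA.
by [].
Qed.

End GaussianBinomialRules.

(** * The multiplication rule of the q-Schur algebra *)

Section SubsetSums.
Variables (R : comPzRingType) (q : R) (n b : nat) (e : bool).
Implicit Types (W L : {set 'I_n}) (M l : 'I_b -> nat).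

(* The two parts of the theorem correspond to the two values of e. *)
Definition olt (x y : nat) : bool := if e then (x < y)%N else (y < x)%N.

Lemma oltxx x : olt x x = false.
Proof. by rewrite /olt !ltnn if_same. Qed.

Lemma olt_asym x y : olt x y -> olt y x = false.
Proof. by rewrite /olt; case: e; lia. Qed.

Lemma olt_total x y : x != y -> olt x y || olt y x.
Proof. by rewrite /olt; case: e; lia. Qed.

Lemma olt_trans y x z : olt x y -> olt y z -> olt x z.
Proof. by rewrite /olt; case: e; lia. Qed.

Lemma olt_max W : W != set0 -> exists2 x, x \in W & {in W, forall y, y != x -> olt y x}.
Proof.
case/set0Pn=> x0 x0W; rewrite /olt; case: e.
  case: (@arg_maxnP _ x0 (mem W) val x0W) => x xW maxx; exists x => // y yW yx.
  by rewrite ltn_neqAle val_eqE yx; apply: maxx.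
case: (@arg_minnP _ x0 (mem W) val x0W) => x xW minx; exists x => // y yW yx.
by rewrite ltn_neqAle eq_sym val_eqE yx; apply: minx.
Qed.

Definition fiber_card (W : {set 'I_n}) (col : 'I_n -> 'I_b) (i : 'I_b) : nat :=
  #|[set y in W | col y == i]|.

(* The coefficient in F^(k) X of the type with multiplicities M in the target row t,
   where X has multiplicities l in row t. *)
Definition merge_coef M l : R :=
  \prod_i (q ^+ ((M i - l i) * \sum_(i' : 'I_b | olt i' i) l i') * qbinom q (M i) (l i)).

Definition crossings W L : nat := (\sum_(x in L) \sum_(y in W :\: L) olt x y)%N.

Lemma merge_coef_small M l i : (M i < l i)%N -> merge_coef M l = 0.
Proof. by move=> lt; rewrite /merge_coef (bigD1 i) //= qbinom_small // mulr0 mul0r. Qed.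

Lemma eq_merge_coef M M' l l' : M =1 M' -> l =1 l' -> merge_coef M l = merge_coef M' l'.
Proof.
move=> MM ll; apply: eq_bigr => i _; rewrite MM ll.
by under eq_bigr => i' _ do rewrite ll.
Qed.

Lemma fiber_cardU1 W col x i : x \notin W ->
  fiber_card (x |: W) col i = ((col x == i) + fiber_card W col i)%N.
Proof.
move=> xW; rewrite /fiber_card; have [ci|ci] := eqVneq (col x) i.
  have -> : [set y in x |: W | col y == i] = x |: [set y in W | col y == i].
    by apply/setP=> y; rewrite !inE; case: eqVneq => [->|//] /=; rewrite ci eqxx.
  by rewrite cardsU1 !inE (negPf xW).
apply: eq_card => y; rewrite !inE; case: eqVneq => [->|//] /=.
by rewrite (negPf ci) andbF.
Qed.

Lemma sum_fiber_card W col : (\sum_i fiber_card W col i)%N = #|W|.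
Proof.
rewrite -sum1_card (partition_big col xpredT) //=; apply: eq_bigr => i _.
by rewrite sum1dep_card.
Qed.

(** A chosen element of an earlier colour crosses every element of colour i that is not chosen,
    which accounts for the power of q; the crossings inside one colour give the Gaussian binomial.
    The induction removes the last element of W: it is crossed by all of L when outside L, and
    crosses nothing when inside. *)
Lemma sum_subset_crossings (col : 'I_n -> 'I_b) l W :
    {in W &, forall x y, olt (col x) (col y) -> olt x y} ->
  \sum_(L : {set 'I_n} | (L \subset W) && [forall i, fiber_card L col i == l i])
     q ^+ crossings W L = merge_coef (fiber_card W col) l.
Proof.
have [m] := ubnP #|W|; elim: m W l => // m IHm W l ltm col_mono.
have [W0|W_n0] := eqVneq W set0.
  have fc0 L i : L = set0 -> fiber_card L col i = 0%N.
    by move=> ->; apply/eqP; rewrite /fiber_card cards_eq0; apply/eqP/setP=> y; rewrite !inE.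
  have [/forallP l0|] := boolP [forall i, l i == 0%N].
    rewrite (big_pred1 set0) => [|L].
      have -> : crossings W set0 = 0%N by rewrite /crossings big_set0.
      rewrite expr0 /merge_coef big1 // => i _.
      by rewrite fc0 // (eqP (l0 i)) sub0n mul0n expr0 qbinom0 mulr1.
    rewrite W0 subset0 /=; case: eqVneq => [->|] //=; apply/forallP=> i.
    by rewrite fc0 // eq_sym l0.
  rewrite negb_forall => /existsP[i li]; rewrite (@merge_coef_small _ _ i); last first.
    by rewrite fc0 // lt0n.
  apply: big1 => L; rewrite W0 subset0 => /andP[/eqP L0 /forallP/(_ i)].
  by rewrite fc0 // eq_sym (negPf li).
have [x xW x_max] := olt_max W_n0.
pose W' := W :\ x; have xW' : x \notin W' by rewrite !inE eqxx.
have WE : W = x |: W' by rewrite setD1K.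
have {}IHm l' := IHm W' l' (leq_trans (proper_card (properD1 xW)) ltm)
  (sub_in2 (subsetP (subD1set _ _)) col_mono).
have MW i : fiber_card W col i = ((col x == i) + fiber_card W' col i)%N.
  by rewrite {1}WE fiber_cardU1.
pose i0 := col x; pose l1 (i : 'I_b) := if i == i0 then (l i).-1 else l i.
have top0 (i : 'I_b) : olt i0 i -> fiber_card W' col i = 0%N.
  move=> lti; apply/eqP; rewrite /fiber_card cards_eq0; apply/eqP/setP=> y; rewrite !inE.
  apply/negP => /andP[/andP[yx yW] /eqP cy].
  have := x_max y yW yx; rewrite olt_asym //; apply: col_mono => //.
  by rewrite cy.
rewrite (bigID (fun L : {set 'I_n} => x \in L)) /= addrC.
have -> : \sum_(L : {set 'I_n} | (L \subset W) && [forall i, fiber_card L col i == l i]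
     && (x \notin L)) q ^+ crossings W L
   = q ^+ (\sum_i l i)%N * merge_coef (fiber_card W' col) l.
  rewrite -IHm mulr_sumr; apply: eq_big => [L|L /andP[/andP[LW /forallP Ll] xL]].
    by rewrite /W' subsetD1 -!andbA; congr (_ && _); rewrite andbC.
  rewrite -exprD; congr (_ ^+ _).
  under eq_bigr => i _ do rewrite -(eqP (Ll i)).
  rewrite sum_fiber_card -sum1_card -big_split; apply: eq_bigr => y yL /=.
  have yW : y \in W by apply: subsetP LW _ yL.
  have yx : y != x by apply: contraNneq xL => <-.
  rewrite (bigD1 x) ?inE ?xW ?xL //= x_max //; congr (1 + _)%N.
  by apply: eq_bigl => z; rewrite !inE; case: (z == x) => /=; rewrite ?andbF ?andbT.
have -> : \sum_(L : {set 'I_n} | (L \subset W) && [forall i, fiber_card L col i == l i]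
     && (x \in L)) q ^+ crossings W L
   = if l i0 == 0%N then 0 else merge_coef (fiber_card W' col) l1.
  case: ifPn => [l0|l0].
    rewrite big_pred0 // => L; apply/negP => /andP[/andP[_ /forallP/(_ i0)]].
    rewrite (eqP l0) /fiber_card cards_eq0 => /eqP/setP/(_ x) + xL.
    by rewrite !inE xL eqxx.
  rewrite -IHm (reindex_onto (fun L : {set 'I_n} => x |: L) (fun L => L :\ x)) /=; last first.
    by move=> L /andP[_ xL]; rewrite setD1K.
  have xLP (L : {set 'I_n}) : ((x |: L) :\ x == L) = (x \notin L).
    apply/eqP/idP => [<-|xL]; first by rewrite !inE eqxx.
    by rewrite setU1K.
  apply: eq_big => [L|L /andP[_]].
    rewrite xLP setU11 andbT subUset sub1set xW /= /W' subsetD1 -!andbA; congr (_ && _).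
    rewrite andbC; case: (boolP (x \in L)) => //= xL; apply: eq_forallb => i.
    rewrite fiber_cardU1 // /l1 -/i0 [i0 == _]eq_sym; case: (eqVneq i i0) => [->|//].
    by rewrite add1n -[in LHS](prednK (n := l i0)) ?lt0n.
  rewrite xLP => xL; congr (_ ^+ _); rewrite /crossings big_setU1 //=.
  rewrite big1 ?add0n => [|y].
    apply: eq_bigr => y _; apply: eq_bigl => z; rewrite !inE negb_or.
    by case: (z == x); rewrite ?andbF ?andbT.
  rewrite !inE negb_or -andbA => /and3P[yx _ yW].
  by rewrite olt_asym // x_max.
(* If [l] asks for a colour after i0, of which W has none, all three coefficients vanish. *)
have [/existsP[i /andP[lti li]]|no_top] := boolP [exists i : 'I_b, olt i0 i && (l i != 0%N)].
  have ii0 : (i == i0) = false by apply: contraTF lti => /eqP ->; rewrite oltxx.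
  have li_gt0 : (0 < l i)%N by rewrite lt0n.
  rewrite (@merge_coef_small (fiber_card W' col) l i) ?top0 //.
  rewrite (@merge_coef_small (fiber_card W' col) l1 i) ?top0 // /l1 ?ii0 //.
  rewrite (@merge_coef_small (fiber_card W col) l i) ?if_same ?mulr0 ?addr0 //.
  by rewrite MW top0 // -/i0 eq_sym ii0.
have l_top (i : 'I_b) : olt i0 i -> l i = 0%N.
  move=> lti; apply: contraNeq no_top => li; apply/existsP; exists i.
  by rewrite lti.
pose lt := (\sum_(i : 'I_b | olt i i0) l i)%N.
have -> : (\sum_i l i)%N = (l i0 + lt)%N.
  rewrite (bigD1 i0) //=; congr (_ + _)%N.
  rewrite (bigID (fun i : 'I_b => olt i i0)) /= [X in (_ + X)%N]big1 ?addn0 => [|i /andP[ne]].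
    apply: eq_bigl => i; case: eqVneq => [->|//]; by rewrite oltxx.
  by have /orP[->|/l_top] := olt_total ne.
rewrite /merge_coef !(bigD1 i0 (P := xpredT)) //=.
set E := (X in _ * (_ * X) + _ = _); rewrite -/lt.
have lt1 : (\sum_(i' : 'I_b | olt i' i0) l1 i' = lt)%N.
  by apply: eq_bigr => i; rewrite /l1; case: eqVneq => [->|//]; rewrite oltxx.
have rest M1 l2 : (forall i, i != i0 -> M1 i = fiber_card W' col i) ->
    (forall i, i != i0 -> l2 i = l i) ->
    \prod_(i < b | i != i0) (q ^+ ((M1 i - l2 i) * \sum_(i' : 'I_b | olt i' i) l2 i')
      * qbinom q (M1 i) (l2 i)) = E.
  move=> M1E l2E; apply: eq_bigr => i ii0; rewrite M1E // l2E //.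
  have /orP[lti|lti] := olt_total ii0; last by rewrite top0 // sub0n !mul0n.
  congr (_ ^+ (_ * _) * _); apply: eq_bigr => i' lti'; apply: l2E.
  by apply: contraTneq lti' => ->; rewrite olt_asym.
rewrite !rest //; first last.
- by move=> i /negPf ii0; rewrite /l1 ii0.
- by move=> i /negPf ii0; rewrite MW -/i0 eq_sym ii0.
have l1i0 : l1 i0 = (l i0).-1 by rewrite /l1 eqxx.
rewrite MW eqxx add1n lt1 !l1i0.
move: (fiber_card W' col i0) (l i0) => M0 [|k] /=.
  by rewrite addr0 !qbinom0 !subn0 ?add0n mulSn exprD !mulr1 mulrA.
rewrite qbinomS !subSS mulrDr mulrDl addrC; congr (_ + _).
(* With truncated subtraction, M0 - k exceeds M0 - (k + 1) by one only if k < M0; otherwise the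
   binomial is zero. *)
have [lek|ltk] := leqP k.+1 M0; last first.
  by rewrite (qbinom_small q ltk) !(mulr0, mul0r).
have -> : (M0 - k = (M0 - k.+1).+1)%N by lia.
rewrite mulSn !exprD; ring.
Qed.

End SubsetSums.

(** * Coset representatives between Young subgroups, and the multiplication rule *)

Section BlockMoves.
Variables (R : comPzRingType) (q : R) (n b : nat) (e : bool).
Variables (c c' : 'I_n -> nat) (s t : nat).
Hypotheses (c_mono : {homo c : k l / (k <= l)%N}) (c'_mono : {homo c' : k l / (k <= l)%N}).
Hypotheses (st : s != t) (c't : forall x, c' x = t -> c x = t).
Hypotheses (c_nt : forall x, c x <> t -> c' x = c x).
Hypotheses (c_t : forall x, c x = t -> c' x = t \/ c' x = s).
Hypotheses (ord_st : forall x y, c x = t -> c' x = s -> c' y = t -> olt e x y).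
Implicit Types (u v w : 'S_n) (l : 'I_b -> nat).

(** [c'] relabels part of the level t of [c] as s, and [K] is the part that stays. A representative
    of Y_c modulo Y_r is determined by the image of [K], a subset of [Q]. *)
Let Q : {set 'I_n} := [set x | c x == t].
Let K : {set 'I_n} := [set x | c' x == t].
Let r (k : 'I_n) : nat := (c k + c' k)%N.

Let KQ : K \subset Q.
Proof. by apply/subsetP=> x; rewrite !inE => /eqP/c't ->. Qed.

Let r_mono : {homo r : k l / (k <= l)%N}.
Proof. by move=> k l kl; apply: leq_add; [apply: c_mono | apply: c'_mono]. Qed.

Let r_young v : (v \in young r) = (v \in young c) && (v \in young c').
Proof. exact: young_homoD. Qed.

Lemma young_imset v (A : {set 'I_n}) x : (v x \in v @: A) = (x \in A).
Proof. by rewrite (mem_imset _ _ perm_inj). Qed.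

Lemma young_level v k : v \in young c' -> (v k \in K) = (k \in K).
Proof. by move=> /youngP vP; rewrite !inE vP. Qed.

Lemma young_moved v : v \in young c -> (forall k, (v k \in K) = (k \in K)) -> v \in young r.
Proof.
move=> vY vK; rewrite r_young vY; apply/youngP=> k; have cv := youngP _ _ vY k.
have := vK k; rewrite !inE; have [ct|cnt] := eqVneq (c k) t; last first.
  by move=> _; rewrite !c_nt //; apply/eqP; rewrite ?cv.
have [kt|ks] := c_t ct; first by rewrite kt eqxx => /eqP.
have [vt|vs] := c_t (etrans cv ct); last by rewrite vs ks.
by rewrite vt ks eqxx (negPf st).
Qed.

Lemma young_with_image (L : {set 'I_n}) : L \subset Q -> #|L| = #|K| ->
  exists v, [/\ v \in young c, blockwise r v & v @: K = L].
Proof.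
(* The labels x + 2 force v0 to fix every point outside [Q]; the labels 0 and 1 make it carry [K]
   onto [L] inside. *)
move=> LQ LK; pose f (A : {set 'I_n}) x := if x \in Q then (x \in A : nat) else (x + 2)%N.
have card_f (A : {set 'I_n}) a : A \subset Q -> #|[set k | f A k == a]|
     = (match a with 0 => #|Q| - #|A| | 1 => #|A| | a'.+2 =>
           #|[set k : 'I_n | (k \notin Q) && (k == a' :> nat)]| end)%N.
  move=> AQ; case: a => [|[|a]].
  - rewrite -(cardsDS AQ); apply: eq_card => x; rewrite in_setD in_set /f.
    by case: (x \in Q); case: (x \in A); rewrite //= ?addn2.
  - apply: eq_card => x; rewrite in_set /f; have := subsetP AQ x.
    case: (x \in Q); case: (x \in A); rewrite //= ?addn2 // => H; by have := H isT.
  - apply: eq_card => x; rewrite [LHS]in_set [RHS]in_set /f.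
    case: (x \in Q) => /=; first by case: (x \in A).
    by rewrite addn2.
have [|v0 v0E] := @perm_of_fibers _ (f L) (f K).
  by move=> a; rewrite !card_f // LK.
have v0Q x : (v0 x \in Q) = (x \in Q).
  have := v0E x; rewrite /f; case: (v0 x \in Q); case: (x \in Q) => //.
    by case: (_ \in L) => /=; lia.
  by case: (_ \in K) => /=; lia.
have v0L x : (v0 x \in L) = (x \in K).
  have := v0E x; rewrite /f v0Q; have := v0Q x.
  case: (boolP (x \in Q)) => xQ v0xQ.
    by case: (_ \in L); case: (_ \in K).
  move=> _; rewrite (contraNF (subsetP LQ _)) ?v0xQ //.
  by rewrite (contraNF (subsetP KQ _)).
have v0Y : v0 \in young c.
  apply/youngP=> x; have [xQ|xQ] := boolP (x \in Q).
    by have := v0Q x; rewrite xQ; move: xQ; rewrite !inE => /eqP -> /eqP.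
  have := v0E x; rewrite /f v0Q (negPf xQ) => /eqP; rewrite eqn_add2r => /eqP/val_inj.
  by move=> ->.
have [v bv] := young_sort r_mono v0; set y := (_ * _)%g => yY; exists v.
have vE : (v = y^-1 * v0)%g by rewrite /y invMg invgK mulgKV.
have /andP[ycV yc'V] : ((y^-1)%g \in young c) && ((y^-1)%g \in young c').
  by rewrite -r_young youngVE.
split=> //; first by rewrite vE youngM.
apply/setP=> x; rewrite -[x](permKV v); move: ((v^-1)%g x) => k.
by rewrite young_imset [in RHS]vE permM v0L young_level.
Qed.

Lemma young_image_inj v v' : v \in young c -> v' \in young c ->
  blockwise r v -> blockwise r v' -> v @: K = v' @: K -> v = v'.
Proof.
move=> vY v'Y bv bv' vv'; have E : (v = (v * v'^-1) * v')%g by rewrite mulgKV.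
suff yY : (v * v'^-1)%g \in young r.
  by rewrite {}E in bv *; rewrite (young_blockwise1 r_mono yY bv' bv) mul1g.
apply: young_moved => [|k]; first by rewrite youngM ?youngV.
by rewrite -(young_imset v') -vv' -permM mulgKV young_imset.
Qed.

(** Since v preserves the levels of [c] and is increasing on those of [c + c'], an inversion
    involves an element of [K] and a relabelled one. The relabelled elements come before [K], so
    such a pair is inverted exactly when the image of the element of [K] comes first. *)
Lemma ninv_crossings v : v \in young c -> blockwise r v ->
  ninv v = crossings e Q (v @: K).
Proof.
move=> vY bv; have vP := youngP _ _ vY.
have vQ x : (v x \in Q) = (x \in Q) by rewrite !inE vP.
(* A crossing lists the element of [K] first, an inversion the smaller element; these orders are
   opposite when [e] is true. *)
pose h (p : 'I_n * 'I_n) := if e then (p.2, p.1) else p.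
have hK : involutive h by rewrite /h; case: e => -[].
pose f (p : 'I_n * 'I_n) := h (v^-1 p.1, v^-1 p.2)%g.
have f_inj : injective f.
  by move=> [a1 a2] [b1 b2] /(inv_inj hK)[/perm_inj -> /perm_inj ->].
rewrite /crossings pair_big_dep /= -big_mkcondr /= sum1dep_card -(card_imset _ f_inj).
rewrite /ninv; apply: eq_card => p; rewrite !inE.
have -> : p = f (v (h p).1, v (h p).2).
  by rewrite /f /= !permK -surjective_pairing hK.
rewrite (mem_imset _ _ f_inj) in_set /= in_setD !young_imset vQ.
set a := (h p).1; set d := (h p).2; rewrite /f /= !permK !in_set.
apply/idP/idP => [inv_ad|/andP[/andP[/eqP aK /andP[/negP dK /eqP dQ]] lt_ad]]; last first.
  have ds : c' d = s by case: (c_t dQ) => // /eqP.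
  by have := ord_st dQ ds aK; move: lt_ad; rewrite /h /olt; case: (e) => /= -> ->.
have sep (x y : 'I_n) : (x < y)%N -> (v y < v x)%N ->
    (c x = t /\ c y = t) /\ (c' x = t /\ c' y = s \/ c' x = s /\ c' y = t).
  move=> xy vyx; have cxy : c x = c y.
    apply/eqP; rewrite eqn_leq (c_mono (ltnW xy)) -(vP x) -(vP y).
    exact: c_mono (ltnW vyx).
  have c'xy : c' x <> c' y.
    move=> c'xy; have /blockwiseP/(_ x y) := bv; rewrite /r cxy c'xy => /(_ erefl xy).
    by rewrite ltnNge ltnW.
  have [cx|cx] := eqVneq (c x) t; last first.
    by case: c'xy; rewrite !c_nt // -?cxy //; apply/eqP.
  have cy : c y = t by rewrite -cxy.
  by split=> //; case: (c_t cx) (c_t cy) c'xy => [] -> [] -> //; auto.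
have {}sep : ((c d = t /\ c a = t) /\ (c' d = t /\ c' a = s \/ c' d = s /\ c' a = t))
    /\ olt e (v a) (v d) /\ ~~ olt e a d.
  move: inv_ad; rewrite /h /olt; case: (e) => /= /andP[lt1 lt2].
    by split; [exact: sep lt1 lt2|rewrite lt2 -leqNgt ltnW].
  have [[ca cd] c'_or] := sep _ _ lt1 lt2; rewrite lt2 -leqNgt ltnW //; do 2 split=> //.
  by case: c'_or => -[c'a c'd]; auto.
have [[[cd ca] c'_or] [lt_ad nad]] := sep.
case: c'_or => -[c'd c'a]; last by rewrite c'a c'd cd eqxx (negPf st) lt_ad.
by case/negP: nad; apply: ord_st.
Qed.

Lemma fiber_card_imset v (A : {set 'I_n}) (col : 'I_n -> 'I_b) i :
  fiber_card (v @: A) col i = fiber_card A (fun x => col (v x)) i.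
Proof.
rewrite /fiber_card -[RHS](card_imset _ (@perm_inj _ v)); apply: eq_card => x.
by rewrite -[x](permKV v) (mem_imset _ _ perm_inj) !in_set young_imset.
Qed.

Lemma sum_block_perms (col : 'I_n -> 'I_b) l :
    {in Q &, forall x y, olt e (col x) (col y) -> olt e x y} -> (\sum_i l i)%N = #|K| ->
  \sum_(v in young c | blockwise r v && [forall i, fiber_card (v @: K) col i == l i])
     q ^+ ninv v = merge_coef q e (fiber_card Q col) l.
Proof.
move=> col_mono sum_l; rewrite -sum_subset_crossings //.
rewrite (partition_big (fun v : 'S_n => v @: K)
  (fun L => (L \subset Q) && [forall i, fiber_card L col i == l i])) /=; last first.
  move=> v /and3P[vY _ ->]; rewrite andbT; apply/subsetP=> _ /imsetP[x xK ->].
  by have := subsetP KQ x xK; rewrite !in_set (youngP _ _ vY).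
apply: eq_bigr => L /andP[LQ Ll].
have LK : #|L| = #|K|.
  rewrite -sum_l -(sum_fiber_card _ col); apply: eq_bigr => i _.
  exact: (eqP (forallP Ll i)).
have [v0 [v0Y bv0 v0K]] := young_with_image LQ LK.
rewrite (big_pred1 v0) => [|v]; first by rewrite ninv_crossings // v0K.
apply/andP/eqP => [[/and3P[vY bv _] /eqP vK]|->].
  by apply: young_image_inj => //; rewrite vK.
by rewrite v0Y bv0 v0K Ll eqxx.
Qed.

(** The product of [young_elt c] with the representatives of the w in [D] having l_i entries i in
    [K] is computed in two ways. It factors through [young_elt c'] by [young_elt_product]. On the
    other hand, writing w = v u, [young_elt c] absorbs T_v with the factor q ^ ninv v, and these
    powers add up to the merge coefficient of the coset of u. *)
Lemma sum_merge_coef (col : 'I_n -> 'I_b) (D : {set 'S_n}) l :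
    (forall k k' : 'I_n, (k <= k')%N -> (col k <= col k')%N) ->
    young_closed c D -> young_closed c' D -> (\sum_i l i)%N = #|K| ->
  exists X Y, \sum_(w in D) merge_coef q e (fiber_card Q (fun x => col (w x))) l *: Tperm q w
    = X * young_elt q c' * Y.
Proof.
move=> col_mono cD c'D sum_l.
pose D' := [set w in D | [forall i, fiber_card K (fun x => col (w x)) i == l i]].
have c'D' : young_closed c' D'.
  move=> v w vY; rewrite !in_set => /andP[wD /forallP wl].
  rewrite c'D //; apply/forallP=> i; rewrite -(eqP (wl i)) eq_sym.
  have vK : v @: K = K.
    apply/setP=> x; rewrite -[x](permKV v); move: ((v^-1)%g x) => k.
    by rewrite young_imset young_level.
  rewrite -{1}vK fiber_card_imset; apply/eqP/eq_card => x.
  by rewrite !in_set permM.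
have [X [Y XY]] := young_elt_product q c_mono c'_mono c'D'; exists X, Y; rewrite -{}XY.
pose F w : hecke q n := if (w \in D') && blockwise r w then young_elt q c * Tperm q w else 0.
transitivity (\sum_(w in D) F w); last first.
  rewrite [RHS]big_mkcond [LHS]big_mkcond /=; apply: eq_bigr => w _; rewrite /F.
  by case: (boolP (w \in D)) => // wD; rewrite in_set (negPf wD).
rewrite !(sum_young_closed c_mono _ cD); apply: eq_bigr => u /andP[uD bu].
have FE v : v \in young c -> F (v * u)%g
    = if blockwise r v && [forall i, fiber_card (v @: K) (fun x => col (u x)) i == l i]
      then q ^+ ninv v *: (young_elt q c * Tperm q u) else 0.
  move=> vY; rewrite /F; congr (if _ then _ else _).
    rewrite andbC in_set cD //=; congr (_ && _).
      have vP := youngP _ _ vY; have uP := blockwiseP _ _ bu.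
      apply/blockwiseP/blockwiseP => bv k k' rk kk'; have := bv k k' rk kk'; rewrite permM permM.
        have ck : c k = c k'.
          apply/eqP; rewrite eqn_leq (c_mono (ltnW kk')).
          by have := c'_mono (ltnW kk'); move: rk; rewrite /r; lia.
        have [//|lt|/val_inj->] := ltngtP (v k) (v k'); last by rewrite ltnn.
        by have := uP _ _ _ lt; rewrite !vP => /(_ (esym ck))/ltnW; rewrite leqNgt => /negPf ->.
      apply: uP; rewrite !vP; apply/eqP; rewrite eqn_leq (c_mono (ltnW kk')).
      by have := c'_mono (ltnW kk'); move: rk; rewrite /r; lia.
    apply: eq_forallb => i; rewrite fiber_card_imset; congr (_ == _).
    by apply: eq_card => x; rewrite !in_set permM.
  by rewrite (@Tperm_young _ q _ c v u c_mono) // mulrA young_elt_Tperm // -hscaleAl.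
rewrite (eq_bigr _ FE) -big_mkcondr /= -scaler_suml sum_block_perms //; last first.
  move=> x y; rewrite !in_set => /eqP xQ /eqP yQ lt.
  have uP := blockwiseP _ _ bu; have cxy : c x = c y by rewrite xQ.
  have up (x1 y1 : 'I_n) : c x1 = c y1 -> (col (u x1) < col (u y1))%N -> (x1 < y1)%N.
    move=> cE; apply: contraLR; rewrite -!leqNgt leq_eqVlt => /predU1P[/val_inj -> //|lt1].
    exact: col_mono (ltnW (uP _ _ (esym cE) lt1)).
  by move: lt; rewrite /olt; case: (e); apply: up.
rewrite mulr_suml scaler_sumr; apply: eq_bigr => v vY.
rewrite (@Tperm_young _ q _ c v u c_mono) //; congr (_ *: _).
apply: eq_merge_coef => // i; rewrite /fiber_card.
have vQ : v @: Q = Q.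
  apply/setP=> x; rewrite -[x](permKV v); move: ((v^-1)%g x) => k.
  by rewrite young_imset !in_set (youngP _ _ vY).
rewrite -[RHS]/(fiber_card Q _ i) -{2}vQ fiber_card_imset.
by apply: eq_card => x; rewrite !in_set permM.
Qed.

End BlockMoves.

Lemma bin2_double k : ('C(k, 2) * 2 + k = k * k)%N.
Proof. by elim: k => // k IHk; rewrite binS bin1; lia. Qed.

(** * Inversion of the multiplication rule *)

Section Straightening.
Variables (R : comPzRingType) (q qV : R) (n b : nat) (e : bool).
Hypothesis qK : q * qV = 1.
Variables (d : 'I_b) (N : 'I_b -> nat) (D : nat).
Hypotheses (Nd : N d = 0%N) (le_Dn : (D <= n)%N).
Implicit Types (M f : 'I_b -> nat) (h : {ffun 'I_b -> 'I_n.+1}).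

Lemma sum_olt_split f (i : 'I_b) :
  (\sum_j f j = f i + (\sum_(j : 'I_b | olt e j i) f j + \sum_(j : 'I_b | olt e i j) f j))%N.
Proof.
rewrite (bigD1 i) //=; congr (_ + _)%N.
rewrite (bigID (fun j : 'I_b => olt e j i)) /=; congr (_ + _)%N; apply: eq_bigl => j.
  by case: eqVneq => [->|//]; rewrite oltxx.
have [->|ji] := eqVneq j i; first by rewrite oltxx.
by have /orP[lt|lt] := olt_total e ji; rewrite lt (olt_asym lt).
Qed.

Lemma exchange_olt f f' :
  (\sum_i f i * (\sum_(j : 'I_b | olt e j i) f' j)
   = \sum_i f' i * (\sum_(j : 'I_b | olt e i j) f j))%N.
Proof.
under eq_bigr => i _ do rewrite big_distrr.
rewrite (exchange_big_dep xpredT) //=; apply: eq_bigr => i _.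
by rewrite big_distrr; apply: eq_bigr => j _; rewrite mulnC.
Qed.

(** Two elements of a coloured set have either the same colour or two different ones. Doubling
    avoids the division in C(k, 2). *)
Lemma bin2_sum_olt f : ('C(\sum_i f i, 2)
  = \sum_i ('C(f i, 2) + f i * \sum_(j : 'I_b | olt e j i) f j))%N.
Proof.
apply/eqP; rewrite -(eqn_pmul2r (isT : 0 < 2)%N) -(eqn_add2r (\sum_i f i)%N) bin2_double.
pose L i := (\sum_(j : 'I_b | olt e j i) f j)%N.
have -> : ((\sum_i ('C(f i, 2) + f i * L i)) * 2 + \sum_i f i
    = \sum_i (f i * f i + f i * L i) + \sum_i f i * L i)%N.
  rewrite big_distrl -!big_split /=; apply: eq_bigr => i _.
  by rewrite -bin2_double; lia.
rewrite {2}/L exchange_olt -big_split big_distrl; apply/eqP/eq_bigr => i _ /=.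
by rewrite (sum_olt_split f i) !mulnDr addnA.
Qed.

(* The coefficient of F^(D-|h|) F_>^(c) F_<^(a) in F_d^(D), times that of the type with
   multiplicities N + h in F_>^(c) F_<^(a) X; here a is the sum of h over olt e i d. *)
Definition exch_weight h : R :=
  (-1) ^+ (\sum_i h i)%N * q ^+ 'C(\sum_i h i, 2)
  * qV ^+ ((\sum_(i : 'I_b | olt e i d) h i) * D.-1)
  * \prod_i (q ^+ (h i * \sum_(i' : 'I_b | olt e i' i) N i') * qbinom q (N i + h i) (h i)).

(** Here f is the excess M - N. Once exponents are collected, the entry i contributes a q-binomial
    sum in the variable [x f i], with general term [G f i]; the indicator in [G] imposes h_d = 0. *)
Let x f (i : 'I_b) : R := q ^+ (\sum_(j : 'I_b | olt e i j) f j)%N * qV ^+ (olt e i d * D.-1).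

Let G f (i : 'I_b) (k : nat) : R :=
  ((i == d) ==> (k == 0%N))%:R *
  (qbinom q (N i + f i) (f i) * ((-1) ^+ k * q ^+ 'C(k, 2) * x f i ^+ k * qbinom q (f i) k)).

(** C(|h|, 2) contributes h_i h_j for each pair of distinct entries, and the exponent of the merge
    coefficient contributes the opposite. What remains is C(h_i, 2) plus terms linear in h, hence a
    product over the entries. *)
Lemma exch_weight_merge f h : h d = 0%N :> nat ->
  exch_weight h * merge_coef q e (fun i => N i + f i)%N (fun i => N i + h i)%N
  = q ^+ (\sum_i f i * \sum_(j : 'I_b | olt e j i) N j)%N * \prod_i G f i (h i).
Proof.
move=> hd; have [/existsP[i lt_i]|le_hf] := boolP [exists i, (f i < h i)%N].
  rewrite (@merge_coef_small _ _ _ _ _ _ i) ?ltn_add2l // mulr0.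
  by rewrite [\prod_i G f i (h i)](bigD1 i) //= /G (qbinom_small q lt_i) !(mulr0, mul0r).
have {}le_hf i : (h i <= f i)%N.
  by rewrite leqNgt; apply: contra le_hf => lt_i; apply/existsP; exists i.
rewrite /exch_weight /merge_coef /G !big_split /= !prodrXr.
rewrite [\prod_i (_ ==> _)%:R]big1 ?mul1r => [|i _]; last first.
  by case: eqVneq => //= ->; rewrite hd.
have tri : \prod_i qbinom q (N i + h i) (h i) * \prod_i qbinom q (N i + f i) (N i + h i)
    = \prod_i qbinom q (N i + f i) (f i) * \prod_i qbinom q (f i) (h i).
  by rewrite -!big_split; apply: eq_bigr => i _; rewrite /= mulrC qbinom_trinomial.

have xE : \prod_i x f i ^+ h i = q ^+ (\sum_i h i * \sum_(j : 'I_b | olt e i j) f j)%N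
    * qV ^+ ((\sum_(i : 'I_b | olt e i d) h i) * D.-1).
  rewrite [in X in _ * X]big_mkcond big_distrl /= -!prodrXr -big_split; apply: eq_bigr => i _.
  rewrite /x exprMn -!exprM mulnC; congr (_ * _ ^+ _).
  by case: (olt _ _ _); rewrite ?mul1n ?mul0n // mulnC.
rewrite xE; set a := \prod_i qbinom q (N i + h i) (h i).
set a' := \prod_i qbinom q (N i + f i) (N i + h i).
rewrite -/a -/a' in tri.
transitivity ((-1) ^+ (\sum_i h i)%N * qV ^+ ((\sum_(i : 'I_b | olt e i d) h i) * D.-1) * (a * a')
  * q ^+ ('C(\sum_i h i, 2) + (\sum_i h i * \sum_(i' : 'I_b | olt e i' i) N i' +
     \sum_i (N i + f i - (N i + h i)) * \sum_(i' : 'I_b | olt e i' i) (N i' + h i')))%N).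
  by rewrite !exprD; ring.
have -> : ('C(\sum_i h i, 2) + (\sum_i h i * \sum_(i' : 'I_b | olt e i' i) N i' +
     \sum_i (N i + f i - (N i + h i)) * \sum_(i' : 'I_b | olt e i' i) (N i' + h i')))%N
   = (\sum_i f i * \sum_(j : 'I_b | olt e j i) N j + (\sum_i 'C(h i, 2)
       + \sum_i h i * \sum_(j : 'I_b | olt e i j) f j))%N.
  rewrite bin2_sum_olt -exchange_olt -!big_split /=; apply: eq_bigr => i _.
  rewrite subnDl big_split /=; have := le_hf i; nia.
rewrite tri !exprD; ring.
Qed.

(** If there is excess beyond d, the last such j has x = 1 and the factor t = 0 vanishes. Otherwise
    the first j with excess lies before d; the entries after it have total excess D - f_j, so x =
    q^(1 - f_j) and the factor t = f_j - 1 vanishes. This is why the weight carries the power D - 1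
    of the inverse of q. *)
Lemma prod_geometric_eq0 f : (\sum_i f i)%N = D -> ~~ [forall i, f i == ((i == d) * D)%N] ->
  exists2 j, j != d & \prod_(t < f j) (1 - q ^+ t * x f j) = 0.
Proof.
move=> sum_f f_n.
have zero (j : 'I_b) t : (t < f j)%N -> q ^+ t * x f j = 1 ->
    \prod_(t < f j) (1 - q ^+ t * x f j) = 0.
  by move=> lt_t tx; rewrite (bigD1 (Ordinal lt_t)) //= tx subrr mul0r.
pose A := [set j : 'I_b | olt e d j && (0 < f j)%N].
have [A0|A_n0] := eqVneq A set0; last first.
  have [j] := olt_max e A_n0; rewrite inE => /andP[dj fj] jmax.
  exists j; first by apply: contraTneq dj => ->; rewrite oltxx.
  apply: (zero _ 0%N) => //; rewrite /x olt_asym // mul0n !expr0 mul1r mulr1 big1 ?expr0 // => i ji.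
  apply/eqP; rewrite -leqn0 leqNgt; apply/negP => fi.
  have iA : i \in A by rewrite inE fi (olt_trans dj).
  have ij : i != j by apply: contraTneq ji => ->; rewrite oltxx.
  by have := jmax i iA ij; rewrite (olt_asym ji).
have f_gt (i : 'I_b) : olt e d i -> f i = 0%N.
  move=> di; apply/eqP; rewrite -leqn0 leqNgt; apply/negP => fi.
  by have := in_set0 i; rewrite -A0 inE di fi.
pose B := [set j : 'I_b | (0 < f j)%N].
have [i0 i0d i0f] : exists2 i, i != d & (0 < f i)%N.
  move: f_n; rewrite negb_forall => /existsP[i]; have [->|id] := eqVneq i d.
    rewrite mul1n => fd; apply/exists_inP; apply: contraNT fd; rewrite negb_exists_in.
    move=> /forall_inP f0; rewrite -sum_f (bigD1 d) //= big1 ?addn0 // => j /f0.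
    by rewrite -eqn0Ngt => /eqP.
  by rewrite mul0n -lt0n => fi; exists i.
have B_n0 : B != set0 by apply/set0Pn; exists i0; rewrite inE.
have [j] := olt_max (~~ e) B_n0; rewrite inE => fj jmin.
have olt_neg (u v : nat) : olt (~~ e) u v = olt e v u by rewrite /olt; case: e.
have jd : olt e j d.
  have i0d' : olt e i0 d.
    by have /orP[//|/f_gt] := olt_total e i0d; move: i0f; case: (f i0).
  have [<-//|ne] := eqVneq i0 j.
  by apply: olt_trans i0d'; rewrite -olt_neg jmin // inE.
exists j; first by apply: contraTneq jd => ->; rewrite oltxx.
apply: (zero _ (f j).-1); first by rewrite prednK.
rewrite /x jd mul1n mulrA -exprD.
have -> : ((f j).-1 + \sum_(i : 'I_b | olt e j i) f i = D.-1)%N.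
  have := sum_olt_split f j; rewrite sum_f [X in (_ + (X + _))%N]big1 => [|i ij].
    by move=> ->; rewrite add0n -{2}(prednK fj).
  apply/eqP; rewrite -leqn0 leqNgt; apply/negP => fi.
  have ne : i != j by apply: contraTneq ij => ->; rewrite oltxx.
  have := jmin i; rewrite inE => /(_ fi ne); rewrite olt_neg olt_asym //.
by rewrite -exprMn qK expr1n.
Qed.

(** M is a possible content of row t. Summed over h, all contributions cancel unless M consists of N
    and D entries d. *)
Lemma sum_exch_weight M : (\sum_i M i = \sum_i N i + D)%N ->
  \sum_(h : {ffun 'I_b -> 'I_n.+1} | h d == 0%N :> nat)
     exch_weight h * merge_coef q e M (fun i => N i + h i)%N
  = if [forall i, M i == (N i + (i == d) * D)%N]
    then q ^+ (D * \sum_(j : 'I_b | olt e j d) N j) else 0.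
Proof.
move=> sum_M; have [/existsP[i lt_i]|le_NM] := boolP [exists i, (M i < N i)%N].
  rewrite ifF; last first.
    apply/negP => /forallP/(_ i)/eqP Mi; move: lt_i; rewrite Mi ltnNge leq_addr //.
  apply: big1 => h _; rewrite (@merge_coef_small _ _ _ _ _ _ i) ?mulr0 //.
  exact: leq_trans lt_i (leq_addr _ _).
have {}le_NM i : (N i <= M i)%N.
  by rewrite leqNgt; apply: contra le_NM => lt_i; apply/existsP; exists i.
have [f Mf] : exists f, forall i, M i = (N i + f i)%N.
  by exists (fun i => M i - N i)%N => i; rewrite subnKC.
have sum_f : (\sum_i f i)%N = D.
  apply/(@addnI (\sum_i N i)%N); rewrite -sum_M -big_split /=.
  by apply: eq_bigr => i _; rewrite -Mf.
have le_fD i : (f i < n.+1)%N.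
  by rewrite ltnS (leq_trans _ le_Dn) // -sum_f (bigD1 i) //= leq_addr.
(* Distributivity turns the sum over functions h into a product of sums; the functions with h_d <> 0
   may be added because [G] vanishes on them. *)
transitivity (q ^+ (\sum_i f i * \sum_(j : 'I_b | olt e j i) N j)%N
    * \prod_i \sum_(k < n.+1) G f i k).
  rewrite bigA_distr_bigA mulr_sumr /= [RHS](bigID (fun h => h d == 0%N :> nat)) /=.
  rewrite [X in _ = _ + X]big1 ?addr0 => [|h hd].
    apply: eq_bigr => h /eqP hd; rewrite -exch_weight_merge //; congr (_ * _).
    by apply: eq_merge_coef.
  by rewrite [\prod_i _](bigD1 d) //= /G eqxx (negPf hd) !mul0r mulr0.
have GE i : i != d -> \sum_(k < n.+1) G f i k
    = qbinom q (N i + f i) (f i) * \prod_(t < f i) (1 - q ^+ t * x f i).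
  move=> /negPf id; rewrite -(@qbinom_theorem _ _ n.+1) // mulr_sumr.
  by apply: eq_bigr => k _; rewrite /G id mul1r.
have Gd : \sum_(k < n.+1) G f d k = 1.
  rewrite big_ord_recl big1 ?addr0 => [|k _]; rewrite /G eqxx /= ?mul0r //.
  by rewrite Nd add0n qbinomnn qbinom0 !expr0 !mulr1.
have -> : [forall i, M i == (N i + (i == d) * D)%N] = [forall i, f i == ((i == d) * D)%N].
  by apply: eq_forallb => i; rewrite Mf eqn_add2l.
case: ifPn => [/forallP fE|/(prod_geometric_eq0 sum_f)[j jd pj0]]; last first.
  by rewrite [\prod_i _](bigD1 j) //= GE // pj0 mulr0 mul0r mulr0.
rewrite [X in _ * X]big1 ?mulr1 => [|i _].
  rewrite (bigD1 d) //= [X in (_ + X)%N]big1 ?addn0 => [|i /negPf id]; last first.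
    by rewrite (eqP (fE i)) id.
  by rewrite (eqP (fE d)) eqxx mul1n.
have [->//|id] := eqVneq i d; rewrite GE // (eqP (fE i)) (negPf id) big_ord0.
by rewrite qbinom0 mulr1.
Qed.

End Straightening.

(** * Sums over tableaux of a given type *)

Section TypeSums.
Variables (R : comPzRingType) (q : R) (n : nat) (la nu : composition n).
Implicit Types (S : typed_tableau la nu) (w u v : 'S_n).
Local Notation H := (hecke q n).

Definition lev (k : 'I_n) : nat := row_of la k.

Definition row_set (j : nat) : {set 'I_n} := [set k | lev k == j].

Definition type_perms S : {set 'S_n} :=
  [set w : 'S_n | [forall j : 'I_(size la), forall i : 'I_(size nu),
     fiber_card (row_set j) (fun k => row_of nu (w k)) i == cnt S i j]].

Lemma type_permsP S w :
  reflect (forall (j : 'I_(size la)) i,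
     fiber_card (row_set j) (fun k => row_of nu (w k)) i = cnt S i j) (w \in type_perms S).
Proof.
rewrite inE; apply: (iffP forallP) => [wS j i|wS j]; last by apply/forallP=> i; apply/eqP.
by have /forallP/(_ i)/eqP := wS j.
Qed.

Lemma fiber_card_stable v (A : {set 'I_n}) (f : 'I_n -> 'I_(size nu)) i :
  (forall k, (v k \in A) = (k \in A)) -> fiber_card A (fun k => f (v k)) i = fiber_card A f i.
Proof.
move=> vA; have vAA : v @: A = A.
  apply/setP=> x; rewrite -[x](permKV v); move: ((v^-1)%g x) => k.
  by rewrite young_imset vA.
by rewrite -{2}vAA fiber_card_imset.
Qed.

Lemma type_perms_closed S : young_closed lev (type_perms S).
Proof.
move=> v w /youngP vP /type_permsP wS; apply/type_permsP => j i; rewrite -wS.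
rewrite -[RHS](@fiber_card_stable v) => [|k]; last by rewrite !inE vP.
by apply: eq_card => k; rewrite !inE permM.
Qed.

Lemma type_perms_closedr S v w : v \in young (fun k => row_of nu k) ->
  w \in type_perms S -> (w * v)%g \in type_perms S.
Proof.
move=> /youngP vP /type_permsP wS; apply/type_permsP => j i; rewrite -wS.
by apply: eq_card => k; rewrite !inE permM (val_inj (vP (w k))).
Qed.

Lemma tabd_tact u : tabd (tact (tinit la) u) = u.
Proof. by apply/esym/tabd_uniq. Qed.

Lemma tact_tinitE u (x : node la) : tact (tinit la) u x = u (tinit_fun la x).
Proof. by rewrite /= ffunE. Qed.

Lemma RStd_blockwise u : (tact (tinit la) u \in RStd la) = blockwise lev u.
Proof.
have col_lt (k l : 'I_n) : lev k = lev l ->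
    (nodecol (node_of la k) < nodecol (node_of la l))%N = (k < l)%N.
  move=> kl; rewrite -(flatten_index_node la k) -(flatten_index_node la l).
  by rewrite /flatten_index -[X in take X]/(lev k)
    -[X in (_ < sumn (take X _) + _)%N]/(lev l) kl ltn_add2l.
rewrite inE; apply/forallP/blockwiseP => [tP k l kl lt_kl|uP x].
  have /forallP/(_ (node_of la l))/implyP := tP (node_of la k).
  rewrite !tact_tinitE !node_ofK col_lt // lt_kl andbT; apply.
  exact/eqP.
apply/forallP=> y; apply/implyP=> /andP[/eqP xy lt_xy]; rewrite !tact_tinitE.
have levE z : lev (tinit_fun la z) = noderow z by rewrite /lev row_of_tinit.
by apply: uP; rewrite -?col_lt ?levE // !tinit_funK.
Qed.

Lemma card_nodes (P : node la -> bool) :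
  #|[set x | P x]| = #|[set k | P (node_of la k)]|.
Proof.
rewrite -(card_imset _ (can_inj (node_ofK la))); apply: eq_card => x.
by rewrite -[x]tinit_funK (mem_imset _ _ (can_inj (node_ofK la))) !inE.
Qed.

Lemma cnt_tab_type u (j : nat) (i : 'I_(size nu)) :
  cnt (tab_type nu (tact (tinit la) u)) i j
  = fiber_card (row_set j) (fun k => row_of nu (u k)) i.
Proof.
rewrite /cnt card_nodes; apply: eq_card => k; rewrite !inE ffunE tact_tinitE node_ofK.
by rewrite -val_eqE.
Qed.

(** If U x < V x, the nodes of the row of x with V-value at most U x all lie strictly to the left of
    x, while U takes such values at all those nodes and at x itself; the counts then differ. *)
Lemma row_weak_inj S1 S2 :
  (forall x y, noderow x = noderow y -> (nodecol x < nodecol y)%N -> (S1 x <= S1 y)%N) ->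
  (forall x y, noderow x = noderow y -> (nodecol x < nodecol y)%N -> (S2 x <= S2 y)%N) ->
  (forall (j : 'I_(size la)) (i : 'I_(size nu)), cnt S1 i j = cnt S2 i j) -> S1 = S2.
Proof.
move=> S1_mono S2_mono cnt12.
have half (U V : typed_tableau la nu) x :
    (forall x y, noderow x = noderow y -> (nodecol x < nodecol y)%N -> (U x <= U y)%N) ->
    (forall x y, noderow x = noderow y -> (nodecol x < nodecol y)%N -> (V x <= V y)%N) ->
    (forall (j : 'I_(size la)) (i : 'I_(size nu)), cnt U i j = cnt V i j) -> (V x <= U x)%N.
  move=> U_mono V_mono cntUV; rewrite leqNgt; apply/negP => lt_UV.
  pose below (W : typed_tableau la nu) := [set y | (noderow y == noderow x) && (W y <= U x)%N].
  have card_below W : #|below W| = (\sum_(i < size nu | (i <= U x)%N) cnt W i (noderow x))%N.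
    rewrite -sum1_card (partition_big W (fun i => (i <= U x)%N)) /=; last first.
      by move=> y; rewrite inE => /andP[].
    apply: eq_bigr => i le_i; rewrite sum1dep_card; apply: eq_card => y; rewrite !inE.
    by rewrite -andbA -val_eqE; case: eqP => //= _; case: eqP => [->|]; rewrite ?le_i ?andbF.
  pose B := [set y : node la | (noderow y == noderow x) && (nodecol y < nodecol x)%N].
  have VB : below V \subset B.
    apply/subsetP=> y; rewrite !inE => /andP[/eqP yx Vy]; rewrite yx eqxx /= ltnNge.
    apply/negP; rewrite leq_eqVlt => /predU1P[xy|/(V_mono _ _ (esym yx))].
      by move: Vy; rewrite (node_inj yx (esym xy)) leqNgt lt_UV.
    by move/leq_trans/(_ Vy); rewrite leqNgt lt_UV.
  have BU : x |: B \subset below U.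
    rewrite subUset sub1set !inE eqxx leqnn /=; apply/subsetP=> y; rewrite !inE.
    by move=> /andP[/eqP yx lt_yx]; rewrite yx eqxx U_mono.
  have xB : x \notin B by rewrite inE ltnn andbF.
  have := leq_trans (subset_leq_card BU) (eq_leq (card_below U)).
  rewrite cardsU1 xB; have jE : noderow x = tag x by [].
  rewrite (eq_bigr (fun i : 'I_(size nu) => cnt V i (noderow x))); last first.
    by move=> i _; rewrite jE cntUV.
  by rewrite -card_below ltnNge subset_leq_card.
apply/ffunP=> x; apply/val_inj/eqP; rewrite eqn_leq !half //.
Qed.

(** For row-standard s the permutation d(s) is a minimal coset representative, so m_la T_d(s) is the
    sum of T_w over its coset. *)
Lemma sum_type_tableaux S : S \in rowstd_tableaux la nu ->
  \sum_(s in RStd la | tab_type nu s == S) m_elt q la * Tperm q (tabd s)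
  = \sum_(w in type_perms S) Tperm q w.
Proof.
rewrite inE => /andP[_ /forallP S_mono].
rewrite (sum_young_left q (@row_of_mono _ la) (@type_perms_closed S)) mulr_sumr m_eltE.
rewrite (reindex_onto (fun u => tact (tinit la) u) (@tabd _ la)) /=; last first.
  by move=> s _; rewrite -tabdE.
apply: eq_big => [u|u _]; last by rewrite tabd_tact.
rewrite tabd_tact eqxx andbT RStd_blockwise andbC; case: (boolP (blockwise lev u)) => // bu.
  rewrite !andbT; apply/eqP/type_permsP => [<- j i|uS]; first by rewrite cnt_tab_type.
  apply: row_weak_inj => [x y xy lt_xy|x y xy lt_xy|j i].
  - rewrite ![tab_type _ _ _]ffunE; apply: (@row_of_mono _ nu); apply: ltnW.
    have /forallP/(_ y)/implyP H : [forall y, (noderow x == noderow y) &&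
        (nodecol x < nodecol y)%N ==> (tact (tinit la) u x < tact (tinit la) u y)%N].
      by move: bu; rewrite -RStd_blockwise inE => /forallP.
    by apply: H; apply/andP; split=> //; apply/eqP.
  - by have /forallP/(_ y)/implyP := S_mono x; apply; rewrite xy eqxx lt_xy.
  - by rewrite cnt_tab_type uS.
by rewrite !andbF.
Qed.

End TypeSums.

(** * Existence of the homomorphisms Theta_S *)

Section ThetaExistence.
Variables (R : comPzRingType) (q : R) (n : nat) (la nu : composition n).
Implicit Types (S : typed_tableau la nu).
Local Notation H := (hecke q n).

Lemma ideal_piZ (h : H^c) (x : H) :
  h *: ideal_pi (murphy_gt la) x = ideal_pi (murphy_gt la) (x * (h : H)).
Proof. exact: ideal_quot_actE. Qed.

(** The sum over the permutations of type S is both X m_nu and m_la Y, as its index set is stable on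
    both sides. Left multiplication by X is therefore defined on M^nu and takes values in the Specht
    module. *)
Lemma Theta_ex S : S \in rowstd_tableaux la nu -> exists f, theta_spec (q := q) S f.
Proof.
move=> rS; rewrite /theta_spec sum_type_tableaux //.
have [X XE] := sum_young_right q (@row_of_mono _ nu) (@type_perms_closedr _ la nu S).
rewrite XE -m_eltE.
have [Y YE] : exists Y, X * m_elt q nu = m_elt q la * Y.
  by rewrite m_eltE -XE (sum_young_left q (@row_of_mono _ la) (@type_perms_closed _ _ _ S))
     -m_eltE; eexists.
have in_cyc (x : perm_module q nu) :
    ideal_pi (murphy_gt la) (X * (cyclic_val x : H))
      \in in_cyclic (ideal_pi (murphy_gt la) (m_elt q la)).
  have /asboolP[h ->] := valP x; apply/asboolP; exists ((Y * (h : H)) : H^c).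
  by rewrite ideal_piZ mulrA -YE -mulrA.
pose f x : specht q la := Cyclic (in_cyc x).
have f_lin : linear f.
  move=> h x y; apply: val_inj; rewrite /= ideal_piZ -mulrA -ideal_piD -mulrDr.
  by [].
pose fL := GRing.isLinear.Build _ _ _ _ f f_lin.
pose F : {linear perm_module q nu -> specht q la} := HB.pack f fL.
by exists F.
Qed.

End ThetaExistence.

(** * Relabelling elements between adjacent rows *)

Section RowMoves.
Variables (R : comPzRingType) (q qV : R) (n : nat) (la : composition n).
Hypothesis qK : q * qV = 1.

Local Notation lev := (lev la).
Local Notation row_set := (row_set la).

Lemma card_row_set j : #|row_set j| = nth 0%N la j.
Proof. exact: card_row_of. Qed.

(** Raising the threshold by one adds at most one element, so every size up to |Q| occurs. Cutting a
    row at a threshold keeps the relabelled level function monotone. *)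
Lemma card_below_ex (Q : {set 'I_n}) k : (k <= #|Q|)%N ->
  exists m, #|[set x in Q | (x < m)%N]| = k.
Proof.
suff H m : (k <= #|[set x in Q | (x < m)%N]|)%N -> exists m, #|[set x in Q | (x < m)%N]| = k.
  move=> kQ; apply: (H n); rewrite (leq_trans kQ) // subset_leq_card //.
  by apply/subsetP=> x xQ; rewrite inE xQ ltn_ord.
elim: m => [|m IHm].
  rewrite [X in (_ <= X)%N](_ : _ = 0%N) ?leqn0 => [/eqP ->|].
    by exists 0%N; apply/eqP; rewrite cards_eq0; apply/eqP/setP=> x; rewrite !inE andbF.
  by apply/eqP; rewrite cards_eq0; apply/eqP/setP=> x; rewrite !inE andbF.
rewrite leq_eqVlt => /predU1P[->|lt_k]; first by exists m.+1.
apply: IHm; rewrite -ltnS; apply: leq_trans lt_k _.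
have [lt_mn|le_nm] := ltnP m n; last first.
  apply/ltnW; rewrite ltnS subset_leq_card //; apply/subsetP=> x; rewrite !inE => /andP[-> _].
  exact: leq_trans (ltn_ord x) le_nm.
apply: leq_trans (_ : #|Ordinal lt_mn |: [set x in Q | (x < m)%N]| <= _)%N; last first.
  by rewrite cardsU1; case: (_ \notin _).
apply/subset_leq_card/subsetP=> x; rewrite !inE => /andP[-> ].
by rewrite ltnS leq_eqVlt -val_eqE.
Qed.

Definition moved_lev (A : {set 'I_n}) (s : nat) (x : 'I_n) : nat := if x \in A then s else lev x.

Lemma card_moved_lev (A : {set 'I_n}) s t a : s != t -> A \subset row_set t ->
  #|[set x | moved_lev A s x == a]| = (if a == s then nth 0 la s + #|A|
    else if a == t then nth 0 la t - #|A| else nth 0 la a)%N.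
Proof.
move=> st AQ; have At x : x \in A -> lev x = t by move=> /(subsetP AQ); rewrite inE => /eqP.
case: eqVneq => [->|as_].
  have -> : [set x | moved_lev A s x == s] = row_set s :|: A.
    apply/setP=> x; rewrite !inE /moved_lev; case: (boolP (x \in A)); rewrite ?eqxx ?orbT ?orbF //.
  rewrite cardsU (_ : row_set s :&: A = set0) ?cards0 ?subn0 ?card_row_set //.
  apply/setP=> x; rewrite !inE; apply/negP => /andP[/eqP xs /At xt].
  by move: st; rewrite -xs xt eqxx.
case: eqVneq => [->|at_]; rewrite -!card_row_set.
  rewrite -(cardsDS AQ); apply: eq_card => x; rewrite !inE /moved_lev.
  by case: (x \in A); rewrite ?(negPf st).
apply: eq_card => x; rewrite !inE /moved_lev; case: (boolP (x \in A)) => // /At ->.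
by rewrite eq_sym (negPf as_) eq_sym (negPf at_).
Qed.

(** The partial sums of the new composition agree with those of [la] except over the first r + 1
    rows, where they are larger by k. *)
Lemma hecke_gt_moved r k (c : 'I_n -> nat) (sg : nat -> nat) :
    (r.+1 < size la)%N -> (0 < k <= nth 0 la r.+1)%N ->
    {homo c : x y / (x <= y)%N} -> injective sg ->
    (forall a, #|[set x | sg (c x) == a]| = (if a == r then nth 0 la r + k
      else if a == r.+1 then nth 0 la r.+1 - k else nth 0 la a)%N) ->
  hecke_gt la (young_elt q c).
Proof.
move=> lt_r /andP[k_gt0 le_k] c_mono sg_inj card_c.
pose nth_mu a := (if a == r then nth 0 la r + k
  else if a == r.+1 then nth 0 la r.+1 - k else nth 0 la a)%N.
pose mu := mkseq nth_mu (size la).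
have nthE a : nth 0%N mu a = nth_mu a.
  have [lt|le] := ltnP a (size la); first by rewrite nth_mkseq.
  rewrite nth_default ?size_mkseq // /nth_mu.
  by rewrite !gtn_eqF ?nth_default // (leq_trans _ le) // ltnW.
have sumE j : sumn (take j mu) = (sumn (take j la) + (j == r.+1) * k)%N.
  rewrite !sumn_take; elim: j => [|j IHj]; first by rewrite !big_ord0.
  rewrite !big_ord_recr /= IHj nthE /nth_mu eqSS.
  case: (eqVneq j r) => [->|jr]; first by rewrite (ltn_eqF (ltnSn r)) mul0n mul1n addn0 addnA.
  case: (eqVneq j r.+1) => [->|_]; last by rewrite !mul0n !addn0.
  by rewrite mul1n mul0n addn0 -addnA subnKC.
apply: (@hecke_gt_young_elt _ q qV n qK la c mu sg) => //.
- by move=> a; rewrite card_c nthE.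
- rewrite -[mu]take_size sumE size_mkseq take_size cparts_sum (gtn_eqF lt_r).
  by rewrite mul0n addn0.
- by move=> j; rewrite sumE leq_addr.
by exists r.+1; rewrite sumE eqxx mul1n -[X in (X < _)%N]addn0 ltn_add2l.
Qed.

(* The level function c is that of la with k elements of row t relabelled s; those
   elements precede the rest of row t in the order olt e. *)
Definition row_move (e : bool) (s t k : nat) (c : 'I_n -> nat) : Prop :=
  [/\ {homo c : x y / (x <= y)%N},
      [/\ forall x, c x = t -> lev x = t, forall x, lev x <> t -> c x = lev x
        & forall x, lev x = t -> c x = t \/ c x = s],
      forall x y : 'I_n, lev x = t -> c x = s -> c y = t -> olt e x y,
      #|[set x | c x == t]| = (nth 0 la t - k)%N
    & hecke_gt la (young_elt q c)].

Lemma moved_levP (A : {set 'I_n}) s t : s != t -> A \subset row_set t ->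
  [/\ forall x, moved_lev A s x = t -> lev x = t,
      forall x, lev x <> t -> moved_lev A s x = lev x
    & forall x, lev x = t -> moved_lev A s x = t \/ moved_lev A s x = s].
Proof.
move=> /eqP st AQ; have At x : x \in A -> lev x = t by move=> /(subsetP AQ); rewrite inE => /eqP.
rewrite /moved_lev; split=> x; case: (boolP (x \in A)) => //; auto.
by move=> /At.
Qed.

Lemma lev_mono : {homo lev : x y / (x <= y)%N}.
Proof. exact: row_of_mono. Qed.

Lemma row_move_up r k : (r.+1 < size la)%N -> (0 < k <= nth 0 la r.+1)%N ->
  exists c, row_move true r r.+1 k c.
Proof.
move=> lt_r k_bd; have /andP[_] := k_bd; rewrite -card_row_set => /card_below_ex[m mE].
set A := [set x in _ | _] in mE; exists (moved_lev A r).
have AQ : A \subset row_set r.+1 by apply/subsetP=> x; rewrite inE => /andP[].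
have st : r != r.+1 by rewrite ltn_eqF.
have AE x : (x \in A) = (lev x == r.+1) && (x < m)%N by rewrite !inE.
have c_mono : {homo moved_lev A r : x y / (x <= y)%N}.
  by move=> x y xy; have := lev_mono xy; rewrite /moved_lev !AE; case: ifP; case: ifP; lia.
split=> //.
- exact: moved_levP.
- by move=> x y; rewrite /moved_lev /olt !AE; case: ifP; case: ifP; lia.
- by rewrite (card_moved_lev _ st AQ) (gtn_eqF (ltnSn r)) eqxx mE.
apply: (@hecke_gt_moved r k _ id) => // a.
by rewrite (card_moved_lev _ st AQ) mE.
Qed.

(** The relabelled rows have sizes la_r - k and la_(r+1) + k. As la_r = la_(r+1), exchanging the two
    levels by [sg] gives the sizes la_r + k and la_(r+1) - k of an upward move. *)
Lemma row_move_down r k : (r.+1 < size la)%N -> nth 0%N la r = nth 0%N la r.+1 ->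
  (0 < k <= nth 0 la r)%N -> exists c, row_move false r.+1 r k c.
Proof.
move=> lt_r laE k_bd; have /andP[k_gt0 le_k] := k_bd.
have [m mE] : exists m, #|[set x in row_set r | (x < m)%N]| = (nth 0 la r - k)%N.
  by apply: card_below_ex; rewrite card_row_set leq_subr.
pose A := [set x in row_set r | (m <= x)%N]; exists (moved_lev A r.+1).
have AQ : A \subset row_set r by apply/subsetP=> x; rewrite inE => /andP[].
have st : r.+1 != r by rewrite gtn_eqF.
have AE x : (x \in A) = (lev x == r) && (m <= x)%N by rewrite !inE.
have cardA : #|A| = k.
  have := cardsID [set x : 'I_n | (x < m)%N] (row_set r).
  rewrite (_ : _ :&: _ = [set x in row_set r | (x < m)%N]); last by apply/setP=> x; rewrite !inE.
  rewrite (_ : _ :\: _ = A); last by apply/setP=> x; rewrite !inE -leqNgt andbC.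
  rewrite mE card_row_set => cE; apply: (@addnI (nth 0 la r - k)%N).
  by rewrite [RHS]subnK // -[RHS]cE.
have c_mono : {homo moved_lev A r.+1 : x y / (x <= y)%N}.
  by move=> x y xy; have := lev_mono xy; rewrite /moved_lev !AE; case: ifP; case: ifP; lia.
split=> //.
- exact: moved_levP.
- by move=> x y; rewrite /moved_lev /olt !AE; case: ifP; case: ifP; lia.
- by rewrite (card_moved_lev _ st AQ) (ltn_eqF (ltnSn r)) eqxx cardA.
pose sg a := (if a == r then r.+1 else if a == r.+1 then r else a).
have sgK : involutive sg.
  move=> a; rewrite /sg; case: (eqVneq a r) => [->|ar]; first by rewrite (gtn_eqF (ltnSn r)) eqxx.
  case: (eqVneq a r.+1) => [->|ar1]; first by rewrite eqxx.
  by rewrite (negPf ar) (negPf ar1).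
apply: (@hecke_gt_moved r k _ sg) => //; [by rewrite -laE|exact: inv_inj|].
move=> a; transitivity #|[set x | moved_lev A r.+1 x == sg a]|.
  by apply: eq_card => x; rewrite !inE (inv_eq sgK).
rewrite (card_moved_lev _ st AQ) cardA /sg -laE.
case: (eqVneq a r) => [_|ar]; first by rewrite eqxx.
case: (eqVneq a r.+1) => [_|ar1]; first by rewrite (ltn_eqF (ltnSn r)) eqxx.
by rewrite (negPf ar1) (negPf ar).
Qed.

End RowMoves.

(** * Straightening *)

Section IdealMembership.
Variables (R : comPzRingType) (q : R) (n : nat) (la : composition n).
Local Notation H := (hecke q n).

Lemma hecke_gt_sum (I : Type) (r : seq I) (P : pred I) (F : I -> H) :
  (forall i, P i -> hecke_gt la (F i)) -> hecke_gt la (\sum_(i <- r | P i) F i).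
Proof.
by move=> FP; elim/big_ind: _ => // [|x y]; [apply: tsideal0|apply: tsidealD].
Qed.

Lemma hecke_gtZ (a : R) (x : H) : hecke_gt la x -> hecke_gt la (a *: x).
Proof. by move=> xP; rewrite -[x]mul1r hscaleAl; apply: tsidealMl. Qed.

End IdealMembership.

Section StraighteningTypes.
Variables (R : comPzRingType) (q qV : R) (n : nat) (la nu : composition n).
Hypothesis qK : q * qV = 1.
Variables (S : typed_tableau la nu) (d : 'I_(size nu)) (e : bool) (s t : 'I_(size la)).
Hypotheses (st : s != t).
Hypothesis moves : forall k, (0 < k <= nth 0 la t)%N -> exists c, row_move q la e s t k c.
Implicit Types (w v : 'S_n) (g h : {ffun 'I_(size nu) -> 'I_n.+1}).
Local Notation H := (hecke q n).
Local Notation lev := (lev la).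
Local Notation row_set := (row_set la).

Let stN : (s : nat) != t. Proof. by []. Qed.

Definition rest_cnt (i : 'I_(size nu)) : nat := if i == d then 0%N else cnt S i t.

Let D : nat := cnt S d t.

Let cntE (i : 'I_(size nu)) : cnt S i t = (rest_cnt i + (i == d) * D)%N.
Proof. by rewrite /rest_cnt /D; case: eqVneq => [->|_]; rewrite ?mul1n ?mul0n ?addn0. Qed.

Let le_D : (D <= nth 0 la t)%N.
Proof. by rewrite -(sum_cnt S) (bigD1 d) //= leq_addr. Qed.

Let sum_rest : (\sum_i rest_cnt i + D = nth 0 la t)%N.
Proof.
rewrite -(sum_cnt S) (bigD1 d) //= [RHS](bigD1 d) //= /rest_cnt eqxx add0n addnC.
by congr (_ + _)%N; apply: eq_bigr => i /negPf ->.
Qed.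

Let row_fiber w (j : nat) i := fiber_card (row_set j) (fun k => row_of nu (w k)) i.

(** All the types reached from S by redistributing entries between rows s and t are gathered here.
    The set is stable under the Young subgroup of [la] and under that of every row move, as
    [sum_merge_coef] demands. *)
Definition two_row_perms : {set 'S_n} :=
  [set w : 'S_n | [forall i : 'I_(size nu),
     (fiber_card (row_set s :|: row_set t) (fun k => row_of nu (w k)) i
        == cnt S i s + cnt S i t)%N
     && [forall j : 'I_(size la), (j != s) && (j != t) ==> (row_fiber w j i == cnt S i j)]]].

Lemma fiber_cardU (A B : {set 'I_n}) (f : 'I_n -> 'I_(size nu)) i : A :&: B = set0 ->
  fiber_card (A :|: B) f i = (fiber_card A f i + fiber_card B f i)%N.
Proof.
move=> AB; rewrite /fiber_card.
have -> : [set y in A :|: B | f y == i] = [set y in A | f y == i] :|: [set y in B | f y == i].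
  by apply/setP=> y; rewrite !inE andb_orl.
rewrite cardsU (_ : _ :&: _ = set0) ?cards0 ?subn0 //.
apply/setP=> y; rewrite !inE; apply/negP => /andP[/andP[yA _] /andP[yB _]].
by have := in_set0 y; rewrite -AB inE yA yB.
Qed.

Let row_disj : row_set s :&: row_set t = set0.
Proof.
apply/setP=> y; rewrite !inE; apply/negP => /andP[/eqP ys /eqP yt].
by move: stN; rewrite -ys yt eqxx.
Qed.

Lemma type_perms_two_row (U : typed_tableau la nu) :
    (forall i : 'I_(size nu), (cnt U i s + cnt U i t = cnt S i s + cnt S i t)%N) ->
    (forall (i : 'I_(size nu)) (j : 'I_(size la)), j != s -> j != t -> cnt U i j = cnt S i j) ->
  forall w, (w \in type_perms U)
    = (w \in two_row_perms) && [forall i : 'I_(size nu), row_fiber w t i == cnt U i t].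
Proof.
move=> Ust Uj w; apply/type_permsP/andP => [wU|[+ /forallP wt]].
  split; last by apply/forallP=> i; rewrite /row_fiber wU.
  rewrite inE; apply/forallP=> i; rewrite fiber_cardU // !wU Ust eqxx /=.
  by apply/forallP=> j; apply/implyP=> /andP[js jt]; rewrite /row_fiber wU Uj.
rewrite inE => /forallP wB j i; have /andP[/eqP] := wB i.
rewrite fiber_cardU // -!/(row_fiber _ _ _) (eqP (wt i)) -Ust => ws /forallP/(_ j).
have [->|jt] := eqVneq j t; first by rewrite -(eqP (wt i)).
have [-> _|js /eqP] := eqVneq j s; first exact: addIn ws.
by rewrite Uj.
Qed.

Lemma two_row_perms_stable v :
    (forall k, (v k \in row_set s :|: row_set t) = (k \in row_set s :|: row_set t)) ->
    (forall (j : 'I_(size la)) k, j != s -> j != t -> (v k \in row_set j) = (k \in row_set j)) ->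
  forall w, w \in two_row_perms -> (v * w)%g \in two_row_perms.
Proof.
move=> vst vj w; rewrite !in_set => /forallP wB; apply/forallP=> i.
have /andP[w1 /forallP w2] := wB i; rewrite -(eqP w1); apply/andP; split.
  rewrite -[X in _ == X](fiber_card_stable (v := v)) //.
  by apply/eqP/eq_card => k; rewrite !inE permM.
apply/forallP=> j; apply/implyP=> /andP[js jt]; have := w2 j; rewrite js jt /=.
move=> /eqP <-; rewrite /row_fiber -[X in _ == X](fiber_card_stable (v := v)); last first.
  by move=> k; apply: vj.
by apply/eqP/eq_card => k; rewrite !inE permM.
Qed.

Lemma two_row_perms_closed : young_closed lev two_row_perms.
Proof.
move=> v w /youngP vP; apply: two_row_perms_stable => [k|j k _ _]; by rewrite !inE vP.
Qed.

Lemma two_row_perms_closed_move k c : row_move q la e s t k c -> young_closed c two_row_perms.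
Proof.
case=> _ [ct c_nt c_t] _ _ _ v w /youngP vP.
have c_st x : (x \in row_set s :|: row_set t) = (c x == s) || (c x == t).
  rewrite !inE; have [xt|xt] := eqVneq (lev x) t.
    by rewrite orbT; case: (c_t x xt) => ->; rewrite eqxx ?orbT.
  by rewrite c_nt ?(negPf xt) //; apply/eqP.
have c_j (j : 'I_(size la)) x : j != s -> j != t -> (x \in row_set j) = (c x == j).
  move=> js jt; rewrite inE; have [xt|xt] := eqVneq (lev x) t.
    have sj : (s == j :> nat) = false by rewrite eq_sym; apply: negPf js.
    have tj : (t == j :> nat) = false by rewrite eq_sym; apply: negPf jt.
    by rewrite xt tj; case: (c_t x xt) => ->; rewrite ?sj ?tj.
  by rewrite c_nt //; apply/eqP.
apply: two_row_perms_stable => [x|j x js jt]; first by rewrite !c_st vP.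
by rewrite !c_j // vP.
Qed.

Lemma sum_row_fiber w : (\sum_i row_fiber w t i = nth 0 la t)%N.
Proof. by rewrite sum_fiber_card card_row_set. Qed.

(** This is F^(D-|h|) applied to the type whose row t has multiplicities [rest_cnt] + h. The formula
    does not mention |h|, so that all h enter a single sum. *)
Let T h : H := \sum_(w in two_row_perms)
  merge_coef q e (row_fiber w t) (fun i => rest_cnt i + h i)%N *: Tperm q w.

(** The totals agree, so either some multiplicity in the row is too small and the coefficient is 0,
    or all are equal and it is 1. *)
Lemma merge_coef_full w h : (\sum_i h i)%N = D ->
  merge_coef q e (row_fiber w t) (fun i => rest_cnt i + h i)%N
  = [forall i, row_fiber w t i == rest_cnt i + h i]%N%:R.
Proof.
move=> sum_h; have sums : (\sum_i row_fiber w t i = \sum_i (rest_cnt i + h i))%N.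
  by rewrite sum_row_fiber big_split /= sum_h.
case: forallP => [wh|wh] /=.
  rewrite /merge_coef big1 // => i _; rewrite (eqP (wh i)) subnn mul0n expr0 mul1r.
  exact: qbinomnn.
have [/existsP[i lt_i]|le] := boolP [exists i, row_fiber w t i < rest_cnt i + h i]%N.
  exact: (@merge_coef_small _ _ _ _ _ _ i).
case: wh => i; rewrite eq_sym.
have {}le j : (rest_cnt j + h j <= row_fiber w t j)%N.
  by rewrite leqNgt; apply: contra le => lt_j; apply/existsP; exists j.
have [_] := leqif_sum (fun j (_ : xpredT j) => leqif_eq (le j)).
by rewrite sums eqxx => /esym/forall_inP/(_ i isT).
Qed.

(** For |h| > D row t is too short and the sum is zero; for |h| < D it factors through a row move of
    D - |h| elements. *)
Lemma sum_two_row_gt h : (\sum_i h i)%N != D -> hecke_gt la (T h).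
Proof.
rewrite neq_ltn => /orP[lt_h|gt_h]; last first.
  rewrite /T big1 => [|w wB]; first exact: tsideal0.
  have /existsP[i lt_i] : [exists i, row_fiber w t i < rest_cnt i + h i]%N.
    rewrite -[X in is_true X]negbK negb_exists; apply/negP => /forallP le.
    have : (\sum_i (rest_cnt i + h i) <= \sum_i row_fiber w t i)%N.
      by apply: leq_sum => i _; rewrite leqNgt le.
    by rewrite sum_row_fiber big_split /= -sum_rest leq_add2l leqNgt gt_h.
  by rewrite (@merge_coef_small _ _ _ _ _ _ i) // scale0r.
pose k := (D - \sum_i h i)%N.
have [c mv] : exists c, row_move q la e s t k c.
  by apply: moves; rewrite subn_gt0 lt_h (leq_trans (leq_subr _ _) le_D).
have cB := two_row_perms_closed_move mv; case: mv => c_mono [ct c_nt c_t] ord cardK cgt.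
have [|X [Y TE]] := sum_merge_coef q (@lev_mono n la) c_mono stN ct c_nt c_t ord
   (fun k k' kk' => @row_of_mono n nu k k' kk') two_row_perms_closed cB
   (l := fun i => rest_cnt i + h i)%N.
  by rewrite cardK big_split /= -sum_rest /k -addnBA ?leq_subr // subKn // ltnW.
rewrite /T TE; by apply: tsidealMr; apply: tsidealMl.
Qed.

Lemma type_perms_exch g : g \in exch_seqs S d t s ->
  \sum_(w in type_perms (exch S d t s g)) Tperm q w = T g.
Proof.
move=> gE; have := gE; rewrite inE => /and3P[/eqP gd /eqP sum_g /forallP le_g].
have ts : (t : nat) != s by rewrite eq_sym.
have cU (i : 'I_(size nu)) j := @cnt_exch _ _ _ S d t s g i j ts gE.
have U_t (i : 'I_(size nu)) : cnt (exch S d t s g) i t = (rest_cnt i + g i)%N.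
  rewrite cU /exch_cnt (negPf ts) eqxx /rest_cnt.
  by case: eqVneq => [->|//]; rewrite gd.
rewrite /T; transitivity (\sum_(w in two_row_perms |
    [forall i : 'I_(size nu), row_fiber w t i == cnt (exch S d t s g) i t]) Tperm q w).
  apply: eq_bigl => w; apply: type_perms_two_row => [i|i j js jt].
    rewrite U_t cU /exch_cnt eqxx /rest_cnt; case: eqVneq => [->|id].
      by rewrite gd !addn0.
    by rewrite addnCA addnC subnK.
  have jsN : (j == s :> nat) = false := negPf js.
  have jtN : (j == t :> nat) = false := negPf jt.
  by rewrite cU /exch_cnt jsN jtN.
rewrite big_mkcondr /=; apply: eq_bigr => w _; rewrite merge_coef_full //.
rewrite (eq_forallb (fun i => congr1 (eq_op _) (U_t i))).
by case: ifP => _; rewrite ?scale1r ?scale0r.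
Qed.

(** Row s does not hold enough entries of some kind, so no permutation contributes. *)
Lemma sum_two_row_out h : h d = 0%N :> nat -> (\sum_i h i)%N = D ->
  h \notin exch_seqs S d t s -> T h = 0.
Proof.
move=> hd sum_h; rewrite inE hd sum_h !eqxx /= negb_forall => /existsP[i].
rewrite -ltnNge => lt_i; apply: big1 => w; rewrite in_set => /forallP/(_ i)/andP[/eqP + _].
rewrite fiber_cardU // -!/(row_fiber _ _ _) merge_coef_full // => wst.
case: forallP => [/(_ i)/eqP wt|_]; last by rewrite scale0r.
move: wst; rewrite wt /rest_cnt; case: eqVneq => [id|_]; last by lia.
by move: lt_i; rewrite id hd.
Qed.

Lemma straighten_type : exists2 z, hecke_gt la z &
  \sum_(w in type_perms S) Tperm q w
  = \sum_(g in exch_seqs S d t s)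
      (qV ^+ (D * \sum_(j : 'I_(size nu) | olt e j d) rest_cnt j)
         * exch_weight q qV e d rest_cnt D g)
      *: (\sum_(w in type_perms (exch S d t s g)) Tperm q w) + z.
Proof.
have le_Dn : (D <= n)%N.
  by rewrite (leq_trans le_D) // -card_row_set (leq_trans (max_card _)) ?card_ord.
have rest_d : rest_cnt d = 0%N by rewrite /rest_cnt eqxx.
pose E := (D * \sum_(j : 'I_(size nu) | olt e j d) rest_cnt j)%N.
(* After exchanging the sums, the coefficient of T_w is that of [sum_exch_weight] for the content of
   row t under w, which leaves the w of type S. *)
have total : \sum_(h : {ffun 'I_(size nu) -> 'I_n.+1} | h d == 0%N :> nat)
      exch_weight q qV e d rest_cnt D h *: T h
    = q ^+ E *: (\sum_(w in type_perms S) Tperm q w).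
  under eq_bigr => h _ do rewrite scaler_sumr.
  rewrite exchange_big /= [X in _ = _ *: X](eq_bigl _ _ (type_perms_two_row _ _)) //.
  rewrite [X in _ = _ *: X]big_mkcondr /= scaler_sumr; apply: eq_bigr => w _.
  under eq_bigr => h _ do rewrite scalerA.
  rewrite -scaler_suml (sum_exch_weight e qK rest_d le_Dn); last by rewrite sum_row_fiber sum_rest.
  rewrite (eq_forallb (fun i => congr1 (eq_op _) (esym (cntE i)))).
  by case: ifP => _; rewrite ?scale0r ?scaler0.
pose z := \sum_(h : {ffun 'I_(size nu) -> 'I_n.+1} | (h d == 0%N :> nat)
   && ((\sum_i h i)%N != D)) exch_weight q qV e d rest_cnt D h *: T h.
exists (qV ^+ E *: z).
  by apply/hecke_gtZ/hecke_gt_sum => h /andP[_ hD]; apply/hecke_gtZ/sum_two_row_gt.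
have -> : \sum_(w in type_perms S) Tperm q w
    = qV ^+ E *: (q ^+ E *: (\sum_(w in type_perms S) Tperm q w)).
  by rewrite scalerA -exprMn mulrC qK expr1n scale1r.
rewrite -total (bigID (fun h => (\sum_i h i)%N == D)) /= -/z scalerDr; congr (_ + _).
rewrite scaler_sumr (bigID (fun h => h \in exch_seqs S d t s)) /=.
rewrite [X in _ + X]big1 ?addr0 => [|h /andP[/andP[/eqP hd /eqP hD] hE]]; last first.
  by rewrite sum_two_row_out // !scaler0.
apply: eq_big => [h|h /andP[_ hE]]; last by rewrite scalerA type_perms_exch.
by rewrite inE; case: (_ == 0%N); case: (_ == D).
Qed.

End StraighteningTypes.

(** * Passage to the Specht module and comparison of exponents *)

Section ThetaStraightening.
Variables (R : comPzRingType) (q qV : R) (n : nat) (la nu : composition n).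
Hypothesis qK : q * qV = 1.
Local Notation H := (hecke q n).

Lemma cyclic_val_sum (I : Type) (r : seq I) (P : pred I) (F : I -> specht q la) :
  cyclic_val (\sum_(i <- r | P i) F i) = \sum_(i <- r | P i) cyclic_val (F i).
Proof. exact: (big_morph (fun x : specht q la => cyclic_val x)). Qed.

Lemma ideal_pi0 : ideal_pi (murphy_gt la) (0 : H) = 0.
Proof. by apply: (addrI (ideal_pi (murphy_gt la) (0 : H))); rewrite -ideal_piD !addr0. Qed.

Lemma ideal_pi_sum (I : Type) (r : seq I) (P : pred I) (F : I -> H) :
  ideal_pi (murphy_gt la) (\sum_(i <- r | P i) F i)
  = \sum_(i <- r | P i) ideal_pi (murphy_gt la) (F i).
Proof. exact: (big_morph _ (@ideal_piD _ _) ideal_pi0). Qed.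

Lemma specht_scale_val (c : R) (x : specht q la) (y : H) :
  cyclic_val x = ideal_pi (murphy_gt la) y ->
  cyclic_val (specht_scale c x) = ideal_pi (murphy_gt la) (c *: y).
Proof.
by move=> xy; rewrite /= xy ideal_piZ -hscaleAr mulr1.
Qed.

Lemma specht_scaleA (a c : R) (x : specht q la) :
  specht_scale a (specht_scale c x) = specht_scale (a * c) x.
Proof.
rewrite /specht_scale scalerA; congr (_ *: _).
rewrite -[LHS]/((c *: (1 : H)) * (a *: (1 : H))).
by rewrite -hscaleAr mulr1 scalerA.
Qed.

Lemma specht_scale_sum (a : R) (I : Type) (r : seq I) (P : pred I) (F : I -> specht q la) :
  specht_scale a (\sum_(i <- r | P i) F i) = \sum_(i <- r | P i) specht_scale a (F i).
Proof. exact: scaler_sumr. Qed.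

Lemma Theta_val (S : typed_tableau la nu) (h : H^c) : S \in rowstd_tableaux la nu ->
  cyclic_val (Theta q S (h *: cyclic_gen _))
  = ideal_pi (murphy_gt la) ((\sum_(w in type_perms S) Tperm q w) * (h : H)).
Proof.
move=> rS; have := ThetaP (Theta_ex q rS); rewrite /theta_spec sum_type_tableaux // => ThE.
by rewrite linearZ /= ThE ideal_piZ.
Qed.

Lemma Theta_straighten (S : typed_tableau la nu) (d : 'I_(size nu)) (e : bool)
    (s t : 'I_(size la)) : s != t -> S \in rowstd_tableaux la nu ->
    (forall k, (0 < k <= nth 0 la t)%N -> exists c, row_move q la e s t k c) ->
  forall x, Theta q S x = \sum_(g in exch_seqs S d t s)
    specht_scale (qV ^+ (cnt S d t * \sum_(j : 'I_(size nu) | olt e j d) rest_cnt S d t j)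
         * exch_weight q qV e d (rest_cnt S d t) (cnt S d t) g)
      (Theta q (exch S d t s g) x).
Proof.
move=> st rS moves x; have [h ->] : exists h : H^c, x = h *: cyclic_gen _.
  by have /asboolP[h xE] := valP x; exists h; apply: val_inj.
apply: val_inj; rewrite /= cyclic_val_sum Theta_val //.
have [z zP ->] := straighten_type qK S d st moves.
rewrite mulrDl ideal_piD [X in _ + X](_ : _ = 0) ?addr0; last first.
  rewrite -ideal_pi0; apply/ideal_piP; rewrite subr0.
  by apply/asboolP/tsidealMr.
rewrite mulr_suml ideal_pi_sum; apply: eq_bigr => g gE; rewrite -hscaleAl.
apply/esym/specht_scale_val; rewrite Theta_val //.
by apply: exch_rowstd => //; rewrite eq_sym.
Qed.

Lemma expr_inv_eq a b c d : (a + d = c + b)%N -> q ^+ a * qV ^+ b = q ^+ c * qV ^+ d.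
Proof.
move=> E; have one k : q ^+ k * qV ^+ k = 1 by rewrite -exprMn qK expr1n.
rewrite -[LHS]mulr1 -(one d) -[RHS]mulr1 -(one b).
by rewrite [LHS]mulrACA [RHS]mulrACA -!exprD E (addnC b).
Qed.

Lemma cnt_lt_sum (S : typed_tableau la nu) i j :
  cnt_lt S i j = (\sum_(i' < size nu | (i' < i)%N) cnt S i' j)%N.
Proof.
rewrite /cnt_lt -sum1_card (partition_big S (fun i' => (i' < i)%N)) /=; last first.
  by move=> x; rewrite inE => /andP[].
apply: eq_bigr => i' lt_i; rewrite sum1dep_card; apply: eq_card => x; rewrite !inE.
by rewrite -andbA -val_eqE; case: eqP => //= _; case: eqP => [->|]; rewrite ?lt_i ?andbF.
Qed.

Lemma cnt_gt_sum (S : typed_tableau la nu) i j :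
  cnt_gt S i j = (\sum_(i' < size nu | (i < i')%N) cnt S i' j)%N.
Proof.
rewrite /cnt_gt -sum1_card (partition_big S (fun i' => (i < i')%N)) /=; last first.
  by move=> x; rewrite inE => /andP[].
apply: eq_bigr => i' lt_i; rewrite sum1dep_card; apply: eq_card => x; rewrite !inE.
by rewrite -andbA -val_eqE; case: eqP => //= _; case: eqP => [->|]; rewrite ?lt_i ?andbF.
Qed.

(** The theorem counts all entries of row t, the weight only those other than d. For an entry i
    beyond d the difference is a factor q^(D g_i); together these give q^(D a). *)
Lemma exch_weight_rest (S : typed_tableau la nu) (d : 'I_(size nu)) (e : bool)
    (t : 'I_(size la)) (s : nat) (g : {ffun 'I_(size nu) -> 'I_n.+1}) : g \in exch_seqs S d t s ->
  let D := cnt S d t in let below i := (\sum_(i' : 'I_(size nu) | olt e i' i) cnt S i' t)%N in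
  exists a, [/\ (\sum_(i : 'I_(size nu) | olt e i d) g i + a = D)%N,
    a = (\sum_(i : 'I_(size nu) | olt e d i) g i)%N &
    qV ^+ (D * \sum_(j : 'I_(size nu) | olt e j d) rest_cnt S d t j)
      * exch_weight q qV e d (rest_cnt S d t) D g * q ^+ (D * a)
    = qV ^+ (D * below d) * ((-1) ^+ D * q ^+ 'C(D, 2) * qV ^+ ((D - a) * D.-1))
       * \prod_i (q ^+ (g i * below i) * qbinom q (cnt S i t + g i) (g i))].
Proof.
rewrite inE => /and3P[/eqP gd /eqP sum_g _] D below.
pose a := (\sum_(i : 'I_(size nu) | olt e d i) g i)%N; exists a.
have sum_ga : (\sum_(i : 'I_(size nu) | olt e i d) g i + a = D)%N.
  by have := sum_olt_split e (fun i => g i : nat) d; rewrite gd sum_g add0n => <-.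
split=> //; rewrite /exch_weight sum_g -/D.
have -> : (\sum_(i : 'I_(size nu) | olt e i d) g i = D - a)%N by rewrite -sum_ga addnK.
have -> : (\sum_(j : 'I_(size nu) | olt e j d) rest_cnt S d t j = below d)%N.
  by apply: eq_bigr => j; rewrite /rest_cnt; case: eqVneq => [->|//]; rewrite oltxx.
have -> : \prod_i (q ^+ (g i * below i) * qbinom q (cnt S i t + g i) (g i))
    = q ^+ (D * a) * \prod_i (q ^+ (g i * \sum_(i' : 'I_(size nu) | olt e i' i) rest_cnt S d t i')
       * qbinom q (rest_cnt S d t i + g i) (g i)).
  rewrite /a big_distrr [in q ^+ _]big_mkcond -prodrXr -big_split; apply: eq_bigr => i _ /=.
  have -> : qbinom q (rest_cnt S d t i + g i) (g i) = qbinom q (cnt S i t + g i) (g i).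
    by rewrite /rest_cnt; case: eqVneq => [->|//]; rewrite gd !qbinom0.
  rewrite mulrA -exprD; congr (_ ^+ _ * _).
  have [di|di] := boolP (olt e d i).
    rewrite /below (bigD1 d) //= mulnDr mulnC -/D; congr (_ + _ * _)%N.
    rewrite [RHS](bigD1 d) //= {1}/rest_cnt eqxx add0n.
    by apply: eq_bigr => j /andP[_ /negPf jd]; rewrite /rest_cnt jd.
  rewrite add0n; congr (_ * _)%N; apply: eq_bigr => j ji; rewrite /rest_cnt.
  by case: eqVneq ji => [->|//]; rewrite (negPf di).
ring.
Qed.

End ThetaStraightening.

(* Rows are numbered from 0; d and i range over 'I_(size nu), numbered from 0. *)
Theorem theorem2p9 (R : comPzRingType) (q qV : R) (q_inv : q * qV = 1) (n : nat)
    (la nu : composition n) (la_part : is_partition la)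
    (S : typed_tableau la nu) (S_rowstd : S \in rowstd_tableaux la nu) :
  (forall (r : nat) (d : 'I_(size nu)), (r.+1 < size la)%N ->
     forall x : perm_module q nu,
       Theta q S x =
       specht_scale
         ((- 1) ^+ cnt S d r.+1
          * qV ^+ 'C((cnt S d r.+1).+1, 2)
          * qV ^+ (cnt S d r.+1 * cnt_lt S d r.+1))
         (\sum_(g in exch_seqs S d r.+1 r)
            specht_scale
              (q ^+ (\sum_(i < size nu | (i < d)%N) g i)
               * \prod_(i < size nu)
                   (q ^+ (g i * cnt_lt S i r.+1)
                    * qbinom q (cnt S i r.+1 + g i) (g i)))
              (Theta q (exch S d r.+1 r g) x)))
  /\
  (forall (r : nat) (d : 'I_(size nu)), (r.+1 < size la)%N ->
     nth 0%N la r = nth 0%N la r.+1 ->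
     forall x : perm_module q nu,
       Theta q S x =
       specht_scale
         ((- 1) ^+ cnt S d r
          * qV ^+ 'C(cnt S d r, 2)
          * qV ^+ (cnt S d r * cnt_gt S d r))
         (\sum_(g in exch_seqs S d r r.+1)
            specht_scale
              (qV ^+ (\sum_(i < size nu | (i < d)%N) g i)
               * \prod_(i < size nu)
                   (q ^+ (g i * cnt_gt S i r)
                    * qbinom q (cnt S i r + g i) (g i)))
              (Theta q (exch S d r r.+1 g) x))).

Proof.
have qU k : q ^+ k * qV ^+ k = 1 by rewrite -exprMn q_inv expr1n.
split=> r d lt_r => [|laE] x.
  pose s := Ordinal (ltnW lt_r); pose t := Ordinal lt_r.
  have st : s != t by rewrite -val_eqE /= ltn_eqF.
  have moves k : (0 < k <= nth 0 la t)%N -> exists c, row_move q la true s t k c.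
    exact: (@row_move_up _ q qV n la q_inv r k lt_r).
  rewrite (Theta_straighten q_inv d st S_rowstd moves) specht_scale_sum.
  apply: eq_bigr => g gE; rewrite specht_scaleA; congr specht_scale.
  have [a [sum_a _]] := exch_weight_rest q qV true gE; set w := _ * exch_weight _ _ _ _ _ _ _ => wE.
  transitivity (w * q ^+ (cnt S d t * a) * qV ^+ (cnt S d t * a)).
    by rewrite -mulrA qU mulr1.
  rewrite {}wE /=; under [X in _ = _ * (_ * X)]eq_bigr => i _ do rewrite cnt_lt_sum.
  rewrite cnt_lt_sum; set P := \prod_i _; set B := (\sum_(i' < _ | _) cnt S i' _)%N.
  have -> : (\sum_(i < size nu | (i < d)%N) g i = cnt S d t - a)%N by rewrite -sum_a addnK.
  have le_a : (a <= cnt S d t)%N by rewrite -sum_a leq_addl.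
  move: (cnt S d t) le_a => D le_a.
  (* The exponent C(D, 2) - (D - a)(D - 1) - D a equals -C(D, 2) - a, that is (D - a) - C(D + 1, 2),
     and D - a exchanged entries are smaller than d. *)
  have := @expr_inv_eq _ q qV q_inv 'C(D, 2) ((D - a) * D.-1 + D * a) (D - a) 'C(D.+1, 2).
  rewrite exprD => E.
  transitivity ((-1) ^+ D * qV ^+ (D * B) * P * (q ^+ (D - a) * qV ^+ 'C(D.+1, 2))).
    rewrite -E; first by ring.
    by clear -le_a; have := bin2_double D; rewrite binS bin1; case: D le_a => [|D] /=; nia.
  by ring.
pose t := Ordinal (ltnW lt_r); pose s := Ordinal lt_r.
have st : s != t by rewrite -val_eqE /= gtn_eqF.
have moves k : (0 < k <= nth 0 la t)%N -> exists c, row_move q la false s t k c.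
  exact: (@row_move_down _ q qV n la q_inv r k lt_r laE).
rewrite (Theta_straighten q_inv d st S_rowstd moves) specht_scale_sum.
apply: eq_bigr => g gE; rewrite specht_scaleA; congr specht_scale.
have [a [sum_a aE]] := exch_weight_rest q qV false gE; set w := _ * exch_weight _ _ _ _ _ _ _ => wE.
transitivity (w * q ^+ (cnt S d t * a) * qV ^+ (cnt S d t * a)).
  by rewrite -mulrA qU mulr1.
rewrite {}wE /=; under [X in _ = _ * (_ * X)]eq_bigr => i _ do rewrite cnt_gt_sum.
rewrite cnt_gt_sum -[X in qV ^+ X * \prod_i _]aE.
set P := \prod_i _; set B := (\sum_(i' < _ | _) cnt S i' _)%N.
have le_a : (a <= cnt S d t)%N by rewrite -sum_a leq_addl.
move: (cnt S d t) le_a => D le_a.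
(* The exponent is again -C(D, 2) - a; in the reversed order a itself counts the exchanged entries
   smaller than d. *)
have := @expr_inv_eq _ q qV q_inv 'C(D, 2) ((D - a) * D.-1 + D * a) 0 ('C(D, 2) + a).
rewrite !exprD => E.
transitivity ((-1) ^+ D * qV ^+ (D * B) * P * (q ^+ 0 * (qV ^+ 'C(D, 2) * qV ^+ a))).
  rewrite -E; first by ring.
  by clear -le_a; have := bin2_double D; case: D le_a => [|D] /=; nia.
by ring.
Qed.
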